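(* Let $K$ be an algebraically closed field of characteristic zero. For each of the families $\mathcal{S}e_\ast$ of smooth cubic surfaces defined in the context, the stabilizer $\mathrm{Stab}(S)\subset \mathrm{PGL}_4(K)$ of a generic surface $S\in\mathcal{S}e_\ast$ (of the unique surface $S$, when the family is a single surface), identified with a group of permutations of the $27$ lines of $S$ numbered $1,\dots,27$ as in the context, is the group generated by the permutations listed below, and it has the following isomorphism type and order: - $\mathcal{S}e_1$: $C_2$, order $2$, generated by $g_1$; - $\mathcal{S}e_1'$: $C_4$, order $4$, generated by $g_1'$; - $\mathcal{S}e_1''$: $C_8$, order $8$, generated by $g_1''$; - $\mathcal{S}e_2$: $C_2\times C_2$, order $4$, generated by $g_2,h_2$; - $\mathcal{S}e_3$: $S_3$, order $6$, generated by $g_3,h_3$; - $\mathcal{S}e_4$: $C_2\times S_3$, order $12$, generated by $g_4,h_4$; - $\mathcal{S}e_6$: $S_4$, order $24$, generated by $g_6,h_6$; - $\mathcal{S}e_9$: $((C_3\times C_3)\rtimes C_3)\rtimes C_2$, order $54$, generated by $g_9,h_9,k_9$; - $\mathcal{S}e_9'$: $((C_3\times C_3)\rtimes C_3)\rtimes C_4$, order $108$, generated by $g_9',h_9'$; - $\mathcal{S}e_{10}$: $S_5$, order $120$, generated by $g_{10},h_{10}$; - $\mathcal{S}e_{18}$: $(C_3\times C_3\times C_3)\rtimes S_4$, order $648$, generated by $g_{18},h_{18}$; where $g_1=g_3=g_4=g_9=h_2=(2,19)(3,22)(4,7)(5,25)(6,26)(8,13)(9,14)(11,16)(12,17)(18,27)(20,24)(21,23)$,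 $g_1'=(2,3,19,22)(4,21,7,23)(5,26,25,6)(8,16,13,11)(9,12,14,17)(18,24,27,20)$, $g_1''=(1,10)(2,11,3,8,19,16,22,13)(4,24,21,27,7,20,23,18)(5,17,26,9,25,12,6,14)$, $g_2=(1,15)(3,22)(4,8)(5,25)(6,26)(7,13)(9,18)(11,20)(12,21)(14,27)(16,24)(17,23)$, $h_3=h_9=(1,9,14)(2,19,10)(3,13,4)(5,21,17)(6,20,16)(7,8,22)(11,24,26)(12,23,25)(15,18,27)$, $h_4=(1,18,14,15,9,27)(2,19,10)(3,7,4,22,13,8)(5,12,17,25,21,23)(6,11,16,26,20,24)$, $g_6=(1,13)(2,10)(3,18)(5,20)(6,21)(7,15)(9,22)(11,25)(12,26)(14,27)(16,24)(17,23)$, $h_6=(1,3,15,22)(2,19)(4,13,14,18)(5,6)(7,27,9,8)(11,23,21,16)(12,24,20,17)(25,26)$, $k_9=(1,21,3)(2,7,13)(4,27,20)(5,26,19)(6,24,9)(8,12,14)(10,16,23)(11,15,22)(17,25,18)$, $g_9'=(2,3,19,22)(4,20,7,24)(5,6,25,26)(8,17,13,12)(9,11,14,16)(18,23,27,21)$, $h_9'=(1,4,6)(2,3,5)(7,10,12)(8,9,11)(13,22,27)(14,25,21)(15,26,17)(16,19,24)(18,23,20)$, $g_{10}=(1,13)(2,9)(4,19)(5,20)(6,21)(7,14)(10,22)(11,23)(12,24)(15,27)(16,26)(17,25)$, $h_{10}=(1,3,15,8,7)(2,9,22,27,19)(4,13,14,10,18)(5,17,11,24,21)(6,16,12,23,20)$,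 $g_{18}=(1,17)(2,5)(3,4,24,26)(6,14,22,15)(7,9,20,10)(8,19,16,18)(11,25,13,23)(21,27)$, $h_{18}=(1,26,7)(2,11,20)(3,8,18)(4,17,10)(5,9,23)(6,15,12)(13,16,14)(19,25,22)(21,27,24)$.
   Context: $K$ is an algebraically closed field of characteristic zero; $[x,y,z,t]$ are homogeneous coordinates on $\mathbb{P}^3_K$. For a smooth cubic surface $S$, $\mathrm{Stab}(S)=\{M\in\mathrm{PGL}_4(K)\mid M(S)=S\}$. Every $M\in\mathrm{Stab}(S)$ permutes the $27$ lines of $S$; this gives an injective homomorphism from $\mathrm{Stab}(S)$ to the permutation group of the $27$ lines, through which $\mathrm{Stab}(S)$ is regarded as a permutation group. $C_m$ is the cyclic group of order $m$, $S_m$ the symmetric group on $m$ letters. ''Generic'' means: for all parameter values in a non-empty Zariski open subset of the parameter space of the family. Families. For $b,c,d,e,f\in K$ with $c\neq0$ let $S_{b,c,d,e,f}$ be the cubic surface $$bc(t-x)(xz+yt)+c^{2}(z+t)(xz-yt)-cd(y-z)(xz+yt)+c(e+f)(x-y)(xz-yt)-ef(2x^{2}y-2xy^{2}+xz^{2}-xzt+yzt-yt^{2})=0 .$$ Fix $\sqrt{-1},\sqrt2,\sqrt3,\sqrt5\in K$ and put $\sqrt{-3}=\sqrt{-1}\sqrt3$. The families consist of the smooth surfaces $S_{b,c,d,e,f}$ whose parameters satisfy: - $\mathcal{S}e_1$: $\Lambda_1=\{b=-(c^2+ef)/c\}$; - $\mathcal{S}e_1'$: $\Lambda_1$ together with $e=\dfrac{(2\sqrt{-1}-1)c(5c-(4\sqrt{-1}-3)f)}{5(c-f)}$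 and $d=\dfrac{(2\sqrt{-1}+1)(5c^2-(4\sqrt{-1}+8)cf-5f^2)}{5(f-c)}$; - $\mathcal{S}e_1''$: the conditions of $\mathcal{S}e_1'$ together with $c=\sqrt{-1}-\sqrt2$, $f=3$; - $\mathcal{S}e_2$: $\Lambda_1\cup\{d=(c^2+ef)/c\}$; - $\mathcal{S}e_3$: $\Lambda_3=\Lambda_1\cup\{d=(3ef-c^2+cf+ce)/(2c)\}$; - $\mathcal{S}e_4$: $\Lambda_4=\Lambda_3\cup\{f=c(3c-e)/(c+e)\}$; - $\mathcal{S}e_6$: $\Lambda_3\cup\{f=-c(5c+e)/(c+e)\}$; - $\mathcal{S}e_9$: $\Lambda_9=\Lambda_3\cup\{e=\sqrt{-3}\,c\}$; - $\mathcal{S}e_9'$: $\Lambda_9$ together with $f=\frac14(\sqrt{-1}-\sqrt3)^3-(\sqrt{-1}-\sqrt3)-1$, $c=1$; - $\mathcal{S}e_{10}$: $\Lambda_4\cup\{e=(2-\sqrt5)c\}$; - $\mathcal{S}e_{18}$: $\Lambda_4\cup\{e=\sqrt{-3}\,c\}$. The families $\mathcal{S}e_1'',\mathcal{S}e_9',\mathcal{S}e_{10},\mathcal{S}e_{18}$ are each a single surface. Labels of the lines. The $27$ lines of a smooth cubic surface can be labelled $E_i,G_j$ ($1\le i,j\le6$), $F_{ij}$ ($1\le i<j\le6$), with incidences: $E_i$ meets $G_j$ iff $i\neq j$; $E_i$ (and likewise $G_i$) meets $F_{hk}$ iff $i\in\{h,k\}$; $F_{ij}$ meets $F_{hk}$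 iff $i,j,h,k$ are all distinct; no other pair of distinct lines meets. Each smooth $S_{b,c,d,e,f}$ contains the lines $$E_1:\ y=z=0,\quad G_4:\ x=y=0,\quad E_2:\ x=t=0,\quad G_3:\ x-t=y-z=0,\quad E_3:\ x-y=z+t=0,$$ and the line $E_5$ with Plücker coordinates $[p_{01},p_{02},p_{03},p_{12},p_{13},p_{23}]$ (coordinates of points being indexed $0,1,2,3$ in the order $x,y,z,t$, with $p_{ij}=P_iQ_j-P_jQ_i$ for two points $P,Q$ of the line) equal to $$[0,\ (f-c)AB,\ (c-f)A^2,\ (c+f)B^2,\ -(c+f)AB,\ -2fAB],\qquad A=cd-cf-ef,\quad B=bc-cf+ef .$$ These six labels determine the labels of all $27$ lines. The lines are numbered as follows: $E_1,\dots,E_6$ are $1,\dots,6$; $G_1,\dots,G_6$ are $7,\dots,12$; and $F_{12},F_{13},F_{14},F_{15},F_{16},F_{23},F_{24},F_{25},F_{26},F_{34},F_{35},F_{36},F_{45},F_{46},F_{56}$ are $13,\dots,27$ in this order. *)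

(* Defs.v *)
From HB Require Import structures.
From mathcomp Require Import all_boot all_order all_algebra all_fingroup.
From mathcomp Require Import mpoly.

Set Implicit Arguments.
Unset Strict Implicit.
Unset Printing Implicit Defensive.

Import GRing.Theory.
Import GroupScope.
Local Open Scope ring_scope.

(* Positions of the homogeneous coordinates x, y, z, t. *)
Definition ix : 'I_4 := inZp 0.
Definition iy : 'I_4 := inZp 1.
Definition iz : 'I_4 := inZp 2.
Definition it : 'I_4 := inZp 3.

Definition cubic (K : closedFieldType) (b c d e f : K) : {mpoly K[4]} :=
  let x := 'X_ix in let y := 'X_iy in let z := 'X_iz in let t := 'X_it in
  (b * c) *: ((t - x) * (x * z + y * t))
  + c ^+ 2 *: ((z + t) * (x * z - y * t))
  - (c * d) *: ((y - z) * (x * z + y * t))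
  + (c * (e + f)) *: ((x - y) * (x * z - y * t))
  - (e * f) *: (2%:R *: (x ^+ 2 * y) - 2%:R *: (x * y ^+ 2) + x * z ^+ 2
                - x * z * t + y * z * t - y * t ^+ 2).

(** Projective geometry: a point of P^3 is the class of a nonzero column
    vector, a line is a 2-dimensional subspace of K^4, and an element of
    PGL_4(K) is the class of an invertible matrix up to a nonzero scalar. *)
Section Geometry.
Variable K : closedFieldType.
Implicit Types (F : {mpoly K[4]}) (M : 'M[K]_4) (v w : 'cV[K]_4).
Implicit Types (l : {vspace 'cV[K]_4}).

Definition eval_at F v : K := F.@[fun i => v i 0].

Definition on_surface F v : Prop := v != 0 /\ eval_at F v = 0.

Definition smooth F : Prop :=
  forall v, on_surface F v -> exists i : 'I_4, eval_at F^`M(i) v != 0.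

(* M(S) = S, for S the surface F = 0. *)
Definition preserves F M : Prop :=
  forall v, on_surface F v <-> exists2 w, on_surface F w & v = M *m w.

Definition in_stab F M : Prop := M \in unitmx /\ preserves F M.

Definition same_in_PGL M1 M2 : Prop := exists2 k : K, k != 0 & M2 = k *: M1.

Definition line_of F l : Prop :=
  \dim l = 2%N /\ forall v, v \in l -> v != 0 -> on_surface F v.

Definition meet l1 l2 : bool := (l1 :&: l2)%VS != 0%VS.

Definition image_line M l : {vspace 'cV[K]_4} := (linfun (mulmx M) @: l)%VS.

(* The line l has Pluecker coordinates [p01, p02, p03, p12, p13, p23]. *)
Definition plucker l (p01 p02 p03 p12 p13 p23 : K) : Prop :=
  exists P Q : 'cV[K]_4, exists2 k : K, k != 0 &
    let pl i j := P i 0 * Q j 0 - P j 0 * Q i 0 in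
    l = (<[P]> + <[Q]>)%VS /\
    [:: pl ix iy; pl ix iz; pl ix it; pl iy iz; pl iy it; pl iz it]
      = [:: k * p01; k * p02; k * p03; k * p12; k * p13; k * p23].

End Geometry.

(** Labels and numbering of the 27 lines *)

(* Only the labels listed in [labels] are meaningful. *)
Inductive label := E of nat | G of nat | F of nat & nat.

Definition labels : seq label :=
  [:: E 1; E 2; E 3; E 4; E 5; E 6; G 1; G 2; G 3; G 4; G 5; G 6;
      F 1 2; F 1 3; F 1 4; F 1 5; F 1 6; F 2 3; F 2 4; F 2 5; F 2 6;
      F 3 4; F 3 5; F 3 6; F 4 5; F 4 6; F 5 6].

(* The line number n, for 1 <= n <= 27, is represented by the element n - 1
   of 'I_27. *)
Definition line_no (n : nat) : 'I_27 := inZp n.-1.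
Definition label_of (i : 'I_27) : label := nth (E 1) labels i.

Definition incident (a b : label) : bool :=
  match a, b with
  | E i, G j | G j, E i => i != j
  | E i, F h k | F h k, E i => i \in [:: h; k]
  | G i, F h k | F h k, G i => i \in [:: h; k]
  | F i j, F h k => uniq [:: i; j; h; k]
  | _, _ => false
  end.

Record labelling (K : closedFieldType) (b c d e f : K)
    (N : label -> {vspace 'cV[K]_4}) : Prop := Labelling {
  lab_line : forall i : 'I_27, line_of (cubic b c d e f) (N (label_of i));
  lab_inj : injective (fun i : 'I_27 => N (label_of i));
  lab_all : forall l, line_of (cubic b c d e f) l ->
    exists i : 'I_27, l = N (label_of i);
  lab_meet : forall i j : 'I_27, i != j ->
    meet (N (label_of i)) (N (label_of j))
      = incident (label_of i) (label_of j);
  lab_E1 : forall v, v \in N (E 1) <-> v iy 0 = 0 /\ v iz 0 = 0;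
  lab_G4 : forall v, v \in N (G 4) <-> v ix 0 = 0 /\ v iy 0 = 0;
  lab_E2 : forall v, v \in N (E 2) <-> v ix 0 = 0 /\ v it 0 = 0;
  lab_G3 : forall v, v \in N (G 3) <->
    v ix 0 - v it 0 = 0 /\ v iy 0 - v iz 0 = 0;
  lab_E3 : forall v, v \in N (E 3) <->
    v ix 0 - v iy 0 = 0 /\ v iz 0 + v it 0 = 0;
  lab_E5 : let A := c * d - c * f - e * f in
           let B := b * c - c * f + e * f in
    plucker (N (E 5)) 0 ((f - c) * A * B) ((c - f) * A ^+ 2)
      ((c + f) * B ^+ 2) (- (c + f) * A * B) (- 2%:R * f * A * B)
}.

(* M sends the line number i to the line number s i. *)
Definition induces (K : closedFieldType) (N : label -> {vspace 'cV[K]_4})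
    (M : 'M[K]_4) (s : 'S_27) : Prop :=
  forall i : 'I_27, image_line M (N (label_of i)) = N (label_of (s i)).

(* Every element of Stab(S) permutes the lines, the induced map from Stab(S)
   to 'S_27 is injective, and its image is H. *)
Definition stab_is (K : closedFieldType) (H : {set 'S_27})
    (b c d e f : K) : Prop :=
  let p := cubic b c d e f in
  forall N : label -> {vspace 'cV[K]_4}, labelling b c d e f N ->
  [/\ forall M, in_stab p M -> exists s, induces N M s,
      forall M1 M2 s, in_stab p M1 -> in_stab p M2 ->
        induces N M1 s -> induces N M2 s -> same_in_PGL M1 M2
    & forall s, (exists2 M, in_stab p M & induces N M s) <-> s \in H].

(** Families *)

Definition family (K : closedFieldType) := K -> K -> K -> K -> K -> Prop.

Definition zariski_open (K : closedFieldType) n (U : n.-tuple K -> Prop) :=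
  exists I : {mpoly K[n]} -> Prop,
    forall p, U p <-> exists2 q, I q & q.@[tnth p] != 0.

(* "For a generic member": the conclusion holds on a nonempty open subset of
   the set of parameters of P, with the topology induced by K^5. *)
Definition generically (K : closedFieldType) (P C : family K) : Prop :=
  exists U : 5.-tuple K -> Prop,
  [/\ zariski_open U,
      exists b c d e f, P b c d e f /\ U [tuple b; c; d; e; f]
    & forall b c d e f, P b c d e f -> U [tuple b; c; d; e; f] ->
        C b c d e f].

(* For a family consisting of one surface. *)
Definition for_the_surface (K : closedFieldType) (P C : family K) : Prop :=
  (exists b c d e f, P b c d e f) /\
  (forall b c d e f, P b c d e f -> C b c d e f).

(* The defining equations of each family come with the nonvanishing of the
   denominators which occur in them.  The arguments i1, r2, r3, r5 stand for
   the chosen square roots of -1, 2, 3 and 5. *)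
Section Families.
Variable K : closedFieldType.
Variables (i1 r2 r3 r5 : K).
Implicit Types b c d e f : K.

Let rm3 := i1 * r3.

Definition smooth_member b c d e f : Prop :=
  c != 0 /\ smooth (cubic b c d e f).

Definition Lambda1 b c d e f : Prop := b = - (c ^+ 2 + e * f) / c.

Definition Lambda3 b c d e f : Prop :=
  Lambda1 b c d e f /\
  d = (3%:R * e * f - c ^+ 2 + c * f + c * e) / (2%:R * c).

Definition Lambda4 b c d e f : Prop :=
  [/\ Lambda3 b c d e f, c + e != 0 & f = c * (3%:R * c - e) / (c + e)].

Definition Lambda9 b c d e f : Prop := Lambda3 b c d e f /\ e = rm3 * c.

Definition Se1 : family K := fun b c d e f =>
  smooth_member b c d e f /\ Lambda1 b c d e f.

Definition Se1' : family K := fun b c d e f =>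
  [/\ smooth_member b c d e f, Lambda1 b c d e f, c != f,
      e = (2%:R * i1 - 1) * c * (5%:R * c - (4%:R * i1 - 3%:R) * f)
          / (5%:R * (c - f))
    & d = (2%:R * i1 + 1)
          * (5%:R * c ^+ 2 - (4%:R * i1 + 8%:R) * c * f - 5%:R * f ^+ 2)
          / (5%:R * (f - c))].

Definition Se1'' : family K := fun b c d e f =>
  [/\ Se1' b c d e f, c = i1 - r2 & f = 3%:R].

Definition Se2 : family K := fun b c d e f =>
  [/\ smooth_member b c d e f, Lambda1 b c d e f & d = (c ^+ 2 + e * f) / c].

Definition Se3 : family K := fun b c d e f =>
  smooth_member b c d e f /\ Lambda3 b c d e f.

Definition Se4 : family K := fun b c d e f =>
  smooth_member b c d e f /\ Lambda4 b c d e f.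

Definition Se6 : family K := fun b c d e f =>
  [/\ smooth_member b c d e f, Lambda3 b c d e f, c + e != 0
    & f = - c * (5%:R * c + e) / (c + e)].

Definition Se9 : family K := fun b c d e f =>
  smooth_member b c d e f /\ Lambda9 b c d e f.

Definition Se9' : family K := fun b c d e f =>
  [/\ smooth_member b c d e f, Lambda9 b c d e f,
      f = 4%:R^-1 * (i1 - r3) ^+ 3 - (i1 - r3) - 1
    & c = 1].

Definition Se10 : family K := fun b c d e f =>
  [/\ smooth_member b c d e f, Lambda4 b c d e f & e = (2%:R - r5) * c].

Definition Se18 : family K := fun b c d e f =>
  [/\ smooth_member b c d e f, Lambda4 b c d e f & e = rm3 * c].

End Families.

(** Permutations *)

(* As products in {perm T} are read from left to right, this is the cycle
   a1 |-> a2 |-> ... |-> ak |-> a1 on the lines with these numbers. *)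
Definition cycle_perm (a : seq nat) : 'S_27 :=
  (if a is a1 :: a' then \prod_(n <- a') tperm (line_no a1) (line_no n)
   else 1)%g.

Definition perm_of_cycles (cs : seq (seq nat)) : 'S_27 :=
  (\prod_(a <- cs) cycle_perm a)%g.

Definition g1 : 'S_27 := perm_of_cycles
  [:: [:: 2; 19]; [:: 3; 22]; [:: 4; 7]; [:: 5; 25]; [:: 6; 26]; [:: 8; 13];
      [:: 9; 14]; [:: 11; 16]; [:: 12; 17]; [:: 18; 27]; [:: 20; 24];
      [:: 21; 23]].
Definition g3 := g1.
Definition g4 := g1.
Definition g9 := g1.
Definition h2 := g1.
Definition g1' : 'S_27 := perm_of_cycles
  [:: [:: 2; 3; 19; 22]; [:: 4; 21; 7; 23]; [:: 5; 26; 25; 6];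
      [:: 8; 16; 13; 11]; [:: 9; 12; 14; 17]; [:: 18; 24; 27; 20]].
Definition g1'' : 'S_27 := perm_of_cycles
  [:: [:: 1; 10]; [:: 2; 11; 3; 8; 19; 16; 22; 13];
      [:: 4; 24; 21; 27; 7; 20; 23; 18]; [:: 5; 17; 26; 9; 25; 12; 6; 14]].
Definition g2 : 'S_27 := perm_of_cycles
  [:: [:: 1; 15]; [:: 3; 22]; [:: 4; 8]; [:: 5; 25]; [:: 6; 26]; [:: 7; 13];
      [:: 9; 18]; [:: 11; 20]; [:: 12; 21]; [:: 14; 27]; [:: 16; 24];
      [:: 17; 23]].
Definition h3 : 'S_27 := perm_of_cycles
  [:: [:: 1; 9; 14]; [:: 2; 19; 10]; [:: 3; 13; 4]; [:: 5; 21; 17];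
      [:: 6; 20; 16]; [:: 7; 8; 22]; [:: 11; 24; 26]; [:: 12; 23; 25];
      [:: 15; 18; 27]].
Definition h9 := h3.
Definition h4 : 'S_27 := perm_of_cycles
  [:: [:: 1; 18; 14; 15; 9; 27]; [:: 2; 19; 10]; [:: 3; 7; 4; 22; 13; 8];
      [:: 5; 12; 17; 25; 21; 23]; [:: 6; 11; 16; 26; 20; 24]].
Definition g6 : 'S_27 := perm_of_cycles
  [:: [:: 1; 13]; [:: 2; 10]; [:: 3; 18]; [:: 5; 20]; [:: 6; 21]; [:: 7; 15];
      [:: 9; 22]; [:: 11; 25]; [:: 12; 26]; [:: 14; 27]; [:: 16; 24];
      [:: 17; 23]].
Definition h6 : 'S_27 := perm_of_cycles
  [:: [:: 1; 3; 15; 22]; [:: 2; 19]; [:: 4; 13; 14; 18]; [:: 5; 6];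
      [:: 7; 27; 9; 8]; [:: 11; 23; 21; 16]; [:: 12; 24; 20; 17];
      [:: 25; 26]].
Definition k9 : 'S_27 := perm_of_cycles
  [:: [:: 1; 21; 3]; [:: 2; 7; 13]; [:: 4; 27; 20]; [:: 5; 26; 19];
      [:: 6; 24; 9]; [:: 8; 12; 14]; [:: 10; 16; 23]; [:: 11; 15; 22];
      [:: 17; 25; 18]].
Definition g9' : 'S_27 := perm_of_cycles
  [:: [:: 2; 3; 19; 22]; [:: 4; 20; 7; 24]; [:: 5; 6; 25; 26];
      [:: 8; 17; 13; 12]; [:: 9; 11; 14; 16]; [:: 18; 23; 27; 21]].
Definition h9' : 'S_27 := perm_of_cycles
  [:: [:: 1; 4; 6]; [:: 2; 3; 5]; [:: 7; 10; 12]; [:: 8; 9; 11];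
      [:: 13; 22; 27]; [:: 14; 25; 21]; [:: 15; 26; 17]; [:: 16; 19; 24];
      [:: 18; 23; 20]].
Definition g10 : 'S_27 := perm_of_cycles
  [:: [:: 1; 13]; [:: 2; 9]; [:: 4; 19]; [:: 5; 20]; [:: 6; 21]; [:: 7; 14];
      [:: 10; 22]; [:: 11; 23]; [:: 12; 24]; [:: 15; 27]; [:: 16; 26];
      [:: 17; 25]].
Definition h10 : 'S_27 := perm_of_cycles
  [:: [:: 1; 3; 15; 8; 7]; [:: 2; 9; 22; 27; 19]; [:: 4; 13; 14; 10; 18];
      [:: 5; 17; 11; 24; 21]; [:: 6; 16; 12; 23; 20]].
Definition g18 : 'S_27 := perm_of_cycles
  [:: [:: 1; 17]; [:: 2; 5]; [:: 3; 4; 24; 26]; [:: 6; 14; 22; 15];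
      [:: 7; 9; 20; 10]; [:: 8; 19; 16; 18]; [:: 11; 25; 13; 23];
      [:: 21; 27]].
Definition h18 : 'S_27 := perm_of_cycles
  [:: [:: 1; 26; 7]; [:: 2; 11; 20]; [:: 3; 8; 18]; [:: 4; 17; 10];
      [:: 5; 9; 23]; [:: 6; 15; 12]; [:: 13; 16; 14]; [:: 19; 25; 22];
      [:: 21; 27; 24]].

Definition sdprod_of (gT : finGroupType) (P Q : {group gT} -> Prop)
    (A : {group gT}) : Prop :=
  exists N H : {group gT}, [/\ (N ><| H)%g = A, P N & Q H].

(* Main.v *)
(* Up to scaling, a surface with b = - (c^2 + ef) / c is given by v = d/c - ef/c^2 + 1,
   E = e/c + 1 and F = f/c + 1, and the Pluecker vectors of its lines are polynomials in
   v, E, F. A symmetry inducing the permutation s multiplies the Pluecker pairing of the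
   lines i and j by a factor x_i x_j when passing to s i and s j; so s preserves the
   ratios p_ij p_lk / (p_ik p_lj), as well as the incidences. That a permutation fails to
   preserve some ratio is an open condition, and it suffices to see it at one member of
   the family, whose coordinates are taken in Z[a, b] for square roots a, b of integers,
   and modulo a prime. A search through the permutations preserving the incidences then
   leaves, generically, only the group generated by the listed ones. These are realized
   by explicit matrices preserving the equation up to a factor; that such a matrix sends
   the line i to the line s i is checked generically in the same way. A symmetry fixing
   all lines is scalar, since it fixes the points where they meet. The isomorphism types
   are read off from orbits of tuples under explicit generators. *)

Require Import Defs.
From mathcomp Require Import all_boot all_order all_algebra all_fingroup.
From mathcomp Require Import mpoly ring zify ssrZ.
From Stdlib Require Import BinInt.
From Stdlib Require Znat.

Set Implicit Arguments.
Unset Strict Implicit.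
Unset Printing Implicit Defensive.

Import GRing.Theory.
Import GroupScope.
Local Open Scope ring_scope.
Delimit Scope nat_scope with N.

(** * Expressions in the moduli and certified nonvanishing *)

(** Reduction modulo a prime can prove that a number is nonzero, never that it is zero. The argument
    is arranged accordingly. All that is needed from the sample point is a nonvanishing, and an
    accidental zero modulo the prime can only make a check fail. The equalities, namely that the
    listed lines lie on the surface and that the matrices preserve the form, are polynomial
    identities valid on the whole family. Quantities are syntactic polynomials: one tree is
    evaluated in [K], in a residue field and on integers, and it also gives the equation whose
    complement is the open set. The coordinates v, E, F are shifted so that the families get short
    equations such as v = 2 or E F = 2 v. For c = 1 the data of E5 become c + f = F, A = v - F, B =
    - F. A labelling prescribes only six lines, so it must first be matched with the table; this
    works because a permutation that preserves incidences and fixes these six lines is trivial. A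
    family with one surface has one moduli point, the sample itself, so nothing generic remains
    there. *)

Inductive ex := Var of nat | Cst of nat | Add of ex & ex | Opp of ex | Mul of ex & ex.

Declare Scope ex_scope.
Delimit Scope ex_scope with ex.
Bind Scope ex_scope with ex.
Notation "x + y" := (Add x y) : ex_scope.
Notation "- x" := (Opp x) : ex_scope.
Notation "x - y" := (Add x (Opp y)) : ex_scope.
Notation "x * y" := (Mul x y) : ex_scope.
Notation "x ^ 2" := (Mul x x) : ex_scope.
Notation "x ^ 3" := (Mul x (Mul x x)) : ex_scope.
Notation "n %:C" := (Cst n) (at level 1, format "n %:C") : ex_scope.

Fixpoint ev (R : comNzRingType) (env : nat -> R) (x : ex) : R :=
  match x with
  | Var k => env k
  | Cst n => n%:R
  | Add x y => ev env x + ev env y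
  | Opp x => - ev env x
  | Mul x y => ev env x * ev env y
  end.

Lemma eq_ev (R : comNzRingType) (env1 env2 : nat -> R) x :
  env1 =1 env2 -> ev env1 x = ev env2 x.
Proof. by move=> e12; elim: x => //= [x -> y ->|x ->|x -> y ->]. Qed.

Definition zR (R : comNzRingType) (z : Z) : R := (int_of_Z z)%:~R.

Lemma zRD (R : comNzRingType) : {morph @zR R : x y / (x + y)%Z >-> x + y}.
Proof. by move=> x y; rewrite /zR (rmorphD int_of_Z) intrD. Qed.
Lemma zRM (R : comNzRingType) : {morph @zR R : x y / (x * y)%Z >-> x * y}.
Proof. by move=> x y; rewrite /zR (rmorphM int_of_Z) intrM. Qed.
Lemma zRN (R : comNzRingType) : {morph @zR R : x / (- x)%Z >-> - x}.
Proof. by move=> x; rewrite /zR (rmorphN int_of_Z) mulrNz. Qed.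
Lemma zR_nat (R : comNzRingType) n : @zR R (Z.of_nat n) = n%:R.
Proof. by rewrite /zR -[Z.of_nat n]/(Z_of_int (Posz n)) Z_of_intK. Qed.

(* The element x0 + x1 a + x2 b + x3 ab of Z[a, b]; here and below a and b are
   square roots of the integers A and B. *)
Definition quad := (Z * Z * Z * Z)%type.
Definition lin (R : comNzRingType) (a b : R) (x : quad) : R :=
  let: (x0, x1, x2, x3) := x in zR R x0 + zR R x1 * a + zR R x2 * b + zR R x3 * (a * b).

(** The integers [q] are chosen before the ring, so the same coefficients give the value of [x] in
    [K] and in a residue field. This is how nonvanishing passes from one to the other. *)
Lemma ev_lin (A B : Z) (t : nat -> quad) x : exists q : quad,
  forall (R : comNzRingType) (a b : R), a ^+ 2 = zR R A -> b ^+ 2 = zR R B ->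
  ev (fun k => lin a b (t k)) x = lin a b q.
Proof.
elim: x => [k|n|x [[[[x0 x1] x2] x3] Hx] y [[[[y0 y1] y2] y3] Hy]
  |x [[[[x0 x1] x2] x3] Hx]|x [[[[x0 x1] x2] x3] Hx] y [[[[y0 y1] y2] y3] Hy]].
- by exists (t k).
- by exists (Z.of_nat n, Z0, Z0, Z0) => R a b _ _ /=; rewrite zR_nat; rewrite /zR /=; ring.
- exists (x0 + y0, x1 + y1, x2 + y2, x3 + y3)%Z => R a b Ha Hb /=.
  by rewrite (Hx _ _ _ Ha Hb) (Hy _ _ _ Ha Hb) /= !zRD; ring.
- exists (- x0, - x1, - x2, - x3)%Z => R a b Ha Hb /=.
  by rewrite (Hx _ _ _ Ha Hb) /= !zRN; ring.
exists (x0 * y0 + A * (x1 * y1) + B * (x2 * y2) + A * (B * (x3 * y3)),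
   x0 * y1 + x1 * y0 + B * (x2 * y3) + B * (x3 * y2),
   x0 * y2 + x2 * y0 + A * (x1 * y3) + A * (x3 * y1),
   x0 * y3 + x3 * y0 + x1 * y2 + x2 * y1)%Z => R a b Ha Hb /=.
rewrite (Hx _ _ _ Ha Hb) (Hy _ _ _ Ha Hb) /= !(zRD, zRM) -Ha -Hb; ring.
Qed.

(** The norm from Z[a, b] to Z in two stages: [r + s * a] is the product of the element with its
    conjugate under b -> - b, and the value is the norm of that product. *)
Definition qnorm (A B : Z) (q : quad) : Z :=
  let: (x0, x1, x2, x3) := q in
  let r := (x0 * x0 + A * (x1 * x1) - B * (x2 * x2) - A * (B * (x3 * x3)))%Z in
  let s := (x0 * x1 - B * (x2 * x3))%Z in let s := (s + s)%Z in (r * r - A * (s * s))%Z.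

Lemma qnormE (R : comNzRingType) (A B : Z) (a b : R) q :
  a ^+ 2 = zR R A -> b ^+ 2 = zR R B ->
  lin a b q * lin a (- b) q * (lin (- a) b q * lin (- a) (- b) q) = zR R (qnorm A B q).
Proof.
move: q => [[[x0 x1] x2] x3] Ha Hb /=.
rewrite /qnorm -!Z.add_opp_r !(zRD, zRM, zRN) -Ha -Hb; ring.
Qed.

Section ModularEvaluation.
Variable m : nat.
Implicit Types (env : nat -> Z) (x : ex).

Definition modm (z : Z) : Z := Z.modulo z (Z.of_nat m).

Fixpoint evm env x : Z :=
  match x with
  | Var k => modm (env k)
  | Cst n => modm (Z.of_nat n)
  | Add x y => modm (evm env x + evm env y)%Z
  | Opp x => modm (- evm env x)%Z
  | Mul x y => modm (evm env x * evm env y)%Z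
  end.

Definition linm (ab : Z * Z) (x : quad) : Z :=
  let: (x0, x1, x2, x3) := x in let: (a, b) := ab in
  modm (x0 + x1 * a + x2 * b + x3 * (a * b))%Z.

(* The places are the reductions mod m of the conjugates of (a, b). *)
Definition sign_closed (A B : Z) (places : seq (Z * Z)) : bool :=
  all (fun p : Z * Z => [&& modm (p.1 * p.1)%Z == modm A, modm (p.2 * p.2)%Z == modm B,
                    (modm (- p.1)%Z, p.2) \in places & (p.1, modm (- p.2)%Z) \in places])
    places && (places != [::]).

Hypothesis m_prime : prime m.

Let m_gt0 : leq 1 m. Proof. exact: prime_gt0. Qed.
Let m_neq0 : Z.of_nat m <> 0%Z. Proof. by move: m_gt0; lia. Qed.

Let zF := zR 'F_m.

Let zF_modm z : zF (modm z) = zF z.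
Proof.
rewrite [in RHS](Z.div_mod z (Z.of_nat m) m_neq0) /zF zRD zRM zR_nat.
by rewrite (pchar_Fp_0 m_prime) mul0r add0r.
Qed.

Let zF_eq0 z : zF z = 0 -> modm z = 0%Z.
Proof.
rewrite -zF_modm.
have := Z.mod_pos_bound z (Z.of_nat m); rewrite -/(modm z).
move: (modm z) => w Hw.
have [{}Hw Hwm] : (0 <= w)%Z /\ (w < Z.of_nat m)%Z by apply: Hw; move: m_gt0; lia.
rewrite -(Znat.Z2Nat.id w Hw) /zF zR_nat => /eqP.
rewrite -(dvdn_pcharf (pchar_Fp m_prime)) => /dvdnP[[|k] Hk]; first by rewrite Hk.
by exfalso; move: Hk Hwm Hw; rewrite mulSn; lia.
Qed.

Lemma evmE env x : zF (evm env x) = ev (fun k => zF (env k)) x.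
Proof.
elim: x => /= [k|n|x Hx y Hy|x Hx|x Hx y Hy]; rewrite zF_modm //.
- by rewrite /zF zR_nat.
- by rewrite /zF zRD -/zF Hx Hy.
- by rewrite /zF zRN -/zF Hx.
- by rewrite /zF zRM -/zF Hx Hy.
Qed.

Lemma evm_mod env x : modm (evm env x) = evm env x.
Proof. by case: x => * /=; rewrite /modm Z.mod_mod. Qed.

Variables (A B : Z) (places : seq (Z * Z)) (t : nat -> quad).
Hypothesis closed_places : sign_closed A B places.

Definition nonvanishing x : bool :=
  all (fun p => evm (fun k => linm p (t k)) x != 0%Z) places.

Variables (K : idomainType) (al be : K).
Hypotheses (char0 : [pchar K] =i pred0) (alE : al ^+ 2 = zR K A) (beE : be ^+ 2 = zR K B).

Let zR_eq0 z : zR K z = 0 -> z = 0%Z.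
Proof.
have H0 n : n%:R = 0 :> K -> n = 0%N.
  by move=> /eqP; rewrite ((pcharf0P K).1 char0) => /eqP.
case: z => [|p|p] //.
  by rewrite -[Z.pos p]Znat.positive_nat_Z zR_nat => /H0; lia.
by rewrite -Pos2Z.opp_pos zRN -Znat.positive_nat_Z zR_nat => /eqP; rewrite oppr_eq0 => /eqP /H0; lia.
Qed.

(* If x vanishes at (al, be) then so does the norm of its value, an integer;
   hence the value of x is 0 mod m at one of the conjugate places. *)
Lemma nonvanishingP x : nonvanishing x -> ev (fun k => lin al be (t k)) x != 0.
Proof.
move=> nz; apply/eqP; have [q Hq] := ev_lin A B t x.
rewrite (Hq _ _ _ alE beE) => q0.
have N0 : qnorm A B q = 0%Z by apply: zR_eq0; rewrite -(qnormE _ alE beE) q0 !mul0r.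
have place a b : (a, b) \in places -> [/\ zF a ^+ 2 = zF A, zF b ^+ 2 = zF B,
    (modm (- a)%Z, b) \in places, (a, modm (- b)%Z) \in places & lin (zF a) (zF b) q != 0].
  move=> Hp; move: closed_places => /andP[/allP /(_ _ Hp) /= /and4P[/eqP Ha /eqP Hb -> ->] _].
  have Ea : zF a ^+ 2 = zF A by rewrite expr2 /zF -zRM -/zF -zF_modm Ha zF_modm.
  have Eb : zF b ^+ 2 = zF B by rewrite expr2 /zF -zRM -/zF -zF_modm Hb zF_modm.
  split=> //; move: nz => /allP /(_ _ Hp); apply: contraNneq => Hl.
  apply/eqP; rewrite -evm_mod; apply: zF_eq0; rewrite evmE.
  rewrite -[RHS]Hl -(Hq _ _ _ Ea Eb); apply: eq_ev => k.
  case: (t k) => [[[x0 x1] x2] x3] /=.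
  by rewrite zF_modm /zF !(zRD, zRM).
case: (places) closed_places place => [|[a b] s] // _ place.
have [Ha Hb Hna Hnb H1] := place a b (mem_head _ _).
have [_ _ _ _ H2] := place _ _ Hna.
have [_ _ Hnn _ H3] := place _ _ Hnb.
have [_ _ _ _ H4] := place _ _ Hnn.
have zFN c : zF (modm (- c)%Z) = - zF c by rewrite zF_modm /zF zRN.
have := qnormE q Ha Hb; rewrite N0 -!zFN => /eqP; rewrite mulf_eq0 !mulf_eq0.
by rewrite (negPf H1) (negPf H2) (negPf H3) (negPf H4).
Qed.

End ModularEvaluation.

(** * Lines of projective space *)

Section Lines.
Variable K : closedFieldType.
Implicit Types (P Q R S v w : 'cV[K]_4) (M : 'M[K]_4) (l : {vspace 'cV[K]_4}).

Lemma ord4_ind (T : 'I_4 -> Prop) : T ix -> T iy -> T iz -> T it -> forall i, T i.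
Proof.
move=> Tx Ty Tz Tt [[|[|[|[|i]]]] Hi] //.
- by rewrite (_ : Ordinal Hi = ix) //; apply/val_inj.
- by rewrite (_ : Ordinal Hi = iy) //; apply/val_inj.
- by rewrite (_ : Ordinal Hi = iz) //; apply/val_inj.
by rewrite (_ : Ordinal Hi = it) //; apply/val_inj.
Qed.

Lemma colP4 v w : v ix 0 = w ix 0 -> v iy 0 = w iy 0 -> v iz 0 = w iz 0 ->
  v it 0 = w it 0 -> v = w.
Proof. by move=> *; apply/colP; elim/ord4_ind. Qed.

Lemma sum_ord4 (f : 'I_4 -> K) : \sum_i f i = f ix + f iy + f iz + f it.
Proof.
rewrite !big_ord_recr big_ord0 /= add0r; congr (_ + _ + _ + _); congr (f _);
  exact/val_inj.
Qed.

Definition span2 P Q : {vspace 'cV[K]_4} := (<[P]> + <[Q]>)%VS.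

Lemma mem_span2 P Q v :
  reflect (exists a b, v = a *: P + b *: Q) (v \in span2 P Q).
Proof.
apply: (iffP memv_addP) => [[_ /vlineP[a ->] [_ /vlineP[b ->] ->]]|[a [b ->]]].
  by exists a, b.
by exists (a *: P); rewrite ?memvZ ?memv_line //; exists (b *: Q);
  rewrite ?memvZ ?memv_line.
Qed.

Definition wedge P Q i j : K := P i 0 * Q j 0 - P j 0 * Q i 0.

(** The bilinear form of the Klein quadric on Plücker vectors: a nonzero value certifies that two
    lines are skew. *)
Definition pairing P Q R S : K :=
  wedge P Q ix iy * wedge R S iz it - wedge P Q ix iz * wedge R S iy it
  + wedge P Q ix it * wedge R S iy iz + wedge P Q iy iz * wedge R S ix it
  - wedge P Q iy it * wedge R S ix iz + wedge P Q iz it * wedge R S ix iy.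

Lemma pairingC P Q R S : pairing P Q R S = pairing R S P Q.
Proof. rewrite /pairing; ring. Qed.

Definition columns P Q R S : 'M[K]_4 :=
  \matrix_(i, j) (nth 0 [:: P; Q; R; S] j) i 0.

Lemma expand_det2 (A : 'M[K]_2) :
  \det A = A ord0 ord0 * A ord_max ord_max - A ord0 ord_max * A ord_max ord0.
Proof.
rewrite (expand_det_row A ord0) !big_ord_recl big_ord0 /cofactor !det_mx11 !mxE /=.
rewrite !addn0 !add0n expr0 expr1 (_ : lift ord0 ord0 = ord_max); last exact/val_inj.
rewrite (_ : lift ord_max ord0 = ord0); last exact/val_inj.
ring.
Qed.

(** Laplace expansion along the first two columns. As a determinant, the pairing is multiplied by
    [\det M] when [M] is applied to both lines. *)
Lemma det_columns P Q R S : \det (columns P Q R S) = pairing P Q R S.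
Proof.
rewrite (expand_det_row _ ord0) !big_ord_recl big_ord0 /cofactor.
rewrite !(expand_det_row (row' ord0 _) ord0) !big_ord_recl !big_ord0 /cofactor.
rewrite !expand_det2 !mxE /= /bump /=.
rewrite (_ : lift ord0 (lift ord0 ord_max) = it); last exact/val_inj.
rewrite (_ : lift ord0 (lift ord0 ord0) = iz); last exact/val_inj.
rewrite (_ : lift ord0 ord0 = iy); last exact/val_inj.
rewrite (_ : ord0 = ix); last exact/val_inj.
rewrite /pairing /wedge; ring.
Qed.

Lemma mul_columns M P Q R S :
  M *m columns P Q R S = columns (M *m P) (M *m Q) (M *m R) (M *m S).
Proof.
apply/matrixP=> i j; rewrite !mxE; move: j.
by elim/ord4_ind; rewrite /= mxE; apply: eq_bigr => k _; rewrite !mxE.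
Qed.

Lemma pairing_mul M P Q R S :
  pairing (M *m P) (M *m Q) (M *m R) (M *m S) = \det M * pairing P Q R S.
Proof. by rewrite -!det_columns -mul_columns det_mulmx. Qed.

Lemma meet_pairing P Q R S : meet (span2 P Q) (span2 R S) -> pairing P Q R S = 0.
Proof.
rewrite /meet -vpick0; set v := vpick _ => v0.
have /andP[] : (v \in span2 P Q) && (v \in span2 R S) by rewrite -memv_cap memv_pick.
move=> /mem_span2[a [b Ev]] /mem_span2[c [d Ev']].
have E i : a * P i 0 + b * Q i 0 - c * R i 0 - d * S i 0 = 0.
  have := congr1 (fun u : 'cV_4 => u i 0) Ev; rewrite Ev' !mxE => <-; ring.
apply/eqP/negPn/negP => p0; move: v0; rewrite Ev.
have -> : a = 0.
  apply: (mulIf p0); rewrite mul0r.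
  (* By multilinearity, replacing [P] by the combination that vanishes multiplies the determinant by
     [a]. *)
  transitivity (pairing (\col_i (a * P i 0 + b * Q i 0 - c * R i 0 - d * S i 0)) Q R S).
    by rewrite /pairing /wedge !mxE; ring.
  by rewrite /pairing /wedge !mxE !E; ring.
have -> : b = 0.
  apply: (mulIf p0); rewrite mul0r.
  transitivity (pairing P (\col_i (a * P i 0 + b * Q i 0 - c * R i 0 - d * S i 0)) R S).
    by rewrite /pairing /wedge !mxE; ring.
  by rewrite /pairing /wedge !mxE !E; ring.
by rewrite !scale0r addr0 eqxx.
Qed.

Lemma span2_wedge P Q P' Q' : span2 P Q = span2 P' Q' ->
  exists c, forall i j, wedge P Q i j = c * wedge P' Q' i j.
Proof.
move=> E.
have /mem_span2[a [b EP]] : P \in span2 P' Q' by rewrite -E; apply/mem_span2;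
  exists 1, 0; rewrite scale1r scale0r addr0.
have /mem_span2[c [d EQ]] : Q \in span2 P' Q' by rewrite -E; apply/mem_span2;
  exists 0, 1; rewrite scale1r scale0r add0r.
exists (a * d - b * c) => i j; rewrite EP EQ /wedge !mxE; ring.
Qed.

Lemma span2_pairing P Q P' Q' : span2 P Q = span2 P' Q' ->
  exists c, forall R S, pairing P Q R S = c * pairing P' Q' R S.
Proof. by move=> /span2_wedge[c Hc]; exists c => R S; rewrite /pairing !Hc; ring. Qed.

Lemma dim_span2 P Q R S : pairing P Q R S != 0 -> \dim (span2 P Q) = 2%N.
Proof.
move=> p0; rewrite dimv_disjoint_sum.
  rewrite !dim_vline; case: eqP => [P0|_]; last case: eqP => [Q0|_] //.
    by case/eqP: p0; rewrite P0 /pairing /wedge !mxE; ring.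
  by case/eqP: p0; rewrite Q0 /pairing /wedge !mxE; ring.
apply/eqP; rewrite -vpick0; apply/eqP; set v := vpick _.
have : v \in (<[P]> :&: <[Q]>)%VS by rewrite memv_pick.
rewrite memv_cap => /andP[/vlineP[a Ea] /vlineP[b Eb]].
have E i : a * P i 0 - b * Q i 0 = 0.
  by have := congr1 (fun u : 'cV_4 => u i 0) Ea; rewrite Eb !mxE => ->; rewrite subrr.
rewrite Ea; suff -> : a = 0 by rewrite scale0r.
apply: (mulIf p0); rewrite mul0r.
transitivity (pairing (\col_i (a * P i 0 - b * Q i 0)) Q R S).
  by rewrite /pairing /wedge !mxE; ring.
by rewrite /pairing /wedge !mxE !E; ring.
Qed.

Lemma image_span2 M P Q : image_line M (span2 P Q) = span2 (M *m P) (M *m Q).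
Proof. by rewrite /image_line limgD !limg_line !lfunE. Qed.

(* The equation wedge P Q /\ v = 0, in the chart where the coordinate (y, z) of
   the line does not vanish. *)
Lemma plucker_mem l p01 p02 p03 p12 p13 p23 v : plucker l p01 p02 p03 p12 p13 p23 ->
  p12 != 0 ->
  p12 * v ix 0 - p02 * v iy 0 + p01 * v iz 0 = 0 ->
  p12 * v it 0 - p13 * v iz 0 + p23 * v iy 0 = 0 -> v \in l.
Proof.
move=> [P [Q [k k0 [-> /= [E01 E02 E03 E12 E13 E23]]]]] p0 Ex Et.
have kp0 : k * p12 != 0 by rewrite mulf_neq0.
apply/mem_span2; pose w i j (R S : 'cV[K]_4) := R i 0 * S j 0 - R j 0 * S i 0.
exists (w iy iz v Q / (k * p12)), (w iy iz P v / (k * p12)).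
apply/esym/(scalerI kp0); rewrite scalerDr !scalerA ![k * p12 * (_ / _)]mulrC !divfK //.
have Ex' : k * p12 * v ix 0 - k * p02 * v iy 0 + k * p01 * v iz 0 = 0.
  by rewrite -[RHS](mulr0 k) -Ex; ring.
have Et' : k * p12 * v it 0 - k * p13 * v iz 0 + k * p23 * v iy 0 = 0.
  by rewrite -[RHS](mulr0 k) -Et; ring.
move: Ex' Et'; rewrite -E01 -E02 -E12 -E13 -E23 /w => Ex' Et'.
apply: colP4; rewrite !mxE.
- by rewrite -[LHS]addr0 -Ex'; ring.
- ring.
- ring.
- by rewrite -[LHS]addr0 -Et'; ring.
Qed.

End Lines.

(** * The cubic form and its lines *)

Section Cubic.
Variables (K : closedFieldType).
Implicit Types (b c d e f : K) (w : 'cV[K]_4).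

Definition cubic_form b c d e f (x y z t : K) : K :=
  b * c * ((t - x) * (x * z + y * t)) + c ^+ 2 * ((z + t) * (x * z - y * t))
  - c * d * ((y - z) * (x * z + y * t)) + c * (e + f) * ((x - y) * (x * z - y * t))
  - e * f * (2%:R * (x ^+ 2 * y) - 2%:R * (x * y ^+ 2) + x * z ^+ 2
             - x * z * t + y * z * t - y * t ^+ 2).

Lemma mderivXU i j : ('X_i : {mpoly K[4]})^`M(j) = (i == j)%:R%:MP.
Proof.
rewrite mderivX mnm1E; case: eqP => [->|_]; last by rewrite scale0r mpolyC0.
rewrite scale1r mpolyC1 (_ : (U_(j) - U_(j))%MM = 0%MM) ?mpolyX0 //.
by apply/mnmP=> k; rewrite mnmBE mnm0E subnn.
Qed.

(* Value and i-th partial derivative at w; computing them bottom-up is much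
   faster than rewriting in the polynomial. *)
Definition jet w i (p : {mpoly K[4]}) (a a' : K) : Prop :=
  eval_at p w = a /\ eval_at p^`M(i) w = a'.

Lemma jetD w i p q a a' b b' :
  jet w i p a a' -> jet w i q b b' -> jet w i (p + q) (a + b) (a' + b').
Proof. by rewrite /jet /eval_at mderivD !mevalD => -[-> ->] [-> ->]. Qed.
Lemma jetN w i p a a' : jet w i p a a' -> jet w i (- p) (- a) (- a').
Proof. by rewrite /jet /eval_at mderivN !mevalN => -[-> ->]. Qed.
Lemma jetM w i p q a a' b b' :
  jet w i p a a' -> jet w i q b b' -> jet w i (p * q) (a * b) (a' * b + a * b').
Proof. by rewrite /jet /eval_at mderivM !(mevalD, mevalM) => -[-> ->] [-> ->]. Qed.
Lemma jetZ w i k p a a' : jet w i p a a' -> jet w i (k *: p) (k * a) (k * a').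
Proof. by rewrite /jet /eval_at mderivZ !mevalZ => -[-> ->]. Qed.
Lemma jetX w i j : jet w i 'X_j (w j 0) (j == i)%:R.
Proof. by rewrite /jet /eval_at mderivXU mevalC mevalXU. Qed.

Lemma jet_value w i p a a' r : jet w i p a a' -> a = r -> eval_at p w = r.
Proof. by move=> [-> _]. Qed.
Lemma jet_partial w i p a a' r : jet w i p a a' -> a' = r -> eval_at p^`M(i) w = r.
Proof. by move=> [_ ->]. Qed.

Ltac jet := rewrite /cubic ?expr2; repeat lazymatch goal with
  | |- jet _ _ (_ + _) _ _ => eapply jetD
  | |- jet _ _ (- _) _ _ => eapply jetN
  | |- jet _ _ (_ * _) _ _ => eapply jetM
  | |- jet _ _ (_ *: _) _ _ => eapply jetZ
  | |- jet _ _ _ _ _ => eapply jetX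
  end.

Lemma eval_cubic b c d e f w :
  eval_at (cubic b c d e f) w = cubic_form b c d e f (w ix 0) (w iy 0) (w iz 0) (w it 0).
Proof. by eapply (@jet_value w ix); [jet | rewrite /cubic_form; ring]. Qed.

Lemma eval_cubic_gradient b c d e f w (x := w ix 0) (y := w iy 0) (z := w iz 0) (t := w it 0) :
  [/\ eval_at (cubic b c d e f)^`M(ix) w =
    b * c * (z * (t - x) - (x * z + y * t)) + c ^+ 2 * ((z + t) * z) - c * d * ((y - z) * z)
    + c * (e + f) * (x * z - y * t + (x - y) * z)
    - e * f * (4%:R * x * y - 2%:R * y ^+ 2 + z ^+ 2 - z * t),
  eval_at (cubic b c d e f)^`M(iy) w =
    b * c * ((t - x) * t) - c ^+ 2 * ((z + t) * t) - c * d * (x * z + y * t + (y - z) * t)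
    - c * (e + f) * (x * z - y * t + (x - y) * t)
    - e * f * (2%:R * x ^+ 2 - 4%:R * x * y + z * t - t ^+ 2),
  eval_at (cubic b c d e f)^`M(iz) w =
    b * c * ((t - x) * x) + c ^+ 2 * (x * z - y * t + (z + t) * x)
    - c * d * ((y - z) * x - (x * z + y * t)) + c * (e + f) * ((x - y) * x)
    - e * f * (2%:R * x * z - x * t + y * t)
  & eval_at (cubic b c d e f)^`M(it) w =
    b * c * (x * z + y * t + (t - x) * y) + c ^+ 2 * (x * z - y * t - (z + t) * y)
    - c * d * ((y - z) * y) - c * (e + f) * ((x - y) * y)
    - e * f * (- x * z + y * z - 2%:R * y * t)].
Proof. by split; (eapply jet_partial; [jet | rewrite /= /x /y /z /t; ring]). Qed.

End Cubic.

Definition ex_of_num (n : Number.int) : option ex :=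
  match n with
  | Number.IntDecimal (Decimal.Neg n) => Some (Opp (Cst (Nat.of_uint n)))
  | Number.IntDecimal (Decimal.Pos n) => Some (Cst (Nat.of_uint n))
  | _ => None
  end.
Definition num_of_ex (x : ex) : option Number.int :=
  match x with
  | Cst n => Some (Number.IntDecimal (Decimal.Pos (Nat.to_uint n)))
  | Opp (Cst n) => Some (Number.IntDecimal (Decimal.Neg (Nat.to_uint n)))
  | _ => None
  end.
Number Notation ex ex_of_num num_of_ex : ex_scope.

(* Coordinates on the moduli of the surfaces with b = - (c^2 + ef) / c:
   v = d/c - ef/c^2 + 1, E = e/c + 1 and F = f/c + 1. *)
Section LineTable.
Let v := Var 0.
Let E := Var 1.
Let F := Var 2.
Local Open Scope ex_scope.

(* Two points spanning each line, in the numbering of the lines. *)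
Definition line_table : seq (seq ex * seq ex) := [::
  ([:: 0; 0; 0; 1], [:: 1; 0; 0; 0]);
  ([:: 0; 0; 1; 0], [:: 0; 1; 0; 0]);
  ([:: 0; 0; 1; - 1], [:: 1; 1; 0; 0]);
  ([:: 2 * v; 0; - 2 * E * F; - v * E * F + 2 * v], [:: 0; 4; - 2 * E * F + 4 * E + 4 * F - 4; - v * E * F + 2 * v * E + 2 * v * F - 4 * v]);
  ([:: 0; 0; F; v - F], [:: v * F - 2 * v - F^2 + 2 * F; - F^2; - 2 * F^2 + 2 * F; 0]);
  ([:: 0; 0; E; v - E], [:: v * E - 2 * v - E^2 + 2 * E; - E^2; - 2 * E^2 + 2 * E; 0]);
  ([:: 0; 2; - E * F + 2 * E + 2 * F - 2; 0], [:: 2 * v; 0; - 2 * E * F; v * E * F - 2 * v * E - 2 * v * F + 2 * v + 2 * E * F]);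
  ([:: v; 0; 0; v - E * F], [:: 0; v^2; v^2 + v * E * F - 2 * v * E - 2 * v * F + 2 * E * F; - 2 * v^2 + 2 * v * E + 2 * v * F - 2 * E * F]);
  ([:: 1; 0; 0; 1], [:: 0; 1; 1; 0]);
  ([:: 0; 0; 0; 1], [:: 0; 0; 1; 0]);
  ([:: 1; 0; 0; - E + 1], [:: 0; 1; E - 1; 0]);
  ([:: 1; 0; 0; - F + 1], [:: 0; 1; F - 1; 0]);
  ([:: 2 * v; 0; 0; v * E * F - 2 * v * E - 2 * v * F + 2 * v + 2 * E * F], [:: 0; v^2; v^2 + v * E * F - 2 * v * E - 2 * v * F + 2 * E * F; 0]);
  ([:: 1; 1; 1; - 1], [:: 2; 0; 0; E * F - 2 * E - 2 * F + 2]);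
  ([:: 0; 0; 0; 1], [:: v; 0; - E * F; 0]);
  ([:: 2; 0; 0; E * F - 2 * F + 2], [:: 0; 2; 2 * E - 2; v * E - 2 * v - E * F + 2 * F]);
  ([:: 2; 0; 0; E * F - 2 * E + 2], [:: 0; 2; 2 * F - 2; v * F - 2 * v - E * F + 2 * E]);
  ([:: 1; 1; - 1; 1], [:: 0; v; - v + E * F; 0]);
  ([:: 0; 0; 2; v - 2], [:: 0; 2; 0; - v - E * F + 2 * E + 2 * F - 2]);
  ([:: 0; v; v + E * F - 2 * E; 0], [:: v; 0; - E * F; - v * E + v]);
  ([:: 0; v; v + E * F - 2 * F; 0], [:: v; 0; - E * F; - v * F + v]);
  ([:: 0; 0; 2; v], [:: 1; 1; 1; 1]);
  ([:: v; 0; - E * F; - v * E + v + E * F], [:: E - 2; E; E; E - 2]);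
  ([:: v; 0; - E * F; - v * F + v + E * F], [:: F - 2; F; F; F - 2]);
  ([:: 0; 0; 2 * F; v * F - 2 * v], [:: v^2 * F - 2 * v^2 - v * F^2 + 2 * v * F; - v * F^2; - v * E * F^2 + 2 * v * E * F + v * F^2 - 2 * v * F - 2 * E * F^2 + 2 * F^2; 0]);
  ([:: 0; 0; 2 * E; v * E - 2 * v], [:: v^2 * E - 2 * v^2 - v * E^2 + 2 * v * E; - v * E^2; - v * E^2 * F + v * E^2 + 2 * v * E * F - 2 * v * E - 2 * E^2 * F + 2 * E^2; 0]);
  ([:: 1; 1; - 1; - v + 1], [:: v; 0; - E * F; - v * E - v * F + v + E * F])].
End LineTable.

Section Surface.
Variable K : closedFieldType.
Variable env : nat -> K.

Definition point (s : seq ex) : 'cV[K]_4 := \col_(i < 4) ev env (nth (Cst 0) s i).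

Definition LP (i : nat) : 'cV[K]_4 := point (nth ([::], [::]) line_table i).1.
Definition LQ (i : nat) : 'cV[K]_4 := point (nth ([::], [::]) line_table i).2.
Definition table_line (i : nat) : {vspace 'cV[K]_4} := span2 (LP i) (LQ i).

Definition par_e : K := env 1%N - 1.
Definition par_f : K := env 2%N - 1.
Definition par_b : K := - (1 + par_e * par_f).
Definition par_d : K := env 0%N - 1 + par_e * par_f.
Definition surface : {mpoly K[4]} := cubic par_b 1 par_d par_e par_f.

Lemma table_line_on_surface (i : nat) w : (i < 27)%N -> w \in table_line i -> eval_at surface w = 0.
Proof.
move=> Hi /mem_span2[p [q ->]]; rewrite eval_cubic.
do 27!(case: i Hi => [_|i Hi];
  first by rewrite !mxE /= /cubic_form /par_b /par_d /par_e /par_f; ring).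
by case: i Hi.
Qed.

End Surface.

(** * Permutations of the 27 labels *)

Section Permutations.
Local Open Scope nat_scope.
Implicit Types (s h : 'S_27) (i j k x y : nat) (l t : seq nat) (gl : seq (seq nat)).

Definition incidence_table : seq bitseq :=
  Eval vm_compute in [seq [seq incident a b | b <- labels] | a <- labels].
Definition inc i j : bool := nth false (nth [::] incidence_table i) j.
(** The remaining line of the tritangent plane of two lines that meet; for skew lines the value has
    no meaning. *)
Definition third i j : nat := find (fun k => inc i k && inc j k) (iota 0 27).
Definition lines : seq nat := Eval vm_compute in iota 0 27.

Arguments lines : simpl never.
Arguments incidence_table : simpl never.

Lemma mem_lines i : (i \in lines) = (i < 27).
Proof. by rewrite -[lines]/(iota 0 27) mem_iota. Qed.

Lemma incE (i j : 'I_27) : inc i j = incident (label_of i) (label_of j).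
Proof.
rewrite /inc (_ : incidence_table = [seq [seq incident a b | b <- labels] | a <- labels]) //.
by rewrite (nth_map (E 1)) // (nth_map (E 1)).
Qed.

Definition app s i : nat := s (inord i).

Lemma app_val s (i : 'I_27) : app s i = s i.
Proof. by rewrite /app inord_val. Qed.
Lemma app_lt s i : app s i < 27.
Proof. by rewrite /app. Qed.
Lemma app_inj s i j : i < 27 -> j < 27 -> app s i = app s j -> i = j.
Proof. by move=> Hi Hj /val_inj/perm_inj/(congr1 val); rewrite /= !inordK. Qed.
Lemma appM s h i : app (s * h)%g i = app h (app s i).
Proof. by rewrite /app permM inord_val. Qed.
Lemma app1 i : i < 27 -> app 1 i = i.
Proof. by move=> Hi; rewrite /app perm1 inordK. Qed.
Lemma app_perm s h : (forall i, i < 27 -> app s i = app h i) -> s = h.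
Proof. by move=> E; apply/permP=> i; apply/val_inj; rewrite /= -!app_val E. Qed.

Definition preserves_inc s : Prop :=
  forall i j, i < 27 -> j < 27 -> inc (app s i) (app s j) = inc i j.

Lemma preserves_incM s h : preserves_inc s -> preserves_inc h -> preserves_inc (s * h)%g.
Proof. by move=> Hs Hh i j Hi Hj; rewrite !appM Hh ?app_lt // Hs. Qed.

Lemma preserves_incV s : preserves_inc s -> preserves_inc s^-1%g.
Proof.
move=> Hs i j Hi Hj.
have K k : k < 27 -> app s (app s^-1%g k) = k by move=> Hk; rewrite -appM mulVg app1.
by rewrite -Hs ?app_lt // !K.
Qed.

(** No other line outside [known] meets the same lines of [known] as [x] does, so a permutation that
    preserves incidences and fixes [known] pointwise must fix [x]. *)
Definition forced (known : seq nat) x : bool :=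
  all (fun y => (y == x) || (y \in known) || has (fun k => inc k y != inc k x) known) lines.

Fixpoint forced_closure n (known : seq nat) : seq nat :=
  if n is n'.+1 then
    forced_closure n' (known ++ [seq x <- lines | (x \notin known) && forced known x])
  else known.

(** Any number of rounds is sound; 6 suffice for the two bases to which this is applied. *)
Definition determines (base : seq nat) : bool :=
  let known := forced_closure 6 base in
  all (fun x => x < 27) base && all (fun x => x \in known) lines.

Lemma forced_closureP n known s : preserves_inc s -> all (fun x => x < 27) known ->
  (forall x, x \in known -> app s x = x) ->
  forall x, x \in forced_closure n known -> app s x = x.
Proof.
move=> Hs; elim: n known => [|n IH] known Hlt Hk; first exact: Hk.
have Hkn k : k \in known -> k < 27 by move/(allP Hlt).
apply: (IH (known ++ _)) => [|y].
  by rewrite all_cat Hlt; apply/allP=> y; rewrite mem_filter mem_lines => /andP[].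
rewrite mem_cat mem_filter => /orP[|/andP[/andP[_ Hf] Hy]]; first exact: Hk.
have Hsy : app s y \in lines by rewrite mem_lines app_lt.
move: Hf => /allP /(_ _ Hsy) /orP[/orP[/eqP //|Hin]|/hasP[k Hkk]].
  by apply: (@app_inj s); rewrite ?app_lt -?mem_lines // Hk.
have [Hkl Hyl] : k < 27 /\ y < 27 by rewrite -(mem_lines y) Hkn.
by rewrite -{1}(Hk k Hkk) Hs // eqxx.
Qed.

Lemma determinesP base s : determines base -> preserves_inc s ->
  (forall x, x \in base -> app s x = x) -> s = 1%g.
Proof.
move=> /andP[Hb /allP Hall] Hs fix_base; apply: app_perm => x Hx; rewrite app1 //.
by apply: (forced_closureP Hs Hb fix_base); apply: Hall; rewrite mem_lines.
Qed.

Lemma determines_eq base s h : determines base -> preserves_inc s -> preserves_inc h ->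
  [seq app s x | x <- base] = [seq app h x | x <- base] -> s = h.
Proof.
move=> Hb Hs Hh /eq_in_map E; have [Hlt _] := andP Hb.
apply/eqP; rewrite eq_mulgV1; apply/eqP/(determinesP Hb).
  by apply: preserves_incM => //; apply: preserves_incV.
by move=> x Hx; rewrite appM E // -appM mulgV app1 // (allP Hlt).
Qed.

Lemma third_spec i j k : i < 27 -> j < 27 -> k < 27 -> inc i j ->
  inc i k && inc j k = (k == third i j).
Proof.
have : all (fun i => all (fun j => inc i j ==>
  all (fun k => inc i k && inc j k == (k == third i j)) lines) lines) lines by vm_compute.
move=> /allP Ha; rewrite -!mem_lines => Hi Hj Hk.
by move: (Ha i Hi) => /allP /(_ j Hj) /implyP H /H /allP /(_ k Hk) /eqP.
Qed.

Lemma third_lt i j : i < 27 -> j < 27 -> inc i j -> third i j < 27.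
Proof.
have : all (fun i => all (fun j => inc i j ==> (third i j < 27)) lines) lines by vm_compute.
move=> /allP Ha; rewrite -(mem_lines i) -(mem_lines j) => Hi Hj.
by move: (Ha i Hi) => /allP /(_ j Hj) /implyP.
Qed.

Lemma app_third s i j : preserves_inc s -> i < 27 -> j < 27 -> inc i j ->
  app s (third i j) = third (app s i) (app s j).
Proof.
move=> Hs Hi Hj Hij; apply/eqP; have Hk := third_lt Hi Hj Hij.
rewrite -third_spec ?app_lt ?Hs //.
by rewrite third_spec ?eqxx.
Qed.

Definition skew i j : bool := (i != j) && ~~ inc i j.

(** [cycle_perm] computed on bare numbers; [.-1] passes from the numbering 1 to 27 to the indices 0
    to 26. *)
Definition swap_cycle (a : seq nat) x : nat :=
  match a with
  | a1 :: a' => foldl (fun x n => if x == a1.-1 then n.-1 else if x == n.-1 then a1.-1 else x) x a'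
  | [::] => x
  end.

Definition cycles_list (cs : seq (seq nat)) : seq nat :=
  [seq foldl (fun x a => swap_cycle a x) i cs | i <- lines].

Lemma app_cycles cs i : all (all (fun n => n.-1 < 27)) cs -> i < 27 ->
  app (perm_of_cycles cs) i = nth 0 (cycles_list cs) i.
Proof.
move=> Hcs Hi; rewrite /cycles_list -[lines]/(iota 0 27) (nth_map 0) ?size_iota // nth_iota // add0n.
have line_noE n : n.-1 < 27 -> line_no n = n.-1 :> nat by move=> Hn; rewrite /= modn_small.
have app_tperm a n x : a.-1 < 27 -> n.-1 < 27 -> x < 27 ->
    app (tperm (line_no a) (line_no n)) x
    = if x == a.-1 then n.-1 else if x == n.-1 then a.-1 else x.
  move=> Ha Hn Hx; rewrite /app.
  have Ex (m : nat) : m.-1 < 27 -> (x == m.-1) = (inord x == line_no m).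
    by move=> Hm; rewrite -val_eqE /= inordK // modn_small.
  rewrite !Ex // ![inord x == _]eq_sym; case: tpermP => [->|->|/eqP n1 /eqP n2].
  - by rewrite eqxx line_noE.
  - by rewrite eqxx; case: eqP => [->|_]; rewrite line_noE.
  by rewrite eq_sym (negPf n1) eq_sym (negPf n2) inordK.
have app_cycle a x : all (fun n => n.-1 < 27) a -> x < 27 ->
    app (cycle_perm a) x = swap_cycle a x.
  case: a => [|a1 a] /=; first by rewrite /cycle_perm => _; apply: app1.
  move=> /andP[H1]; elim: a x => [|n a IH] x /=; first by rewrite big_nil => _; apply: app1.
  move=> /andP[Hn Ha] Hx; rewrite big_cons appM app_tperm // IH //.
  by case: ifP => // _; case: ifP.
elim: cs i Hi Hcs => [|a cs IH] i Hi /=; first by rewrite /perm_of_cycles big_nil app1.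
move=> /andP[Ha Hcs]; rewrite /perm_of_cycles big_cons appM app_cycle // IH //.
by rewrite -app_cycle // app_lt.
Qed.

End Permutations.

#[global] Opaque lines incidence_table.

(** * Orbits of tuples *)

Local Open Scope nat_scope.

Definition act (g t : seq nat) : seq nat := [seq nth 0 g x | x <- t].

Section Traversal.
Variable gl : seq (seq nat).

Definition add_new (acc : seq (seq nat) * seq (seq nat)) (u : seq nat) :=
  if u \in acc.2 then acc else (u :: acc.1, u :: acc.2).

Fixpoint bfs n (front seen : seq (seq nat)) : seq (seq nat) :=
  if n is n'.+1 then
    let acc := foldl add_new ([::], seen) [seq act g t | t <- front, g <- gl] in
    if acc.1 is [::] then seen else bfs n' acc.1 acc.2
  else seen.

(** The bound 40 does not affect soundness: every listed tuple lies in the orbit after any number of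
    rounds, and where the whole orbit is needed [orbit_closed] is checked. *)
Definition orbit_list (t : seq nat) : seq (seq nat) := bfs 40 [:: t] [:: t].

Definition orbit_closed (orb : seq (seq nat)) : bool :=
  all (fun t => all (fun g => act g t \in orb) gl) orb.

Section Closure.
Variable Q : seq nat -> Prop.
Hypothesis Q_act : forall g u, g \in gl -> Q u -> Q (act g u).

Lemma bfs_ind n front seen : (forall u, u \in front -> Q u) -> (forall u, u \in seen -> Q u) ->
  forall u, u \in bfs n front seen -> Q u.
Proof.
elim: n front seen => [|n IH] front seen Hf Hs //.
rewrite [bfs _ _ _]/=; set acc := foldl _ _ _.
have [H1 H2] : (forall u, u \in acc.1 -> Q u) /\ (forall u, u \in acc.2 -> Q u).
  have : forall u, u \in [seq act g t | t <- front, g <- gl] -> Q u.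
    by move=> _ /allpairsP[[t g] [/= Ht Hg ->]]; apply: Q_act => //; apply: Hf.
  rewrite /acc; move: [seq act g t | t <- front, g <- gl] => r.
  have : forall u, u \in (([::], seen) : seq (seq nat) * seq (seq nat)).1 -> Q u by [].
  have : forall u, u \in (([::], seen) : seq (seq nat) * seq (seq nat)).2 -> Q u by [].
  elim: r ([::], seen) => [|u r IHr] [a1 a2] /= Q2 Q1 Qr; first by split.
  apply: IHr => [w|w|w Hw]; last by apply: Qr; rewrite inE Hw orbT.
    rewrite /add_new /=; case: ifP => _ /=; first exact: Q2.
    by rewrite inE => /predU1P[->|/Q2 //]; apply: Qr; rewrite mem_head.
  rewrite /add_new /=; case: ifP => _ /=; first exact: Q1.
  by rewrite inE => /predU1P[->|/Q1 //]; apply: Qr; rewrite mem_head.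
by case: (acc.1) H1 => [|w s] H1; [exact: Hs | exact: IH].
Qed.

Lemma orbit_list_ind t : Q t -> forall u, u \in orbit_list t -> Q u.
Proof. by move=> Qt; apply: bfs_ind => u; rewrite inE => /eqP ->. Qed.

End Closure.
End Traversal.

#[global] Opaque orbit_list.

Section GroupOrbits.
Variables (gT : finGroupType) (N : nat) (to : gT -> nat -> nat).
Hypotheses (to1 : forall i, i < N -> to 1%g i = i)
  (toM : forall x y i, to (x * y)%g i = to y (to x i))
  (to_lt : forall x i, to x i < N).
Variables (gs : seq gT) (gl : seq (seq nat)).
Hypothesis gsP : size gs = size gl /\
  forall k i, k < size gs -> i < N -> to (nth 1%g gs k) i = nth 0 (nth [::] gl k) i.

Let H : {group gT} := <<[set x in gs]>>%G.

Let act_gen g t : g \in gl -> all (fun i => i < N) t ->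
  exists2 x, x \in H & act g t = [seq to x i | i <- t].
Proof.
case: gsP => Hsz Hgs Hg /allP Ht.
have Hk : index g gl < size gs by rewrite Hsz index_mem.
exists (nth 1%g gs (index g gl)); first by apply: mem_gen; rewrite inE mem_nth.
by apply/eq_in_map => i /Ht Hi; rewrite Hgs // nth_index.
Qed.

Let gen_act x t : x \in gs -> all (fun i => i < N) t ->
  exists2 g, g \in gl & act g t = [seq to x i | i <- t].
Proof.
case: gsP => Hsz Hgs Hx /allP Ht.
have Hk : index x gs < size gs by rewrite index_mem.
exists (nth [::] gl (index x gs)); first by rewrite mem_nth // -Hsz.
by apply/eq_in_map => i /Ht Hi; rewrite -Hgs // nth_index.
Qed.

Lemma orbit_listP t u : all (fun i => i < N) t -> u \in orbit_list gl t ->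
  exists2 x, x \in H & u = [seq to x i | i <- t].
Proof.
move=> Ht; apply: (orbit_list_ind (Q := fun u => exists2 x, x \in H & u = [seq to x i | i <- t])).
  move=> g _ Hg [x Hx ->].
  have Hxt : all (fun i => i < N) [seq to x i | i <- t] by apply/allP=> _ /mapP[i _ ->].
  have [y Hy ->] := act_gen Hg Hxt; exists (x * y)%g; first exact: groupM.
  by rewrite -map_comp; apply: eq_map => i; rewrite /= toM.
exists 1%g; first exact: group1.
by rewrite -[LHS]map_id; apply/eq_in_map => i Hi; rewrite to1 // (allP Ht).
Qed.

Lemma mem_closed_orbit t orb x : all (fun i => i < N) t -> orbit_closed gl orb -> t \in orb ->
  x \in H -> [seq to x i | i <- t] \in orb.
Proof.
move=> Ht /allP Hc Horb /gen_prodgP[n [c Hcs ->]].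
have Hcs' i : c i \in gs by have := Hcs i; rewrite inE.
elim: n c {Hcs} Hcs' => [|n IH] c Hcs.
  rewrite big_ord0 (_ : [seq _ | _ <- _] = t) // -[RHS]map_id.
  by apply/eq_in_map => i Hi; rewrite to1 // (allP Ht).
rewrite big_ord_recr /=; set y := (\prod_(i < n) _)%g.
have Hy : [seq to y i | i <- t] \in orb by apply: IH.
rewrite (_ : [seq _ | _ <- _] = [seq to (c ord_max) i | i <- [seq to y i | i <- t]]); last first.
  by rewrite -map_comp; apply: eq_map => i; rewrite /= toM.
have [|g Hg <-] := @gen_act (c ord_max) [seq to y i | i <- t] (Hcs _).
  by apply/allP=> _ /mapP[i _ ->].
by move: (Hc _ Hy) => /allP; apply.
Qed.

(** An element fixing every entry of [t] is trivial, so the orbit map is injective on [H]; a list of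
    translates of [t] that contains [t] and is closed under the generators is its whole image. *)
Lemma card_orbit_list t orb : all (fun i => i < N) t -> orb = orbit_list gl t ->
  (forall x, x \in H -> (forall i, i \in t -> to x i = i) -> x = 1%g) ->
  [&& orbit_closed gl orb, t \in orb & uniq orb] -> #|H| = size orb.
Proof.
move=> Ht Eorb faithful /and3P[Hc Hin Hu].
rewrite cardE -(size_map (fun x => [seq to x i | i <- t])).
apply/perm_size/uniq_perm => // [|u].
  rewrite map_inj_in_uniq ?enum_uniq // => x y; rewrite !mem_enum => Hx Hy /eq_in_map E.
  apply/eqP; rewrite eq_mulgV1; apply/eqP/faithful; first by rewrite groupM ?groupV.
  by move=> i Hi; rewrite toM E // -toM mulgV to1 // (allP Ht).
apply/mapP/idP => [[x]|Hu'].
  by rewrite mem_enum => Hx ->; apply: mem_closed_orbit.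
have [|x Hx ->] := @orbit_listP t u Ht; first by rewrite -Eorb.
by exists x; rewrite ?mem_enum.
Qed.

End GroupOrbits.

Section PermGroups.
Variable css : seq (seq (seq nat)).
Definition perm_gens : seq 'S_27 := [seq perm_of_cycles cs | cs <- css].
Definition list_gens : seq (seq nat) := [seq cycles_list cs | cs <- css].
Definition cycle_data : bool := all (all (all (fun n => n.-1 < 27))) css.
Hypothesis css_ok : cycle_data.

Lemma perm_gensP : size perm_gens = size list_gens /\
  forall k i, k < size perm_gens -> i < 27 ->
    app (nth 1%g perm_gens k) i = nth 0 (nth [::] list_gens k) i.
Proof.
split; first by rewrite !size_map.
move=> k i; rewrite size_map => Hk Hi; rewrite !(nth_map [::]) //.
by apply: app_cycles => //; apply: (allP css_ok); apply: mem_nth.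
Qed.

End PermGroups.

Local Open Scope ring_scope.

Local Open Scope nat_scope.

(** * Search for the permutations passing a family of tests *)

Section Search.
Variable pass : seq nat -> seq nat -> bool.
Variable css : seq (seq (seq nat)).
Hypothesis css_ok : cycle_data css.
Let gl := list_gens css.
Let H : {group 'S_27} := <<[set x in perm_gens css]>>%G.

(* To be instantiated by orbit_list; kept abstract as conversion might unfold it. *)
Variable orbit : seq nat -> seq (seq nat).
Hypothesis orbitP : forall t u, all (fun i => i < 27) t -> u \in orbit t ->
  exists2 x, x \in H & u = [seq app x i | i <- t].

(* The line x whose image is chosen next; the positions of two previous lines
   coplanar with x, if these determine it; the tests to run, as lists of
   positions. *)
Definition step := (nat * option (nat * nat) * seq (seq nat))%type.

Definition compatible (prior l : seq nat) x y : bool :=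
  (y \notin l) && all (fun k => inc (nth 0 prior k) x == inc (nth 0 l k) y) (iota 0 (size prior)).

Definition pass_all (prior l : seq nat) (tests : seq (seq nat)) : bool :=
  all (fun q => pass [seq nth 0 prior k | k <- q] [seq nth 0 l k | k <- q]) tests.

Definition extend (prior : seq nat) (st : step) (cands : seq (seq nat)) : seq (seq nat) :=
  let: (x, kind, tests) := st in
  let new := match kind with
    | None => flatten [seq [seq rcons l y | y <- lines & compatible prior l x y] | l <- cands]
    | Some (a, b) => [seq rcons l (third (nth 0 l a) (nth 0 l b)) | l <- cands]
    end in
  [seq l <- new | pass_all (rcons prior x) l tests].

Fixpoint run (prior : seq nat) (sts : seq step) (cands : seq (seq nat)) : seq (seq nat) :=
  if sts is st :: sts' then run (rcons prior st.1.1) sts' (extend prior st cands) else cands.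

Lemma run_cons prior st sts cands :
  run prior (st :: sts) cands = run (rcons prior st.1.1) sts (extend prior st cands).
Proof. by []. Qed.

Fixpoint steps_ok (prior : seq nat) (sts : seq step) : bool :=
  if sts is (x, kind, tests) :: sts' then
    [&& (x < 27) && (x \notin prior),
      if kind is Some (a, b) then
        let: (u, w) := (nth 0 prior a, nth 0 prior b) in
        [&& a < size prior, b < size prior, inc u w & x == third u w]
      else true,
      all (fun q => (size q == 4) && all (fun k => k <= size prior) q) tests & steps_ok (rcons prior x) sts']
  else true.

Definition step_lines (sts : seq step) : seq nat := [seq st.1.1 | st <- sts].

Definition survives (s : 'S_27) : Prop :=
  preserves_inc s /\
  forall q, size q = 4 -> all (fun x => x < 27) q -> pass q [seq app s x | x <- q].

(** The images under a surviving permutation are never discarded. Steps of kind [Some] may compute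
    the next image by [third] because tritangent planes go to tritangent planes. *)
Lemma run_survives s prior sts cands : survives s -> all (fun x => x < 27) prior ->
  steps_ok prior sts -> [seq app s x | x <- prior] \in cands ->
  [seq app s x | x <- prior ++ step_lines sts] \in run prior sts cands.
Proof.
move=> [Hs Ht]; elim: sts prior cands => [|[[x kind] tests] sts IH] prior cands Hp.
  by rewrite cats0.
rewrite [steps_ok _ _]/= => /and4P[/andP[Hx Hnew] Hk Htests Hok] Hin.
have Hp' : all (fun x => x < 27) (rcons prior x) by rewrite all_rcons Hx.
rewrite run_cons -[step_lines _]/(x :: step_lines sts) -cat_rcons; apply: IH => //.
have nth_app l k : k < size l -> nth 0 [seq app s y | y <- l] k = app s (nth 0 l k).
  by move=> Hk'; rewrite (nth_map 0).
rewrite /extend mem_filter; apply/andP; split.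
  apply/allP=> q /(allP Htests)/andP[/eqP q4 Hq]; 
  have {}Hq : all (fun k => k < size (rcons prior x)) q by rewrite size_rcons.
  rewrite (_ : [seq nth 0 [seq app s y | y <- _] k | k <- q] =
    [seq app s y | y <- [seq nth 0 (rcons prior x) k | k <- q]]).
    apply: Ht; rewrite ?size_map //; apply/allP=> _ /mapP[k /(allP Hq) Hk' ->].
    by apply: (allP Hp'); apply: mem_nth.
  by rewrite -map_comp; apply/eq_in_map => k /(allP Hq) Hk'; rewrite nth_app.
rewrite map_rcons; case: kind Hk => [[a b]|_].
  move=> /and4P[Ha Hb Hab /eqP Ex]; apply/mapP; exists [seq app s y | y <- prior] => //.
  by rewrite Ex app_third ?nth_app // (allP Hp) // mem_nth.
apply/flattenP; exists [seq rcons [seq app s y | y <- prior] y |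
    y <- lines & compatible prior [seq app s y | y <- prior] x y].
  by apply/mapP; exists [seq app s y | y <- prior].
apply/mapP; exists (app s x) => //; rewrite mem_filter mem_lines app_lt andbT.
apply/andP; split.
  apply/mapP => -[y Hy /app_inj Exy]; move: Hnew; rewrite Exy ?Hy //.
  exact: (allP Hp).
apply/allP=> k; rewrite mem_iota add0n => /andP[_ Hk].
by rewrite nth_app // Hs // (allP Hp) // mem_nth.
Qed.

(** Keeps one candidate per orbit of [H], which acts on lists of images. If [n] runs out the
    remaining candidates are all kept, which is harmless. *)
Fixpoint representatives n (cands : seq (seq nat)) : seq (seq nat) :=
  if n is n'.+1 then
    if cands is c :: cands' then
      let orb := orbit c in
      c :: representatives n' [seq l <- cands' | l \notin orb]
    else [::]
  else cands.

Lemma representatives_cons n c cands : representatives n.+1 (c :: cands) =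
  c :: representatives n [seq l <- cands | l \notin orbit c].
Proof. by []. Qed.

Lemma representativesP n cands l : l \in cands ->
  exists2 r, r \in representatives n cands & l = r \/ l \in orbit r.
Proof.
elim: n cands => [|n IH] cands; first by exists l => //; left.
case: cands => [|c cands]; first by rewrite in_nil.
rewrite representatives_cons inE => /predU1P[->|Hl].
  by exists c; [apply: mem_head | left].
have [Hc|Hc] := boolP (l \in orbit c).
  by exists c; [apply: mem_head | right; apply: Hc].
have [|r Hr Hlr] := IH [seq l <- cands | l \notin orbit c].
  by rewrite mem_filter Hc.
by exists r; [rewrite inE Hr orbT | apply: Hlr].
Qed.

Lemma representatives_sub n cands : {subset representatives n cands <= cands}.
Proof.
elim: n cands => [|n IH] [|c cands] l; rewrite ?representatives_cons; [exact..|].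
rewrite !inE => /predU1P[->|/IH]; first by rewrite eqxx.
by rewrite mem_filter => /andP[_ ->]; rewrite orbT.
Qed.

Definition preserving_list (g : seq nat) : bool :=
  all (fun i => all (fun j => inc (nth 0 g i) (nth 0 g j) == inc i j) lines) lines.

Hypothesis gens_preserve : all preserving_list gl.

Lemma group_preserves h : h \in H -> preserves_inc h.
Proof.
move=> /gen_prodgP[n [c Hc ->]]; elim: n c Hc => [|n IH] c Hc.
  by rewrite big_ord0 => i j Hi Hj; rewrite !app1.
rewrite big_ord_recr /=; apply: preserves_incM; first by apply: IH.
have := Hc ord_max; rewrite inE => /mapP[cs Hcs ->] i j Hi Hj.
have Hok : all (all (fun n => n.-1 < 27)) cs by exact: (allP css_ok).
rewrite !app_cycles //.
have /(allP gens_preserve)/allP Hg : cycles_list cs \in gl by apply/mapP; exists cs.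
have := Hg i; rewrite mem_lines => /(_ Hi)/allP/(_ j).
by rewrite mem_lines => /(_ Hj)/eqP.
Qed.

Variables (sts1 sts2 : seq step) (base : seq nat).
Let order := step_lines (sts1 ++ sts2).

(** The reduction by [H] sits between the stages, where candidates are still short: with
    [first_steps] they are the 270 possible images of a pair of meeting lines, completed by the
    third line of their plane. The filter provides the bound on entries that [orbitP] requires. *)
Definition search_ok : bool :=
  let cands1 := [seq l <- run [::] sts1 [:: [::]] | all (fun x => x < 27) l] in
  let orb := orbit base in
  all (fun l => [seq nth 0 l (index x order) | x <- base] \in orb)
    (run (step_lines sts1) sts2 (representatives (size cands1) cands1)).

Hypotheses (sts_ok : steps_ok [::] (sts1 ++ sts2)) (base_ok : determines base)
  (base_order : all (fun x => x \in order) base).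

(** Passing to a representative replaces [s] by some [s * h], hence the hypothesis on the whole
    coset. At the end [s * h] agrees with an element of [H] on [base], and [base] determines it. *)
Lemma search_complete s : search_ok -> (forall h, h \in H -> survives (s * h)%g) -> s \in H.
Proof.
move=> Hok Hs.
have ok1 : steps_ok [::] sts1 /\ steps_ok (step_lines sts1) sts2.
  have cat_ok prior a b : steps_ok prior (a ++ b) ->
      steps_ok prior a /\ steps_ok (prior ++ step_lines a) b.
    elim: a prior => [|[[x kind] tests] a IH] prior /=; first by rewrite cats0.
    by move=> /and4P[-> -> -> /IH]; rewrite cat_rcons.
  exact: cat_ok sts_ok.
have lt27 sts prior : steps_ok prior sts -> all (fun x => x < 27) (step_lines sts).
  by elim: sts prior => [|[[x kind] tests] sts IH] //= prior /and4P[/andP[-> _] _ _ /IH].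
have Hs1 : survives s by rewrite -[s]mulg1; apply: Hs; apply: group1.
move: Hok; rewrite /search_ok; set cands1 := [seq l <- _ | _] => Hok.
have Hc1 : [seq app s x | x <- step_lines sts1] \in cands1.
  rewrite mem_filter (@run_survives s [::] sts1 [:: [::]] Hs1 isT ok1.1 (mem_head _ _)) andbT.
  by apply/allP=> _ /mapP[x _ ->]; apply: app_lt.
have [r Hr Hlr] := representativesP (size cands1) Hc1.
have Hrlt : all (fun x => x < 27) r.
  by have := representatives_sub Hr; rewrite mem_filter => /andP[].
have [h Hh Er] : exists2 h, h \in H & [seq app (s * h)%g x | x <- step_lines sts1] = r.
  case: Hlr => [<-|Horb]; first by exists 1%g => //; rewrite mulg1.
  have [h Hh E] := orbitP Hrlt Horb.
  exists h^-1%g; first by rewrite groupV.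
  transitivity [seq app h^-1%g y | y <- [seq app s x | x <- step_lines sts1]].
    by rewrite -map_comp; apply: eq_map => x; rewrite /= appM.
  rewrite E -map_comp -[RHS]map_id; apply/eq_in_map => x Hx /=.
  by rewrite -appM mulgV app1 // (allP Hrlt).
have Hsh : survives (s * h)%g by exact: Hs.
rewrite -Er in Hr.
have /(allP Hok) := run_survives Hsh (lt27 _ _ ok1.1) ok1.2 Hr.
rewrite -map_cat (_ : [seq nth 0 _ _ | x <- base] = [seq app (s * h)%g x | x <- base]); last first.
  apply/eq_in_map => x /(allP base_order) Hx.
  by rewrite (nth_map 0) ?index_mem // nth_index.
have Hbase : all (fun x => x < 27) base by case/andP: base_ok.
move=> /(orbitP Hbase)[k Hk E].
have <- : (k * h^-1)%g = s.
  rewrite -(determines_eq base_ok Hsh.1 (group_preserves Hk) E).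
  by rewrite mulgK.
by rewrite groupM ?groupV.
Qed.

End Search.

Local Open Scope ring_scope.

(** * The stabilizer at a nondegenerate point of the moduli *)

(** An injection of the finite set of skew pairs into itself is onto, so one direction of the
    equivalence suffices. *)
Lemma skew_preserving (s : 'S_27) :
  (forall i j, (i < 27)%N -> (j < 27)%N -> skew i j -> skew (app s i) (app s j)) ->
  preserves_inc s.
Proof.
move=> Hs i j Hi Hj.
pose S := [set p : 'I_27 * 'I_27 | skew p.1 p.2].
pose f (p : 'I_27 * 'I_27) := (s p.1, s p.2).
have f_inj : injective f by move=> [a b] [a' b'] [/perm_inj -> /perm_inj ->].
have fS : f @: S = S.
  apply/eqP; rewrite eqEcard card_imset // leqnn andbT.
  apply/subsetP=> _ /imsetP[[a b] Hab ->]; move: Hab; rewrite !inE /= => Hab.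
  by rewrite -!app_val /=; apply: Hs; rewrite ?ltn_ord.
have E : skew (app s i) (app s j) = skew i j.
  pose a : 'I_27 := inord i; pose b : 'I_27 := inord j.
  have [Ea Eb] : a = i :> nat /\ b = j :> nat by rewrite !inordK.
  apply/idP/idP => [Hsk|]; last exact: Hs.
  have : f (a, b) \in S by rewrite inE /f /= -!app_val Ea Eb.
  rewrite -fS => /imsetP[p Hp /f_inj Ep].
  by move: Hp; rewrite -Ep inE /= Ea Eb.
move: E; rewrite /skew; have [->|Hij] := eqVneq i j.
  have irr k : (k < 27)%N -> inc k k = false.
    have : all (fun k => ~~ inc k k) lines by vm_compute.
    by move=> /allP Ha; rewrite -mem_lines => /Ha/negPf.
  by rewrite !irr ?app_lt.
have -> : app s i != app s j by apply: contraNneq Hij => /app_inj->.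
by move=> /= /negb_inj.
Qed.

(** E1, G4, E2, G3, E3, E5: the lines whose position a labelling prescribes. *)
Lemma label_base : determines [:: 0; 9; 1; 8; 2; 4]%N.
Proof. by vm_compute. Qed.

Section Nondegenerate.
Variables (K : closedFieldType) (env : nat -> K).
Local Notation surf := (surface env).
Local Notation L := (table_line env).
Local Notation LP := (LP env).
Local Notation LQ := (LQ env).

Definition gram (i j : nat) : K := pairing (LP i) (LQ i) (LP j) (LQ j).

(** Equality of the ratios p_ij p_lk / (p_ik p_lj) for [q] and for its image [p], cleared of
    denominators; the tuples are read in the order i, l, j, k. *)
Definition quad_defect (q p : seq nat) : K :=
  let: (i, l, j, k) := (nth 0 q 0, nth 0 q 1, nth 0 q 2, nth 0 q 3)%N in
  let: (i', l', j', k') := (nth 0 p 0, nth 0 p 1, nth 0 p 2, nth 0 p 3)%N in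
  gram i j * gram l k * (gram i' k' * gram l' j')
  - gram i k * gram l j * (gram i' j' * gram l' k').

(** This makes the entries of the table 27 distinct lines with the expected skew pairs. For lines
    that meet, distinctness is a nonzero minor of their Plücker vectors. The last condition, F
    nonzero, is for the chart of [plucker_mem] used to recognize E5. *)
Definition nondegenerate : Prop :=
  [/\ forall i j, (i < 27)%N -> (j < 27)%N -> skew i j -> gram i j != 0,
      forall i j, (i < 27)%N -> (j < 27)%N -> inc i j -> exists a b c d,
        wedge (LP i) (LQ i) a b * wedge (LP j) (LQ j) c d
        - wedge (LP i) (LQ i) c d * wedge (LP j) (LQ j) a b != 0
    & env 2%N != 0].

Hypothesis char0 : [pchar K] =i pred0.
Hypothesis nondeg : nondegenerate.
Variable N : label -> {vspace 'cV[K]_4}.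
Hypothesis HN : labelling (par_b env) 1 (par_d env) (par_e env) (par_f env) N.

Let skew_ex i : (i < 27)%N -> exists2 j, (j < 27)%N & skew i j.
Proof.
have : all (fun i => has (skew i) lines) lines by vm_compute.
by move=> /allP Ha; rewrite -mem_lines => /Ha/hasP[j]; rewrite mem_lines; exists j.
Qed.

Let dimL i : (i < 27)%N -> \dim (L i) = 2%N.
Proof.
move=> Hi; have [j Hj Hij] := skew_ex Hi; apply: (@dim_span2 _ _ _ (LP j) (LQ j)).
by case: nondeg => H _ _; apply: (H i j).
Qed.

Let line_L i : (i < 27)%N -> line_of surf (L i).
Proof.
move=> Hi; split; first exact: dimL.
by move=> v Hv v0; split=> //; apply: table_line_on_surface Hv.
Qed.

Let L_inj i j : (i < 27)%N -> (j < 27)%N -> L i = L j -> i = j.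
Proof.
case: nondeg => Hskew Hinc _ Hi Hj E; apply/eqP/negPn/negP => Hij.
case Hc: (inc i j).
  have [a [b [c [d]]]] := Hinc i j Hi Hj Hc; rewrite subr_eq0 => /eqP; apply.
  by have [k Hk] := span2_wedge E; rewrite !Hk; ring.
have := Hskew i j Hi Hj; rewrite /skew Hij Hc => /(_ isT)/eqP; apply; apply: meet_pairing.
by rewrite /meet -/(L i) -/(L j) -E capvv -dimv_eq0 dimL.
Qed.

(* A permutation p with L i = N (label_of (p i)) preserves skewness, hence
   incidence, and fixes the six lines of the labelling. *)
Lemma label_lineE (i : 'I_27) : N (label_of i) = L i.
Proof.
have /fin_all_exists[p0 Hp] (j : 'I_27) : exists k : 'I_27, L j = N (label_of k).
  by case: HN => _ _ Hall _ _ _ _ _ _ _; apply: Hall; apply: line_L.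
have p_inj : injective p0.
  by move=> j k E; apply/val_inj/L_inj => //=; rewrite !Hp E.
pose p := perm p_inj.
have {}Hp (j : 'I_27) : L j = N (label_of (p j)) by rewrite permE.
have pinc : preserves_inc p.
  apply: skew_preserving => j k Hj Hk Hjk.
  have [Ej Ek] : (inord j : 'I_27) = j :> nat /\ (inord k : 'I_27) = k :> nat by rewrite !inordK.
  have ne : p (inord j) != p (inord k).
    by rewrite (inj_eq perm_inj) -val_eqE /= Ej Ek; case/andP: Hjk.
  rewrite /app /skew val_eqE ne incE /= -(lab_meet HN) // -!Hp Ej Ek.
  by apply/negP=> /meet_pairing; apply/eqP; case: nondeg => H _ _; apply: H.
suff p1 : p = 1%g by rewrite Hp p1 perm1.
apply: (determinesP label_base pinc).
have fixed (j : 'I_27) : N (label_of j) = L j -> app p j = j.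
  by move=> E; rewrite app_val; congr val; apply: (lab_inj HN); rewrite /= -Hp.
have mem_base (P Q : 'cV[K]_4) (l : {vspace 'cV[K]_4}) (C : 'cV[K]_4 -> Prop) :
    (forall v, v \in l <-> C v) -> (forall a b, C (a *: P + b *: Q)) ->
    (forall v, C v -> exists a b, v = a *: P + b *: Q) -> l = span2 P Q.
  move=> H1 H2 H3; apply/vspaceP=> v; apply/idP/mem_span2 => [/H1/H3 //|[a [b ->]]].
  exact/H1.
move=> j; rewrite !inE => /or4P[/eqP->|/eqP->|/eqP->|/or3P[/eqP->|/eqP->|/eqP->]].
- apply: (fixed (@Ordinal 27 0 isT)); apply: mem_base (lab_E1 HN) _ _ => [a b|v [Ey Ez]].
    by rewrite !mxE /=; split; ring.
  exists (v it 0), (v ix 0); apply: colP4; rewrite !mxE /= ?Ey ?Ez; ring.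
- apply: (fixed (@Ordinal 27 9 isT)); apply: mem_base (lab_G4 HN) _ _ => [a b|v [Ex Ey]].
    by rewrite !mxE /=; split; ring.
  exists (v it 0), (v iz 0); apply: colP4; rewrite !mxE /= ?Ex ?Ey; ring.
- apply: (fixed (@Ordinal 27 1 isT)); apply: mem_base (lab_E2 HN) _ _ => [a b|v [Ex Et]].
    by rewrite !mxE /=; split; ring.
  exists (v iz 0), (v iy 0); apply: colP4; rewrite !mxE /= ?Ex ?Et; ring.
- apply: (fixed (@Ordinal 27 8 isT)); apply: mem_base (lab_G3 HN) _ _ => [a b|v].
    by rewrite !mxE /=; split; ring.
  move=> [/eqP]; rewrite subr_eq0 => /eqP Ex /eqP; rewrite subr_eq0 => /eqP Ey.
  exists (v it 0), (v iz 0); apply: colP4; rewrite !mxE /= ?Ex ?Ey; ring.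
- apply: (fixed (@Ordinal 27 2 isT)); apply: mem_base (lab_E3 HN) _ _ => [a b|v].
    by rewrite !mxE /=; split; ring.
  move=> [/eqP]; rewrite subr_eq0 => /eqP Ex /eqP; rewrite addr_eq0 => /eqP Ez.
  exists (v iz 0), (v iy 0); apply: colP4; rewrite !mxE /= ?Ex ?Ez; ring.
apply: (fixed (@Ordinal 27 4 isT)); apply/esym/eqP; rewrite eqEdim dimL //.
have [-> _] := lab_line HN (@Ordinal 27 4 isT); rewrite leqnn andbT.
have F0 : env 2%N != 0 by case: nondeg.
have E5 := lab_E5 HN; rewrite /= in E5.
(* Here c + f is F and B is - F, so the coordinate p12 = (c + f) B^2 of E5 is F^3. *)
have p12 : (1 + par_f env) * (par_b env * 1 - 1 * par_f env + par_e env * par_f env) ^+ 2 != 0.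
  rewrite (_ : _ * _ = env 2%N ^+ 3) ?expf_neq0 // /par_b /par_e /par_f; ring.
have HP : LP 4 \in N (E 5).
  by apply: (plucker_mem E5 p12); rewrite !mxE /= /par_b /par_d /par_e /par_f; ring.
have HQ : LQ 4 \in N (E 5).
  by apply: (plucker_mem E5 p12); rewrite !mxE /= /par_b /par_d /par_e /par_f; ring.
by apply/subvP=> v /mem_span2[a [b ->]]; rewrite memvD // memvZ.
Qed.

End Nondegenerate.

(** E1 and G2, ..., G6: a line together with one line from each of the five tritangent planes
    through it. *)
Lemma stabilizer_base : determines [:: 0; 7; 8; 9; 10; 11]%N.
Proof. by vm_compute. Qed.

Section Stabilizer.
Variables (K : closedFieldType) (env : nat -> K).
Local Notation surf := (surface env).
Local Notation L := (table_line env).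
Local Notation LP := (LP env).
Local Notation LQ := (LQ env).
Hypothesis char0 : [pchar K] =i pred0.
Hypothesis nondeg : nondegenerate env.
Variable N : label -> {vspace 'cV[K]_4}.
Hypothesis HN : labelling (par_b env) 1 (par_d env) (par_e env) (par_f env) N.
Implicit Types (M : 'M[K]_4) (s : 'S_27) (l : {vspace 'cV[K]_4}).

Let NE (i : 'I_27) : N (label_of i) = L i.
Proof. exact: label_lineE. Qed.

Let ordE k : (k < 27)%N -> exists i : 'I_27, k = i.
Proof. by move=> Hk; exists (Ordinal Hk). Qed.

Let gram_inc i j : (i < 27)%N -> (j < 27)%N -> inc i j || (i == j) -> gram env i j = 0.
Proof.
move=> /ordE[{}i ->] /ordE[{}j ->].
have [->|Hij] := eqVneq i j; first by rewrite /gram /pairing /wedge => _; ring.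
rewrite val_eqE (negPf Hij) orbF => Hinc; apply: meet_pairing.
by rewrite -![span2 _ _]/(L _) -!NE (lab_meet HN) // -incE.
Qed.

Let gram_neq0 i j : (i < 27)%N -> (j < 27)%N -> (gram env i j != 0) = skew i j.
Proof.
move=> Hi Hj; apply/idP/idP => [|Hs]; last by case: nondeg => H _ _; apply: H.
by apply: contraR; rewrite negb_and !negbK orbC => H; apply/eqP/gram_inc.
Qed.

Lemma image_line_table M i : image_line M (L i) = span2 (M *m LP i) (M *m LQ i).
Proof. exact: image_span2. Qed.

Lemma image_lineM M1 M2 l : image_line (M2 *m M1) l = image_line M2 (image_line M1 l).
Proof.
rewrite /image_line -limg_comp; congr (_ @: _)%VS; apply/lfunP=> v.
by rewrite comp_lfunE !lfunE /= mulmxA.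
Qed.

Lemma image_line1 l : image_line 1%:M l = l.
Proof.
rewrite /image_line (_ : linfun _ = \1%VF) ?lim1g //.
by apply/lfunP=> u; rewrite lfunE /= mul1mx id_lfunE.
Qed.

Lemma image_lineK M l : M \in unitmx -> image_line (invmx M) (image_line M l) = l.
Proof. by move=> Mu; rewrite -image_lineM mulVmx // image_line1. Qed.

Let skew_ex i : (i < 27)%N -> exists2 j, (j < 27)%N & gram env i j != 0.
Proof.
have : all (fun i => has (skew i) lines) lines by vm_compute.
move=> /allP Ha Hi; move: (Hi); rewrite -mem_lines => /Ha/hasP[j].
by rewrite mem_lines => Hj Hs; exists j; rewrite ?gram_neq0.
Qed.

(** The image of a line stays two-dimensional, since its pairing with the image of a skew line is
    nonzero; being on the surface, it is one of the lines by [lab_all]. *)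
Lemma in_stab_perm M : in_stab surf M -> exists s, induces N M s.
Proof.
move=> [Mu HM].
have dM : \det M != 0 by rewrite -unitfE -unitmxE.
have imageL (i : 'I_27) : exists j : 'I_27, image_line M (N (label_of i)) = N (label_of j).
  apply: (lab_all HN); rewrite NE image_line_table; split.
    have [//|j Hj Hij] := @skew_ex i; apply: (@dim_span2 _ _ _ (M *m LP j) (M *m LQ j)).
    by rewrite pairing_mul mulf_neq0.
  move=> _ /mem_span2[a [b ->]] v0; apply/HM.
  exists (a *: LP i + b *: LQ i); last by rewrite mulmxDr !scalemxAr.
  split; first by apply: contraNneq v0 => E; rewrite !scalemxAr -mulmxDr E mulmx0.
  by apply: (@table_line_on_surface K env i) => //; apply/mem_span2; exists a, b.
have [f Hf] := fin_all_exists imageL.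
have f_inj : injective f.
  move=> i j E; apply: (lab_inj HN); rewrite /=.
  by rewrite -(image_lineK (N (label_of i)) Mu) Hf E -Hf image_lineK.
by exists (perm f_inj) => i; rewrite permE.
Qed.

Lemma induces_table M s i : induces N M s -> (i < 27)%N ->
  span2 (M *m LP i) (M *m LQ i) = L (app s i).
Proof. by move=> HM /ordE[{}i ->]; rewrite app_val -image_line_table -!NE HM. Qed.

Lemma induces_scale M s i : induces N M s -> (i < 27)%N ->
  exists c, forall R S, pairing (M *m LP i) (M *m LQ i) R S
                        = c * pairing (LP (app s i)) (LQ (app s i)) R S.
Proof. by move=> HM Hi; apply: span2_pairing; apply: induces_table. Qed.

Lemma induces_gram M s : induces N M s -> exists c : nat -> K, forall i j,
  (i < 27)%N -> (j < 27)%N ->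
  \det M * gram env i j = c i * c j * gram env (app s i) (app s j).
Proof.
move=> HM.
have /fin_all_exists[c Hc] (i : 'I_27) := induces_scale HM (ltn_ord i).
exists (fun i => c (inord i)) => i j /ordE[{}i ->] /ordE[{}j ->].
by rewrite !inord_val /gram -pairing_mul Hc pairingC Hc pairingC mulrA.
Qed.

Lemma stab_preserves_inc M s : in_stab surf M -> induces N M s -> preserves_inc s.
Proof.
move=> [Mu _] /induces_gram[c Hc]; apply: skew_preserving => i j Hi Hj.
have dM : \det M != 0 by rewrite -unitfE -unitmxE.
rewrite -!gram_neq0 ?app_lt // => Hij.
have : \det M * gram env i j != 0 by rewrite mulf_neq0.
by rewrite Hc // !mulf_eq0 !negb_or => /andP[].
Qed.

Lemma stab_quad M s q : in_stab surf M -> induces N M s -> all (fun x => (x < 27)%N) q ->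
  size q = 4%N -> quad_defect env q [seq app s x | x <- q] = 0.
Proof.
move=> [Mu _] /induces_gram[c Hc].
have dM : \det M != 0 by rewrite -unitfE -unitmxE.
case: q => [|i [|l [|j [|k []]]]] //= /and5P[Hi Hl Hj Hk _] _.
(* The factor [\det M ^+ 2] lets both pairings in each term be transformed; the two terms then carry
   the same product of the four scalars [c]. *)
apply: (mulfI (expf_neq0 2 dM)); rewrite mulr0 /quad_defect /=.
set G' := gram env (app s _) (app s _) * gram env (app s _) (app s _).
set G'' := gram env (app s _) (app s _) * gram env (app s _) (app s _).
transitivity ((\det M * gram env i j) * (\det M * gram env l k) * G'
  - (\det M * gram env i k) * (\det M * gram env l j) * G''); first ring.
rewrite !Hc // /G' /G''; ring.
Qed.

(** G4 cuts E1 and E2 in the points e_t and e_z, which are therefore eigenvectors. The columns of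
    e_x and e_y keep one unknown each off the diagonal, at (t, x) and (z, y); E3 and G3 remove
    these. *)
Lemma fixing_base_scalar M :
  (forall i, i \in [:: 0; 9; 1; 8; 2]%N -> image_line M (L i) = L i) ->
  M = (M it it)%:M.
Proof.
move=> HM.
have n2 : 2%:R != 0 :> K by rewrite ((pcharf0P K).1 char0).
pose e k : 'cV[K]_4 := delta_mx k 0.
have Me i k : (M *m e k) i 0 = M i k by rewrite -colE mxE.
have mem i (v : 'cV[K]_4) : i \in [:: 0; 9; 1; 8; 2]%N -> v \in L i -> M *m v \in L i.
  by move=> Hi Hv; rewrite -(HM i Hi) /image_line -(lfunE (mulmx M)) memv_img.
have eqE1 v : v \in L 0 <-> v iy 0 = 0 /\ v iz 0 = 0.
  by rewrite -(lab_E1 HN) (NE (@Ordinal 27 0 isT)).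
have eqE2 v : v \in L 1 <-> v ix 0 = 0 /\ v it 0 = 0.
  by rewrite -(lab_E2 HN) (NE (@Ordinal 27 1 isT)).
have eqE3 v : v \in L 2 <-> v ix 0 - v iy 0 = 0 /\ v iz 0 + v it 0 = 0.
  by rewrite -(lab_E3 HN) (NE (@Ordinal 27 2 isT)).
have eqG3 v : v \in L 8 <-> v ix 0 - v it 0 = 0 /\ v iy 0 - v iz 0 = 0.
  by rewrite -(lab_G3 HN) (NE (@Ordinal 27 8 isT)).
have eqG4 v : v \in L 9 <-> v ix 0 = 0 /\ v iy 0 = 0.
  by rewrite -(lab_G4 HN) (NE (@Ordinal 27 9 isT)).
have [|Myt Mzt] := (eqE1 (M *m e it)).1 _.
  by apply: mem => //; apply/eqE1; rewrite !mxE.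
have [|Mxt _] := (eqG4 (M *m e it)).1 _.
  by apply: mem => //; apply/eqG4; rewrite !mxE.
have [|Myx Mzx] := (eqE1 (M *m e ix)).1 _.
  by apply: mem => //; apply/eqE1; rewrite !mxE.
have [|Mxz Mtz] := (eqE2 (M *m e iz)).1 _.
  by apply: mem => //; apply/eqE2; rewrite !mxE.
have [|_ Myz] := (eqG4 (M *m e iz)).1 _.
  by apply: mem => //; apply/eqG4; rewrite !mxE.
have [|Mxy Mty] := (eqE2 (M *m e iy)).1 _.
  by apply: mem => //; apply/eqE2; rewrite !mxE.
have [|_ E3a] := (eqE3 (M *m (e iz - e it))).1 _.
  by apply: mem => //; apply/eqE3; rewrite !mxE /=; split; ring.
have [|E3b E3c] := (eqE3 (M *m (e ix + e iy))).1 _.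
  by apply: mem => //; apply/eqE3; rewrite !mxE /=; split; ring.
have [|G3a _] := (eqG3 (M *m (e ix + e it))).1 _.
  by apply: mem => //; apply/eqG3; rewrite !mxE /=; split; ring.
have [|_ G3b] := (eqG3 (M *m (e iy + e iz))).1 _.
  by apply: mem => //; apply/eqG3; rewrite !mxE /=; split; ring.
have addE (v w : 'cV[K]_4) i : (v + w) i 0 = v i 0 + w i 0 by rewrite mxE.
have oppE (v : 'cV[K]_4) i : (- v) i 0 = - v i 0 by rewrite mxE.
move: Myt Mzt Mxt Myx Mzx Mxz Mtz Myz Mxy Mty E3a E3b E3c G3a G3b.
rewrite !(mulmxDr, mulmxN) !(addE, oppE) !Me.
move=> Myt Mzt Mxt Myx Mzx Mxz Mtz Myz Mxy Mty E3a E3b E3c G3a G3b.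
have eq_of (x y z : K) : z = 0 -> x - y = z -> x = y.
  by move=> -> /eqP; rewrite subr_eq0 => /eqP.
have Ezz : M iz iz = M it it by apply: (eq_of _ _ _ E3a); rewrite Mzt Mtz; ring.
have Eyy : M ix ix = M iy iy by apply: (eq_of _ _ _ E3b); rewrite Mxy Myx; ring.
(* In the sum of the two relations from G3 the entries (t, x) and (z, y) cancel, their sum being 0
   by E3; what remains is 2 M_xx = 2 M_tt. *)
have Ex : M ix ix = M it it.
  apply: (mulIf n2); have H0 : 0 + 0 + 0 = 0 :> K by rewrite !addr0.
  apply: (eq_of _ _ _ H0); rewrite -{1}G3a -{1}G3b -E3c Mzx Mty Mxt Myz Ezz Eyy; ring.
have Etx : M it ix = 0 by apply/esym/(eq_of _ _ _ G3a); rewrite Mxt Ex; ring.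
have Ezy : M iz iy = 0 by apply/esym/(eq_of _ _ _ G3b); rewrite Myz -Eyy Ex Ezz; ring.
apply/matrixP=> i j; rewrite [RHS]mxE; elim/ord4_ind: i; elim/ord4_ind: j => //=;
  by rewrite ?mulr0n // -?Eyy ?Ezz.
Qed.

Lemma induces_unique M1 M2 s : in_stab surf M1 -> in_stab surf M2 ->
  induces N M1 s -> induces N M2 s -> same_in_PGL M1 M2.
Proof.
move=> [M1u _] [M2u _] H1 H2.
have HM : invmx M1 *m M2 = ((invmx M1 *m M2) it it)%:M.
  apply: fixing_base_scalar => i Hi.
  have /ordE[{Hi} j ->] : (i < 27)%N by move: i Hi; apply/allP.
  by rewrite image_lineM -NE H2 -H1 image_lineK.
set k := _ it it in HM; exists k; last by rewrite -mul_mx_scalar -HM mulKVmx.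
apply: contraTneq M2u => k0; rewrite unitmxE -(mulKVmx M1u M2) HM k0.
by rewrite mul_mx_scalar detZ expr0n mul0r unitr0.
Qed.

Lemma in_stabM M1 M2 s1 s2 : in_stab surf M1 -> in_stab surf M2 ->
  induces N M1 s1 -> induces N M2 s2 ->
  in_stab surf (M2 *m M1) /\ induces N (M2 *m M1) (s1 * s2)%g.
Proof.
move=> [M1u H1] [M2u H2] I1 I2; split; last by move=> i; rewrite image_lineM I1 I2 permM.
split=> [|v]; first by rewrite unitmx_mul M2u.
split=> [/H2[w /H1[u Hu ->] ->]|[u Hu ->]]; first by exists u; rewrite ?mulmxA.
by rewrite -mulmxA; apply/H2; exists (M1 *m u) => //; apply/H1; exists u.
Qed.

Lemma in_stab1 : in_stab surf 1%:M /\ induces N 1%:M 1%g.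
Proof.
split; last by move=> i; rewrite image_line1 perm1.
split=> [|v]; first exact: unitmx1.
by split=> [Hv|[w Hw ->]]; [exists v; rewrite ?mul1mx | rewrite mul1mx].
Qed.

Lemma semi_invariant_in_stab M k : M \in unitmx -> k != 0 ->
  (forall w, eval_at surf (M *m w) = k * eval_at surf w) -> in_stab surf M.
Proof.
move=> Mu k0 HM; split=> // v; split=> [[v0 Hv]|[w [w0 Hw] ->]].
  exists (invmx M *m v); last by rewrite mulKVmx.
  split; first by apply: contraNneq v0 => E; rewrite -(mulKVmx Mu v) E mulmx0.
  by apply: (mulfI k0); rewrite -HM mulKVmx // mulr0.
split; last by rewrite HM Hw mulr0.
by apply: contraNneq w0 => E; rewrite -(mulKmx Mu w) E mulmx0.
Qed.

(* M L_i = L_j is excluded for j <> s i by a line L_k meeting L_j but not M L_i. *)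
Lemma induces_detected M s : in_stab surf M -> preserves_inc s ->
  (forall i j, i \in [:: 0; 7; 8; 9; 10; 11]%N -> (j < 27)%N -> j != app s i ->
    exists k, [/\ (k < 27)%N, inc j k || (j == k) &
      pairing (M *m LP i) (M *m LQ i) (LP k) (LQ k) != 0]) ->
  induces N M s.
Proof.
move=> HM Hs Hdet; have [s' Hs'] := in_stab_perm HM.
suff <- : s' = s by [].
apply: (determines_eq stabilizer_base (stab_preserves_inc HM Hs') Hs).
apply/eq_in_map => i Hi; apply/eqP/negPn/negP => Hne.
have [k [Hk Hinc /eqP]] := Hdet i (app s' i) Hi (app_lt _ _) Hne; apply.
have Hi27 : (i < 27)%N by move: i Hi {Hne Hinc}; apply/allP.
have [c ->] := induces_scale Hs' Hi27.
by rewrite -/(gram env _ _) gram_inc ?mulr0 ?app_lt.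
Qed.

End Stabilizer.

(** * Generic properties and their numerical certification *)

Section Generic.
Variables (K : closedFieldType) (env0 : nat -> K).
Implicit Types (C D : (nat -> K) -> Prop).

(** A basic open neighbourhood of the sample point. Witnesses of finitely many properties multiply,
    and each property holds at [env0] itself, which is what families with one surface use. *)
Definition generic C : Prop :=
  exists2 x, ev env0 x != 0 & forall env, ev env x != 0 -> C env.

Lemma generic_imp C D : (forall env, C env -> D env) -> generic C -> generic D.
Proof. by move=> CD [x H0 H]; exists x => // env /H/CD. Qed.

Lemma generic_ex x : ev env0 x != 0 -> generic (fun env => ev env x != 0).
Proof. by exists x. Qed.

Lemma generic_true C : (forall env, C env) -> generic C.
Proof. by move=> HC; exists (Cst 1) => /=; rewrite ?oner_eq0. Qed.

Lemma generic_and C D : generic C -> generic D -> generic (fun env => C env /\ D env).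
Proof.
move=> [x Hx HC] [y Hy HD]; exists (Mul x y); first by rewrite /= mulf_neq0.
by move=> env /=; rewrite mulf_eq0 negb_or => /andP[/HC ? /HD ?].
Qed.

Lemma generic_all (T : eqType) (r : seq T) (C : T -> (nat -> K) -> Prop) :
  (forall u, u \in r -> generic (C u)) -> generic (fun env => forall u, u \in r -> C u env).
Proof.
elim: r => [|u r IH] Hr; first by apply: generic_true => env u; rewrite in_nil.
have Hr' : generic (fun env => forall w, w \in r -> C w env).
  by apply: IH => w Hw; apply: Hr; rewrite inE Hw orbT.
apply: generic_imp (generic_and (Hr u (mem_head _ _)) Hr') => env [Hu Hall] w.
by rewrite inE => /predU1P[->|/Hall].
Qed.

End Generic.

Definition wedge_ex (P Q : seq ex) a b : ex :=
  (nth 0 P a * nth 0 Q b - nth 0 P b * nth 0 Q a)%ex.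
Definition plucker_ex (P Q : seq ex) : seq ex :=
  [:: wedge_ex P Q 0 1; wedge_ex P Q 0 2; wedge_ex P Q 0 3;
      wedge_ex P Q 1 2; wedge_ex P Q 1 3; wedge_ex P Q 2 3]%N.
Definition pair_ex (p q : seq ex) : ex :=
  (nth 0 p 0 * nth 0 q 5 - nth 0 p 1 * nth 0 q 4 + nth 0 p 2 * nth 0 q 3
   + nth 0 p 3 * nth 0 q 2 - nth 0 p 4 * nth 0 q 1 + nth 0 p 5 * nth 0 q 0)%ex.
Definition line_ex i : seq ex :=
  plucker_ex (nth ([::], [::]) line_table i).1 (nth ([::], [::]) line_table i).2.
Definition gram_ex i j : ex := pair_ex (line_ex i) (line_ex j).
Definition minor_ex i j a b : ex :=
  (nth 0 (line_ex i) a * nth 0 (line_ex j) b - nth 0 (line_ex i) b * nth 0 (line_ex j) a)%ex.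
Definition quad_ex (q p : seq nat) : ex :=
  let: (i, l, j, k) := (nth 0 q 0, nth 0 q 1, nth 0 q 2, nth 0 q 3)%N in
  let: (i', l', j', k') := (nth 0 p 0, nth 0 p 1, nth 0 p 2, nth 0 p 3)%N in
  (gram_ex i j * gram_ex l k * (gram_ex i' k' * gram_ex l' j')
   - gram_ex i k * gram_ex l j * (gram_ex i' j' * gram_ex l' k'))%ex.
Definition mulv_ex (M : seq (seq ex)) (P : seq ex) : seq ex :=
  [seq (nth 0 r 0 * nth 0 P 0 + nth 0 r 1 * nth 0 P 1 + nth 0 r 2 * nth 0 P 2
        + nth 0 r 3 * nth 0 P 3)%ex | r <- M].
Definition image_ex (M : seq (seq ex)) i : seq ex :=
  plucker_ex (mulv_ex M (nth ([::], [::]) line_table i).1)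
             (mulv_ex M (nth ([::], [::]) line_table i).2).
Definition det_ex (M : seq (seq ex)) : ex :=
  let col j := [seq nth 0%ex r j | r <- M] in
  pair_ex (plucker_ex (col 0) (col 1)) (plucker_ex (col 2) (col 3)).

Section Evaluation.
Variables (K : closedFieldType) (env : nat -> K).

Definition mat (M : seq (seq ex)) : 'M[K]_4 :=
  \matrix_(i, j) ev env (nth 0%ex (nth [::] M i) j).

Lemma ev_gram i j : ev env (gram_ex i j) = gram env i j.
Proof. by rewrite /gram /pairing /wedge !mxE /=. Qed.

Lemma ev_minor i j (u w : nat) : (u < 6)%N -> (w < 6)%N -> exists a b c d,
  ev env (minor_ex i j u w) = wedge (LP env i) (LQ env i) a b * wedge (LP env j) (LQ env j) c d
    - wedge (LP env i) (LQ env i) c d * wedge (LP env j) (LQ env j) a b.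
Proof.
have Hw (k : nat) : (k < 6)%N -> exists a b, forall l, ev env (nth 0%ex (line_ex l) k) = wedge (LP env l) (LQ env l) a b.
  case: k => [|[|[|[|[|[|k]]]]]] // _; [exists ix, iy|exists ix, iz|exists ix, it|exists iy, iz|exists iy, it|exists iz, it];
    by move=> l; rewrite /wedge !mxE.
move=> /Hw[a [b Hu]] /Hw[c [d {}Hw]]; exists a, b, c, d.
by rewrite /= !Hu !Hw.
Qed.

Lemma ev_quad q p : ev env (quad_ex q p) = quad_defect env q p.
Proof. by rewrite /quad_defect -!ev_gram. Qed.

Lemma mat_point M P : size M = 4%N -> mat M *m point env P = point env (mulv_ex M P).
Proof.
by move=> sM; apply/colP=> i; rewrite mxE sum_ord4 !mxE (nth_map [::]) ?sM.
Qed.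

Lemma ev_image M i k : size M = 4%N -> ev env (pair_ex (image_ex M i) (line_ex k)) =
  pairing (mat M *m LP env i) (mat M *m LQ env i) (LP env k) (LQ env k).
Proof. by move=> sM; rewrite /LP /LQ !mat_point // /pairing /wedge !mxE /=. Qed.

Lemma ev_det M : size M = 4%N -> ev env (det_ex M) = \det (mat M).
Proof.
move=> sM; have sM' i : (i < 4)%N -> (i < size M)%N by rewrite sM.
have -> : mat M = columns (col ix (mat M)) (col iy (mat M)) (col iz (mat M)) (col it (mat M)).
  by apply/matrixP=> i j; rewrite [RHS]mxE; elim/ord4_ind: j; rewrite /= [RHS]mxE.
by rewrite det_columns /pairing /wedge !mxE /= !(nth_map [::]) ?sM'.
Qed.

End Evaluation.

(** * Certificates computed modulo a prime *)

Section Certificates.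
Variables (m : nat) (A B : Z) (places : seq (Z * Z)) (ts : seq quad).
Let t k := nth (0, 0, 0, 0)%Z ts k.
Let evp (p : Z * Z) := evm m (fun k => linm m p (t k)).

Local Notation "x *! y" := (modm m (Z.mul x y)) (at level 40, left associativity).
Local Notation "x +! y" := (modm m (Z.add x y)) (at level 50, left associativity).
Local Notation negm x := (modm m (Z.opp x)).

(** Follows [pair_ex] node by node and reduces where [evm] does, so a value computed from stored
    tables is [evm] of the full expression by conversion, and large trees are not evaluated
    again. *)
Definition pair_mod (p q : seq Z) : Z :=
  let n s k := nth (modm m (Z.of_nat 0)) s k in
  n p 0%N *! n q 5 +! negm (n p 1%N *! n q 4) +! n p 2 *! n q 3
   +! n p 3 *! n q 2 +! negm (n p 4 *! n q 1%N) +! n p 5 *! n q 0%N.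

Definition plucker_table (p : Z * Z) : seq (seq Z) := [seq map (evp p) (line_ex i) | i <- lines].
Definition gram_of (pl : seq (seq Z)) : seq (seq Z) := [seq [seq pair_mod a b | b <- pl] | a <- pl].
Definition entry (T : seq (seq Z)) i j : Z := nth 0%Z (nth [::] T i) j.

Definition quad_mod (T : seq (seq Z)) (q p : seq nat) : Z :=
  let: (i, l, j, k) := (nth 0 q 0, nth 0 q 1, nth 0 q 2, nth 0 q 3)%N in
  let: (i', l', j', k') := (nth 0 p 0, nth 0 p 1, nth 0 p 2, nth 0 p 3)%N in
  let T := entry T in
  T i j *! T l k *! (T i' k' *! T l' j') +! negm (T i k *! T l j *! (T i' j' *! T l' k')).

(** A quadruple is refuted only by a defect that is nonzero at every place, since this is what
    implies nonvanishing in [K]. Passing by accident merely enlarges the search. *)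
Definition pass_mod (Ts : seq (seq (seq Z))) (q p : seq nat) : bool :=
  has (fun T => quad_mod T q p == 0%Z) Ts.

Definition nondegenerate_check (Ps Ts : seq (seq (seq Z))) : bool :=
  [&& all (fun i => all (fun j => skew i j ==> all (fun T => entry T i j != 0%Z) Ts) lines) lines,
      all (fun i => all (fun j => inc i j ==>
        has (fun a => has (fun b => all (fun P =>
            let u := nth [::] P i in let w := nth [::] P j in
            nth 0%Z u a *! nth 0%Z w b +! negm (nth 0%Z u b *! nth 0%Z w a) != 0%Z) Ps)
          (iota 0 6)) (iota 0 6)) lines) lines
    & all (fun p => evp p (Var 2) != 0%Z) places].

Definition detection_check (Ps : seq (seq (seq Z))) (g : seq nat) (Mk : seq (seq ex) * ex) : bool :=
  [&& size Mk.1 == 4%N, nonvanishing m places t (det_ex Mk.1), nonvanishing m places t Mk.2 &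
      all (fun i =>
        let images := [seq map (evp p) (image_ex Mk.1 i) | p <- places] in
        all (fun j => (j == nth 0%N g i) ||
          has (fun k => (inc j k || (j == k)) &&
            all (fun PI => pair_mod PI.2 (nth [::] PI.1 k) != 0%Z) (zip Ps images)) lines) lines)
        [:: 0; 7; 8; 9; 10; 11]%N].

Variables (css : seq (seq (seq nat))) (gm : seq (seq (seq ex) * ex)).
Variables (sts1 sts2 : seq step) (base : seq nat).

(* The certificate that at the sample point the surface has the symmetries
   listed in gm and no others. *)
Definition certificate : bool :=
  let Ps := [seq plucker_table p | p <- places] in
  let Ts := [seq gram_of P | P <- Ps] in
  let gl := list_gens css in
  [&& sign_closed m A B places, nondegenerate_check Ps Ts,
      cycle_data css, all preserving_list gl & [&& (size gm == size css)%N &&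
      all (fun k => detection_check Ps (nth [::] gl k) (nth ([::], 0%ex) gm k)) (iota 0 (size css)),
      steps_ok [::] (sts1 ++ sts2) && all (fun x => x \in step_lines (sts1 ++ sts2)) base &
      search_ok (pass_mod Ts) (orbit_list gl) sts1 sts2 base]].

Let H : {group 'S_27} := <<[set x in perm_gens css]>>%G.

Variables (K : closedFieldType) (al be : K).
Hypotheses (m_prime : prime m) (base_ok : determines base).
Hypotheses (char0 : [pchar K] =i pred0) (alE : al ^+ 2 = zR K A) (beE : be ^+ 2 = zR K B).
Hypothesis certified : certificate.

Let env0 := fun k => lin al be (t k).
Let Ps := [seq plucker_table p | p <- places].
Let Ts := [seq gram_of P | P <- Ps].

(** The test may fail for some [s * h] rather than for [s], because the search works modulo [H].
    This is enough: [h] comes from a symmetry, so [s * h] does as soon as [s] does. *)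
Definition separated (env : nat -> K) : Prop := forall s, preserves_inc s -> s \notin H ->
  exists h q, [/\ h \in H, size q = 4%N, all (fun x => (x < 27)%N) q &
    quad_defect env q [seq app (s * h)%g x | x <- q] != 0].

Definition detects (env : nat -> K) (s : 'S_27) (Mk : seq (seq ex) * ex) : Prop :=
  [/\ mat env Mk.1 \in unitmx, ev env Mk.2 != 0 &
    forall i j, i \in [:: 0; 7; 8; 9; 10; 11]%N -> (j < 27)%N -> j != app s i ->
    exists k, [/\ (k < 27)%N, inc j k || (j == k) &
      pairing (mat env Mk.1 *m LP env i) (mat env Mk.1 *m LQ env i) (LP env k) (LQ env k) != 0]].

Let closed_places : sign_closed m A B places. Proof. by case/and5P: certified. Qed.

Let generic_nonvanishing x : all (fun p => evp p x != 0%Z) places ->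
  generic env0 (fun env => ev env x != 0).
Proof. by move=> Hx; apply: generic_ex; apply: (nonvanishingP m_prime closed_places). Qed.

Let evpD p x y : evp p (x + y)%ex = evp p x +! evp p y. Proof. by []. Qed.
Let evpN p x : evp p (- x)%ex = negm (evp p x). Proof. by []. Qed.
Let evpM p x y : evp p (x * y)%ex = evp p x *! evp p y. Proof. by []. Qed.

Let mod0 : modm m 0%Z = 0%Z. Proof. by rewrite /modm; case: (Z.of_nat m). Qed.

Let nth_evp p s k : nth 0%Z [seq evp p x | x <- s] k = evp p (nth 0%ex s k).
Proof.
have [Hk|Hk] := ltnP k (size s); first by rewrite (nth_map 0%ex).
by rewrite !nth_default ?size_map // /evp /= mod0.
Qed.

Let pair_modE p u w : pair_mod (map (evp p) u) (map (evp p) w) = evp p (pair_ex u w).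
Proof. by rewrite /pair_mod mod0 !nth_evp. Qed.

Let plucker_tableE p i : (i < 27)%N -> nth [::] (plucker_table p) i = map (evp p) (line_ex i).
Proof.
move=> Hi; have sl : size lines = 27%N by vm_compute.
rewrite (nth_map 0%N) ?sl //; congr (map _ (line_ex _)).
by rewrite -[lines]/(iota 0 27) nth_iota.
Qed.

Let entryE p i j : (i < 27)%N -> (j < 27)%N -> entry (gram_of (plucker_table p)) i j = evp p (gram_ex i j).
Proof.
have sl : size lines = 27%N by vm_compute.
move=> Hi Hj; rewrite /entry (nth_map [::]) ?size_map ?sl //.
by rewrite (nth_map [::]) ?size_map ?sl // !plucker_tableE // pair_modE.
Qed.

Let quad_modE p q w : all (fun x => (x < 27)%N) q -> all (fun x => (x < 27)%N) w ->
  quad_mod (gram_of (plucker_table p)) q w = evp p (quad_ex q w).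
Proof.
move=> Hq Hw; have lt s k : all (fun x => (x < 27)%N) s -> (nth 0%N s k < 27)%N.
  move=> Hs; have [Hk|Hk] := ltnP k (size s); first exact: (all_nthP _ Hs).
  by rewrite nth_default.
rewrite /quad_mod /quad_ex evpD evpN !evpM !entryE ?lt //; reflexivity.
Qed.

Let generic_nondegenerate : generic env0 (@nondegenerate K).
Proof.
have /and5P[_ /and3P[/allP Hskew /allP Hinc HF] _ _ /and3P[_ _ _]] := certified.
have G1 : generic env0 (fun env => forall i, i \in lines -> forall j, j \in lines ->
    skew i j -> gram env i j != 0).
  apply: generic_all => i Hi; apply: generic_all => j Hj.
  case Hij: (skew i j); last exact: generic_true.
  apply: generic_imp (_ : generic env0 (fun env => ev env (gram_ex i j) != 0)).
    by move=> env; rewrite ev_gram.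
  apply: generic_nonvanishing; apply/allP=> p Hp.
  have /implyP/(_ Hij)/allP := allP (Hskew i Hi) j Hj.
  move=> /(_ (gram_of (plucker_table p))); rewrite entryE -?mem_lines //; apply.
  by apply/map_f/map_f.
have G2 : generic env0 (fun env => forall i, i \in lines -> forall j, j \in lines ->
    inc i j -> exists a b c d, wedge (LP env i) (LQ env i) a b * wedge (LP env j) (LQ env j) c d
        - wedge (LP env i) (LQ env i) c d * wedge (LP env j) (LQ env j) a b != 0).
  apply: generic_all => i Hi; apply: generic_all => j Hj.
  case Hij: (inc i j); last exact: generic_true.
  have /implyP/(_ Hij)/hasP[a Ha /hasP[b Hb /allP Hab]] := allP (Hinc i Hi) j Hj.
  move: Ha Hb; rewrite !mem_iota !add0n => /andP[_ Ha] /andP[_ Hb].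
  apply: generic_imp (_ : generic env0 (fun env => ev env (minor_ex i j a b) != 0)).
    by move=> env; have [u [w [u' [w' ->]]]] := ev_minor env i j Ha Hb; exists u, w, u', w'.
  apply: generic_nonvanishing; apply/allP=> p Hp.
  have := Hab (plucker_table p) (map_f _ Hp).
  rewrite !plucker_tableE -?mem_lines //; cbv zeta.
  by rewrite !nth_evp /minor_ex evpD evpN !evpM.
have G3 : generic env0 (fun env => env 2%N != 0).
  exact: (generic_nonvanishing (x := Var 2) HF).
apply: generic_imp (generic_and G1 (generic_and G2 G3)) => env [H1 [H2 H3]].
by split=> // i j; rewrite -!mem_lines => Hi Hj; [apply: H1 | apply: H2].
Qed.

(** A conjunction over all of 'S_27, which is finite but never enumerated. For each [s], either a
    test fails somewhere on its coset, an open condition, or all tests pass and [search_complete]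
    puts [s] in [H]. *)
Let generic_separated : generic env0 separated.
Proof.
have /and5P[_ _ css_ok pres /and3P[_ /andP[Hsts Hbase] Hsearch]] := certified.
have orbP u w : all (fun i => (i < 27)%N) u -> w \in orbit_list (list_gens css) u ->
    exists2 x, x \in H & w = [seq app x i | i <- u].
  exact: (orbit_listP app1 appM app_lt (perm_gensP css_ok)).
have Gs s : s \in enum 'S_27 -> generic env0 (fun env => preserves_inc s -> s \notin H ->
  exists h q, [/\ h \in H, size q = 4%N, all (fun x => (x < 27)%N) q &
    quad_defect env q [seq app (s * h)%g x | x <- q] != 0]).
  move=> _; have [Hsp|Hsp] := boolP [exists h in H, [exists q : 4.-tuple 'I_27,
      ~~ pass_mod Ts (map val q) [seq app (s * h)%g x | x <- map val q]]].
    move: Hsp => /exists_inP[h Hh /existsP[q Hq]].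
    have Hlt (r : seq 'I_27) : all (fun x => (x < 27)%N) (map val r).
      by apply/allP=> _ /mapP[x _ ->]; apply: ltn_ord.
    apply: generic_imp (_ : generic env0 (fun env =>
        ev env (quad_ex (map val q) [seq app (s * h)%g x | x <- map val q]) != 0)).
      move=> env; rewrite ev_quad => H0 _ _; exists h, (map val q); split=> //.
      by rewrite size_map size_tuple.
    apply: generic_nonvanishing; apply/allP=> p Hp; apply: contraNneq Hq => E.
    apply/hasP; exists (gram_of (plucker_table p)); first by apply/map_f/map_f.
    rewrite quad_modE ?E //; apply/allP=> _ /mapP[x _ ->]; exact: app_lt.
  apply: generic_true => env Hs; case/negP; rewrite /H.
  apply: (search_complete css_ok orbP pres Hsts base_ok Hbase Hsearch) => h Hh.
  split=> [|q q4 Hq].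
    by apply: preserves_incM => //; apply: (group_preserves css_ok pres).
  move: Hsp; rewrite negb_exists_in => /forall_inP/(_ h Hh).
  have sq : size (map (fun k => inord k : 'I_27) q) == 4%N by rewrite size_map q4.
  rewrite negb_exists => /forallP/(_ (Tuple sq)); rewrite negbK /=.
  suff -> : [seq val x | x <- [seq (inord k : 'I_27) | k <- q]] = q by [].
  rewrite -map_comp -[RHS]map_id; apply/eq_in_map => k /(allP Hq) Hk.
  by rewrite /= inordK.
apply: generic_imp (generic_all Gs) => env Hall s; exact: (Hall s (mem_enum _ _)).
Qed.

Let generic_detects k : (k < size css)%N ->
  generic env0 (fun env => detects env (nth 1%g (perm_gens css) k) (nth ([::], 0%ex) gm k)).
Proof.
move=> Hk; have /and5P[_ _ css_ok _ /and3P[/andP[/eqP sg Hdet0] _ _]] := certified.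
have {Hdet0} Hdet := allP Hdet0.
set Mk := nth _ gm k; set g := nth [::] (list_gens css) k.
have /Hdet/and4P[/eqP sM {}Hdet Hlam /allP Himg] : k \in iota 0 (size css) by rewrite mem_iota.
have gE j : (j < 27)%N -> app (nth 1%g (perm_gens css) k) j = nth 0%N g j.
  by move=> Hj; have [_ ->] := perm_gensP css_ok; rewrite ?size_map.
have G1 : generic env0 (fun env => forall i, i \in [:: 0; 7; 8; 9; 10; 11]%N ->
    forall j, j \in lines -> j != nth 0%N g i -> exists k, [/\ (k < 27)%N, inc j k || (j == k) &
      pairing (mat env Mk.1 *m LP env i) (mat env Mk.1 *m LQ env i) (LP env k) (LQ env k) != 0]).
  apply: generic_all => i Hi; apply: generic_all => j Hj.
  have /orP[/eqP ->|/hasP[l Hl /andP[Hjl /allP Hpl]]] := allP (Himg i Hi) j Hj.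
    by apply: generic_true => env; rewrite eqxx.
  apply: generic_imp (_ : generic env0 (fun env =>
      ev env (pair_ex (image_ex Mk.1 i) (line_ex l)) != 0)).
    by move=> env; rewrite ev_image // => H0 _; exists l; rewrite -mem_lines.
  apply: generic_nonvanishing; apply/allP=> p Hp.
  rewrite -pair_modE -plucker_tableE -?mem_lines //.
  apply: (Hpl (plucker_table p, map (evp p) (image_ex Mk.1 i))).
  by rewrite zip_map; apply: map_f.
have G2 := generic_nonvanishing Hdet; have G3 := generic_nonvanishing Hlam.
apply: generic_imp (generic_and G1 (generic_and G2 G3)) => env [H1 [H2 H3]].
split=> // [|i j Hi Hj Hne]; first by rewrite unitmxE unitfE -ev_det.
apply: (H1 i Hi j); rewrite ?mem_lines // -gE //; move: i Hi {Hne}; exact/allP.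
Qed.

Definition symmetric_at (env : nat -> K) : Prop :=
  forall k, (k < size css)%N -> let Mk := nth ([::], 0%ex) gm k in
  forall w, eval_at (surface env) (mat env Mk.1 *m w) = ev env Mk.2 * eval_at (surface env) w.

(** Being symmetric is a closed condition, so it stays a hypothesis on [env], to be verified on the
    whole family; only the absence of further symmetries is generic. *)
Theorem generic_stabilizer : generic env0 (fun env => symmetric_at env ->
  stab_is H (par_b env) 1 (par_d env) (par_e env) (par_f env)).
Proof.
have /and5P[_ _ css_ok pres /and3P[_ _ _]] := certified.
have G : generic env0 (fun env => forall k, k \in iota 0 (size css) ->
    detects env (nth 1%g (perm_gens css) k) (nth ([::], 0%ex) gm k)).
  by apply: generic_all => k; rewrite mem_iota => /andP[_ Hk]; apply: generic_detects.
apply: generic_imp (generic_and generic_nondegenerate (generic_and generic_separated G)).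
move=> env [nondeg [sep det]] sym p N HN.
have induced h : h \in H -> exists2 M, in_stab (surface env) M & induces N M h.
  move=> /gen_prodgP[n [c Hc ->]]; elim: n c Hc => [|n IH] c Hc.
    by rewrite big_ord0; have [? ?] := in_stab1 env N; exists 1%:M.
  rewrite big_ord_recr /=; have [M1 S1 I1] := IH (fun i => c (widen_ord (leqnSn n) i)) (fun i => Hc _).
  have := Hc ord_max; rewrite inE => /(nthP 1%g)[k]; rewrite size_map => Hk Ek.
  have [|Mu lam0 Hdet] := det k; first by rewrite mem_iota.
  have S2 := semi_invariant_in_stab Mu lam0 (sym k Hk).
  have I2 : induces N (mat env (nth ([::], 0%ex) gm k).1) (c ord_max).
    rewrite -Ek; apply: (induces_detected nondeg HN S2); last exact: Hdet.
    by apply: (group_preserves css_ok pres); apply: mem_gen; rewrite inE mem_nth // size_map.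
  have [S I] := in_stabM S1 S2 I1 I2.
  by exists (mat env (nth ([::], 0%ex) gm k).1 *m M1).
split=> [M|M1 M2 s|s]; first exact: (in_stab_perm nondeg HN).
  exact: (induces_unique char0 nondeg HN).
split=> [[M S I]|]; last exact: induced.
apply/negPn/negP => Hs.
have [h [q [Hh q4 Hq /eqP]]] := sep s (stab_preserves_inc nondeg HN S I) Hs; apply.
have [Mh Sh Ih] := induced h Hh; have [S' I'] := in_stabM S Sh I Ih.
exact: (stab_quad nondeg HN S' I' Hq q4).
Qed.

End Certificates.

(* E1, G2, F12, G3, F13, G4, F14, G5, F15, G6, F16, E2. *)
Definition first_steps : seq step :=
  [:: (0, None, [::]); (7, None, [::]); (12, Some (0, 1), [::])]%N.
(** The tests compare lines of different tritangent planes through E1, whose residual pairs are G_j,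
    F_1j. Of the 32 ways to choose one line from each pair only 16 are compatible with the
    incidences: a line skew to E1 meets one line of each pair, with a fixed parity. The last line
    E2, which meets F12, G3, ..., G6, eliminates the images of wrong parity. *)
Definition next_steps : seq step :=
  [:: (8, None, [::]); (13, Some (0, 3), [:: [:: 1; 2; 3; 4]]);
      (9, None, [:: [:: 1; 2; 3; 5]]);
      (14, Some (0, 5), [:: [:: 1; 2; 5; 6]; [:: 3; 4; 5; 6]]);
      (10, None, [:: [:: 1; 3; 5; 7]; [:: 1; 2; 3; 7]]);
      (15, Some (0, 7), [:: [:: 1; 2; 7; 8]; [:: 3; 4; 7; 8]; [:: 5; 6; 7; 8]]);
      (11, None, [::]);
      (16, Some (0, 9), [:: [:: 1; 2; 9; 10]; [:: 3; 4; 9; 10]; [:: 5; 6; 9; 10]; [:: 7; 8; 9; 10]]);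
      (1, None, [::])]%N.
Definition base_lines : seq nat := [:: 0; 7; 8; 9; 10; 11]%N.

(* Matrices inducing the generators, with the factor by which they multiply the
   cubic form; al and be are the square roots adjoined for the family. *)
Section SymmetryMatrices.
Let v := Var 0.
Let E := Var 1.
Let F := Var 2.
Let al := Var 3.
Let be := Var 4.
Local Open Scope ex_scope.
Definition M_g1 : seq (seq ex) * ex :=
  ([:: [:: -2; 0; 0; 0]; [:: 0; -2; 0; 0]; [:: 0; 0; -2; 0];
      [:: - (E * F) + 2 * E + 2 * F - 4; v + E * F - 2 * E - 2 * F + 2; - v + 2; 2]], -8).
Definition M_g1' : seq (seq ex) * ex :=
  ([:: [:: 1; -1; 0; 0];
      [:: 0; -1; 0; 0];
      [:: 0; - F; 1; 0];
      [:: 1 - al - F; F; -1; al]], 1).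
Definition M_g1'' : seq (seq ex) * ex :=
  ([:: [:: 0; 1; - al - al * be; 0];
      [:: 0; 1 + al - be; 0; 0];
      [:: -6 + 6 * al + 4 * be - 4 * al * be; 5 - 3 * al - 3 * be + 2 * al * be; 0; 0];
      [:: 5 - al - 3 * be; -1 + 2 * al + be - al * be; - al + be; -1 + al + be]], 8 - 4 * al - 6 * be + 2 * al * be).
Definition M_g2 : seq (seq ex) * ex :=
  ([:: [:: 2; 0; 0; 0]; [:: 0; 2; 0; 0]; [:: - (E * F); E * F; -2; 0]; [:: 0; 0; 0; 2]], 8).
Definition M_h3 : seq (seq ex) * ex :=
  (let a := (E - 2) * (F - 2) in
   [:: [:: 2 * a; 0; 0; 0];
      [:: 2 * a - 4; 4 * E + 4 * F - 3 * E * F - 4; E * F - 4; -4];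
      [:: 2 * a - 4; 8 * E + 8 * F - 5 * E * F - 12; 3 * E * F - 4 * E - 4 * F + 4; -4];
      [:: 2 * a; a^2; 0; 0]], (2 * ((E - 2) * (F - 2)))^3).
Definition M_h4 : seq (seq ex) * ex :=
  (let a := E * (E - 2)^2 in
   [:: [:: - a; 0; 0; 0]; [:: - a - E^2; a; 0; - E^2]; [:: a - E^2; 0; a; - E^2];
      [:: - a; ((E - 2)^2)^2; 0; 0]], (- (E * (E - 2)^2))^3).
Definition M_g6 : seq (seq ex) * ex :=
  (let a := E^2 - 4 in
   [:: [:: E * a; 0; 0; 0]; [:: E * a - E^2; 0; 0; E^2];
      [:: a^2 - E^2; - a^2 - E * a; E * a; E * a + E^2]; [:: E * a - a^2; a^2; 0; 0]],
   (E * (E^2 - 4))^3).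
Definition M_h6 : seq (seq ex) * ex :=
  ([:: [:: E; 0; 0; 0]; [:: E; - E; 0; 0]; [:: E^2 - 4; 4 - E^2 - 2 * E; E; E];
      [:: 4 - E^2; E^2 + 2 * E - 4; - (2 * E); - E]], E^3).
Definition M_k9 : seq (seq ex) * ex :=
  ([:: [:: -10 - 2 * al + 4 * F; 4 + 4 * al - 4 * F - 2 * al * F; 2 * F; 2 + 2 * al];
      [:: -6 + 2 * al; 6 - 2 * al; 2 + 2 * al; 2 + 2 * al];
      [:: 2 + 2 * al - 8 * F; -2 - 2 * al + 8 * F; -6 + 2 * al; -6 + 2 * al];
      [:: -10 - 2 * al + 14 * F + 2 * al * F - 4 * F * F; 20 + 4 * al - 22 * F + 5 * F * F - al * F * F; 4 * F - 2 * al * F - F * F + al * F * F; 2 + 2 * al - 2 * F - 2 * al * F]], -512 + 384 * F - 384 * al * F + 192 * F * F + 192 * al * F * F - 64 * F * F * F).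
Definition M_g9' : seq (seq ex) * ex :=
  ([:: [:: 1; -1; 0; 0];
      [:: 0; -1; 0; 0];
      [:: 0; -1 - al * be; 1; 0];
      [:: al - al * be; 1 + al * be; -1; - al]], 1).
Definition M_h9' : seq (seq ex) * ex :=
  ([:: [:: 26; -17 - 20 * al - 12 * be + 5 * al * be; 7 - 4 * al + 8 * be + al * be; 2 + 10 * al + 6 * be + 4 * al * be];
      [:: -2 + 3 * al + 7 * be - 4 * al * be; -17 - 20 * al - 12 * be + 5 * al * be; 7 - 4 * al + 8 * be + al * be; 6 + 17 * al + 5 * be + 12 * al * be];
      [:: -16 + 11 * al - 9 * be - 6 * al * be; -39 - 26 * al + 26 * be - 13 * al * be; 21 + 14 * al - 2 * be + 3 * al * be; -8 + 25 * al - 11 * be + 10 * al * be];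
      [:: 18 - 14 * al + 2 * be - 16 * al * be; 39 + 26 * al - 26 * be + 13 * al * be; -21 - 14 * al + 2 * be - 3 * al * be; -6 - 4 * al + 8 * be - 12 * al * be]], 15264 - 7712 * al - 14112 * be + 1824 * al * be).
Definition M_g10 : seq (seq ex) * ex :=
  ([:: [:: 1; -1; 1; -1];
      [:: -1; 1; 1; -1];
      [:: 1; 1; 1; 1];
      [:: -1; -1; 1; 1]], 8).
Definition M_h10 : seq (seq ex) * ex :=
  ([:: [:: 3; -2; 0; 1];
      [:: 3; -3; 1; 1];
      [:: 1; -3; 1; -1];
      [:: -1; -2; 0; 1]], -8).
Definition M_g18 : seq (seq ex) * ex :=
  ([:: [:: 2; 1 + 3 * al; 1 - al; 2];
      [:: 5 + al; -5 - al; 1 + al; -1 - al];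
      [:: 3 - 5 * al; -9 - al; -3 + al; -3 + al];
      [:: -6 - 4 * al; 3 + al; 3 - 3 * al; 6]], 192 * al).
Definition M_h18 : seq (seq ex) * ex :=
  ([:: [:: 14; -14; 4 + 2 * al; -4 - 2 * al];
      [:: -7 - 7 * al; -5 + al; -5 + al; -1 + 3 * al];
      [:: -33 - 13 * al; -3 - 5 * al; -3 - 5 * al; 9 + al];
      [:: 24 - 2 * al; 14 * al; 6 - 4 * al; 6 - 4 * al]], -5184 - 1920 * al).
End SymmetryMatrices.

(** * The matrices preserve the cubic form up to a factor *)

Definition semi_invariant (K : closedFieldType) (env : nat -> K) (Mk : seq (seq ex) * ex) : Prop :=
  forall w, eval_at (surface env) (mat env Mk.1 *m w) = ev env Mk.2 * eval_at (surface env) w.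

Ltac expand_form := move=> w; rewrite /surface !eval_cubic !mxE !sum_ord4 !mxE /=
  /cubic_form /par_b /par_d /par_e /par_f.

Section SemiInvariance.
Variables (K : closedFieldType) (env : nat -> K).
Local Notation v := (env 0%N).
Local Notation E := (env 1%N).
Local Notation F := (env 2%N).
Local Notation al := (env 3%N).
Local Notation be := (env 4%N).

Lemma semi_invariant_g1 : semi_invariant env M_g1.
Proof. by expand_form; ring. Qed.

Lemma semi_invariant_g2 : v = 2%:R -> semi_invariant env M_g2.
Proof. by move=> Hv; expand_form; rewrite Hv; ring. Qed.

Lemma semi_invariant_h3 : E * F = 2%:R * v -> semi_invariant env M_h3.
Proof. by move=> Hv; expand_form; ring: Hv. Qed.

Lemma semi_invariant_h4 : v = 2%:R -> E * F = 4%:R -> semi_invariant env M_h4.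
Proof. by move=> Hv HF; expand_form; rewrite Hv; ring: HF. Qed.

Lemma semi_invariant_g6 : v = - 2%:R -> E * F = - 4%:R -> semi_invariant env M_g6.
Proof. by move=> Hv HF; expand_form; rewrite Hv; ring: HF. Qed.

Lemma semi_invariant_h6 : v = - 2%:R -> E * F = - 4%:R -> semi_invariant env M_h6.
Proof. by move=> Hv HF; expand_form; rewrite Hv; ring: HF. Qed.

Lemma semi_invariant_g1' : al ^+ 2 = -1 -> v = - 2%:R * al -> E * F = 2%:R * E - 2%:R * al * F ->
  semi_invariant env M_g1'.
Proof. by move=> Hal Hv HF; expand_form; rewrite Hv; ring: HF Hal. Qed.

(** The curve E F = 2 v with E = 1 + al is parametrized by k = F / 2, which leaves a polynomial
    identity. *)
Lemma semi_invariant_k9 k : al ^+ 2 = - 3%:R -> E = 1 + al -> F = 2%:R * k -> v = (1 + al) * k ->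
  semi_invariant env M_k9.
Proof. by move=> Hal HE HF Hv; expand_form; rewrite Hv HE HF; ring: Hal. Qed.

Lemma semi_invariant_g1'' : al ^+ 2 = -1 -> be ^+ 2 = 2%:R -> v = - 2%:R * al ->
  E = 2%:R - 2%:R * al - be + al * be -> F = 1 - al - be -> semi_invariant env M_g1''.
Proof. by move=> Hal Hbe Hv HE HF; expand_form; rewrite Hv HE HF; ring: Hal Hbe. Qed.

Lemma semi_invariant_g9' : al ^+ 2 = -1 -> be ^+ 2 = 3%:R -> v = 2%:R * al ->
  E = 1 + al * be -> F = al + be -> semi_invariant env M_g9'.
Proof. by move=> Hal Hbe Hv HE HF; expand_form; rewrite Hv HE HF; ring: Hal Hbe. Qed.

Lemma semi_invariant_h9' : al ^+ 2 = -1 -> be ^+ 2 = 3%:R -> v = 2%:R * al ->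
  E = 1 + al * be -> F = al + be -> semi_invariant env M_h9'.
Proof. by move=> Hal Hbe Hv HE HF; expand_form; rewrite Hv HE HF; ring: Hal Hbe. Qed.

Lemma semi_invariant_g10 : al ^+ 2 = 5%:R -> v = 2%:R -> E = 3%:R - al -> F = 3%:R + al ->
  semi_invariant env M_g10.
Proof. by move=> Hal Hv HE HF; expand_form; rewrite Hv HE HF; ring: Hal. Qed.

Lemma semi_invariant_h10 : al ^+ 2 = 5%:R -> v = 2%:R -> E = 3%:R - al -> F = 3%:R + al ->
  semi_invariant env M_h10.
Proof. by move=> Hal Hv HE HF; expand_form; rewrite Hv HE HF; ring: Hal. Qed.

Lemma semi_invariant_g18 : al ^+ 2 = - 3%:R -> v = 2%:R -> E = 1 + al -> F = 1 - al ->
  semi_invariant env M_g18.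
Proof. by move=> Hal Hv HE HF; expand_form; rewrite Hv HE HF; ring: Hal. Qed.

Lemma semi_invariant_h18 : al ^+ 2 = - 3%:R -> v = 2%:R -> E = 1 + al -> F = 1 - al ->
  semi_invariant env M_h18.
Proof. by move=> Hal Hv HE HF; expand_form; rewrite Hv HE HF; ring: Hal. Qed.

End SemiInvariance.

(** * Smoothness *)

(* In the plane k2 z = k1 y through the line y = z = 0, with y = k2 s and
   z = k1 s, the residual conic is
   q = a x^2 + h x t - 2 k2 t^2 + g x s + k t s.
   When it is singular, its vertex is (- k^2 : m : kg) in the coordinates
   (x : s : t), where m = hk + 4 k2 g. *)
Section ResidualConic.
Variables k1 k2 : ex.
Let v := Var 0.
Let E := Var 1.
Let F := Var 2.
Local Open Scope ex_scope.
Let e := E - 1.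
Let f := F - 1.
Let b := - (1 + e * f).
Let d := v - 1 + e * f.

Definition conic_a : ex := (e + f - b) * k1 - 2 * (e * f) * k2.
Definition conic_h : ex := b * (k1 - k2) + k1 - (e + f) * k2 + e * f * k1.
Definition conic_g : ex := k1^2 - d * (k2 - k1) * k1 - (e + f) * k1 * k2 - e * f * (k1^2 - 2 * k2^2).
Definition conic_k : ex := - (k1 * k2) - d * k2 * (k2 - k1) + (e + f) * k2^2 - e * f * k1 * k2.
Definition conic_m : ex := conic_h * conic_k + 4 * k2 * conic_g.

Definition partial_z (x y z t : ex) : ex :=
  b * (t - x) * x + (x * z - y * t + (z + t) * x) - d * ((y - z) * x - (x * z + y * t))
  + (e + f) * (x - y) * x - e * f * (2 * x * z - x * t + y * t).
(** The z-derivative of the cubic at the vertex of the conic. The conic controls the derivatives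
    along the plane; this one is transverse to it when [k2] is nonzero. *)
Definition vertex_z : ex :=
  partial_z (- conic_k^2) (k2 * conic_m) (k1 * conic_m) (conic_k * conic_g).
End ResidualConic.

Section Smooth.
Local Open Scope ex_scope.
Let v := Var 0.
Let E := Var 1.
Let F := Var 2.
(** The tritangent planes through E1 other than y = 0, as ratios z : y; they contain G3, G5, G6 and
    G2 respectively. *)
Definition singular_planes : seq (ex * ex) :=
  [:: (1, 1); (E - 1, 1); (F - 1, 1); (v^2 + v * E * F - 2 * v * E - 2 * v * F + 2 * E * F, v^2)].
Definition smoothness_conditions : seq ex :=
  [:: v; E; F] ++ [seq vertex_z k.1 k.2 | k <- singular_planes].
End Smooth.

Section SmoothSurface.
Variables (K : closedFieldType) (env : nat -> K).
Hypothesis char0 : [pchar K] =i pred0.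

Let nat_neq0 n : n.+1%:R != 0 :> K. Proof. by rewrite ((pcharf0P K).1 char0). Qed.

Let at_plane (c : ex -> ex -> ex) (k1 k2 : K) : K :=
  ev (nth 0 [:: env 0%N; env 1%N; env 2%N; k1; k2]) (c (Var 3) (Var 4)).
Local Notation v := (env 0%N).
Local Notation E := (env 1%N).
Local Notation F := (env 2%N).
Local Notation e := (par_e env).
Local Notation f := (par_f env).

(** A singular point with y nonzero lies in a plane z = r y and is singular on the residual conic.
    The conic then degenerates, so r is one of four values, and there the transverse derivative at
    the vertex does not vanish. In the plane y = 0 it suffices that v, E, F are nonzero. *)
Lemma smooth_surface :
  (forall i, (i < 7)%N -> ev env (nth 1%ex smoothness_conditions i) != 0) ->
  smooth (surface env).
Proof.
move=> Hc.
have v0 : v != 0 := Hc 0%N isT.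
have E0 : E != 0 := Hc 1%N isT.
have F0 : F != 0 := Hc 2%N isT.
have z1 : at_plane vertex_z 1 1 != 0 := Hc 3 isT.
have z2 : at_plane vertex_z (E + - 1) 1 != 0 := Hc 4 isT.
have z3 : at_plane vertex_z (F + - 1) 1 != 0 := Hc 5 isT.
set w4 := v * v + v * E * F + - (2%:R * v * E) + - (2%:R * v * F) + 2%:R * E * F.
have z4 : at_plane vertex_z w4 (v * v) != 0 := Hc 6 isT.
move=> p [p0 _].
have [Px Py Pz Pt] := eval_cubic_gradient (par_b env) 1 (par_d env) e f p.
move: p0; set x := p ix 0 in Px Py Pz Pt *; set y := p iy 0 in Px Py Pz Pt *.
set z := p iz 0 in Px Py Pz Pt *; set t := p it 0 in Px Py Pz Pt *.
rewrite -/(surface env) in Px Py Pz Pt.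
move=> p0; apply/existsP; rewrite -[[exists _, _]]negbK negb_exists; apply/negP => /forallP sing.
have {}sing i : eval_at (surface env)^`M(i) p = 0 by apply/eqP; rewrite -[_ == _]negbK sing.
rewrite !sing in Px Py Pz Pt.
have [y0|y_neq0] := eqVneq y 0.
  have Hx : z * (2%:R * E * F * x + v * z) = 0.
    by rewrite [RHS]Px y0 /par_b /par_d /par_e /par_f; ring.
  have Hz : x * (E * F * x + 2%:R * v * z) = 0.
    by rewrite [RHS]Pz y0 /par_b /par_d /par_e /par_f; ring.
  have z0 : z = 0.
    apply/eqP/negPn/negP => z_neq0; have x_neq0 : x != 0.
      apply: contraNneq z_neq0 => x0; move/eqP: Hx.
      by rewrite x0 mulr0 add0r !mulf_eq0 (negPf v0) orbb.
    have H1 := mulfI z_neq0 (etrans Hx (esym (mulr0 z))).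
    have H2 := mulfI x_neq0 (etrans Hz (esym (mulr0 x))).
    have : 3%:R * v * z == 0.
      apply/eqP; transitivity (2%:R * (E * F * x + 2%:R * v * z) - (2%:R * E * F * x + v * z)).
        by ring.
      by rewrite H1 H2; ring.
    by rewrite !mulf_eq0 (negPf v0) (negPf z_neq0) (negPf (nat_neq0 2)).
  have x0 : x = 0.
    by move/eqP: Hz; rewrite z0 mulr0 addr0 !mulf_eq0 (negPf E0) (negPf F0) /= orbb => /eqP.
  have Ht : 2%:R * t ^+ 2 = 0.
    transitivity (- (0 : K)); last exact: oppr0.
    rewrite [X in - X]Py x0 y0 z0 /par_b /par_d /par_e /par_f; ring.
  move/eqP: Ht; rewrite mulf_eq0 (negPf (nat_neq0 1)) expf_eq0 /= => /eqP t0.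
  by case/eqP: p0; apply: colP4; rewrite !mxE.
pose r := z / y; have Ez : z = r * y by rewrite divfK.
pose a := at_plane conic_a r 1; pose h := at_plane conic_h r 1.
pose g := at_plane conic_g r 1; pose k := at_plane conic_k r 1.
pose m := at_plane conic_m r 1; pose pz := at_plane vertex_z r 1.
have Qx : 2%:R * a * x + h * t + g * y = 0.
  apply: (mulfI y_neq0); rewrite mulr0 [RHS]Px Ez /a /h /g /at_plane /=.
  by rewrite /par_b /par_d /par_e /par_f; ring.
have Qt : h * x - 4%:R * t + k * y = 0.
  apply: (mulfI y_neq0); rewrite mulr0 [RHS]Pt Ez /h /k /at_plane /=.
  by rewrite /par_b /par_d /par_e /par_f; ring.
have Qy : g * x + k * t = 0.
  apply: (mulfI y_neq0); rewrite mulr0; apply: (mulfI (nat_neq0 2)); rewrite mulr0.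
  apply: (mulfI y_neq0); rewrite mulr0.
  (* The zeros stand for the partial derivatives. In the plane the cubic is y q with q the conic,
     and Euler's relation turns 2 (y P_y + z P_z) - (x P_x + t P_t) into 3 y^2 q_s, where q_s = g x
     + k t. *)
  transitivity (2%:R * (y * 0 + z * 0) - (x * 0 + t * 0) : K); last by ring.
  rewrite {1}Py {1}Pz {1}Px {1}Pt Ez /g /k /at_plane /=.
  by rewrite /par_b /par_d /par_e /par_f; ring.
have Ex : m * x = - (k * k) * y.
  transitivity (k * (h * x - 4%:R * t + k * y) + 4%:R * (g * x + k * t) - k ^+ 2 * y).
    by rewrite /m /h /g /k /at_plane /=; ring.
  by rewrite Qt Qy; ring.
have Et : m * t = k * g * y.
  transitivity (h * (g * x + k * t) - g * (h * x - 4%:R * t + k * y) + k * g * y).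
    by rewrite /m /h /g /k /at_plane /=; ring.
  by rewrite Qt Qy; ring.
(* The determinant of the linear equations [Qx], [Qt], [Qy], that is the discriminant of the conic,
   is four times this product. *)
have Dr : (r - 1) * (r - e) * (r - f) * (v ^+ 2 * r - w4) = 0.
  apply: (mulfI (nat_neq0 3)); rewrite mulr0; apply: (mulfI y_neq0); rewrite mulr0.
  transitivity (2%:R * a * (m * x) + h * (m * t) + m * g * y).
    rewrite Ex Et /m /a /h /g /k /w4 /at_plane /= /par_e /par_f; ring.
  by rewrite -[RHS](mulr0 m) -Qx; ring.
have pz0 : pz = 0.
  apply: (mulfI y_neq0); rewrite mulr0; apply: (mulfI y_neq0); rewrite mulr0.
  (* Multiplying by m^2 allows m x, m y, m t to be replaced by y times the coordinates of the
     vertex. *)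
  transitivity (m ^+ 2 * 0 : K); last exact: mulr0.
  rewrite Pz Ez.
  transitivity (par_b env * ((m * t - m * x) * (m * x)) + ((m * x) * (r * (m * y)) - (m * y) * (m * t)
      + (r * (m * y) + m * t) * (m * x))
    - par_d env * ((m * y - r * (m * y)) * (m * x) - ((m * x) * (r * (m * y)) + (m * y) * (m * t)))
    + (e + f) * ((m * x - m * y) * (m * x))
    - e * f * (2%:R * (m * x) * (r * (m * y)) - (m * x) * (m * t) + (m * y) * (m * t))); last by ring.
  rewrite Ex Et.
  pose X := - (k * k); pose T := k * g.
  have -> : pz = par_b env * (T - X) * X + (X * (r * m) - 1 * m * T + (r * m + T) * X)
    - par_d env * ((1 * m - r * m) * X - (X * (r * m) + 1 * m * T))
    + (e + f) * (X - 1 * m) * X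
    - e * f * (2%:R * X * (r * m) - X * T + 1 * m * T) by [].
  by rewrite /X /T; ring.
move/eqP: Dr; rewrite !mulf_eq0 !subr_eq0 -!orbA => /or4P[] /eqP Er.
- by case/eqP: z1; move: pz0; rewrite /pz Er.
- by case/eqP: z2; move: pz0; rewrite /pz Er.
- by case/eqP: z3; move: pz0; rewrite /pz Er.
(* [vertex_z] is homogeneous of degree 8 in (k1, k2), so passing from (r, 1) to (v^2 r, v^2) costs
   v^16. *)
case/eqP: z4; rewrite -Er -[RHS](mulr0 (v ^+ 16)) -pz0 /pz /at_plane /=; ring.
Qed.

End SmoothSurface.

(** The values of the variables 3 and 4 of an environment: the adjoined square roots themselves. *)
Definition al_be : seq quad := [:: (0, 1, 0, 0); (0, 0, 1, 0)]%Z.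

Definition smooth_check (m : nat) (places : seq (Z * Z)) (ts : seq quad) : bool :=
  all (fun i => nonvanishing m places (nth (0, 0, 0, 0)%Z (ts ++ al_be)) (nth 1%ex smoothness_conditions i))
    (iota 0 7).

Ltac cycles_of s :=
  let t := eval unfold s in s in
  lazymatch t with
  | perm_of_cycles ?cs => exact cs
  | ?s' => cycles_of s'
  end.

Definition cycles_g1 := ltac:(cycles_of g1).
Definition cycles_g1' := ltac:(cycles_of g1').
Definition cycles_g1'' := ltac:(cycles_of g1'').
Definition cycles_g2 := ltac:(cycles_of g2).
Definition cycles_h3 := ltac:(cycles_of h3).
Definition cycles_h4 := ltac:(cycles_of h4).
Definition cycles_g6 := ltac:(cycles_of g6).
Definition cycles_h6 := ltac:(cycles_of h6).
Definition cycles_k9 := ltac:(cycles_of k9).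
Definition cycles_g9' := ltac:(cycles_of g9').
Definition cycles_h9' := ltac:(cycles_of h9').
Definition cycles_g10 := ltac:(cycles_of g10).
Definition cycles_h10 := ltac:(cycles_of h10).
Definition cycles_g18 := ltac:(cycles_of g18).
Definition cycles_h18 := ltac:(cycles_of h18).

(** * Sample points, primes and certificates *)

Local Open Scope Z_scope.
(** Each list gives v, E, F at a point satisfying the equations of its family; for instance E F = 30
    = 2 v in [sample3], and v = 2, E F = 4 in [sample4]. *)
Definition sample1 : seq quad := [:: (3, 0, 0, 0); (5, 0, 0, 0); (7, 0, 0, 0)].
Definition sample1' : seq quad := [:: (0, -2, 0, 0); (0, 2, 0, 0); (1, 0, 0, 0)].
Definition sample1'' : seq quad := [:: (0, -2, 0, 0); (2, -2, -1, 1); (1, -1, -1, 0)].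
Definition sample2 : seq quad := [:: (2, 0, 0, 0); (5, 0, 0, 0); (7, 0, 0, 0)].
Definition sample3 : seq quad := [:: (15, 0, 0, 0); (6, 0, 0, 0); (5, 0, 0, 0)].
Definition sample4 : seq quad := [:: (2, 0, 0, 0); (-1, 0, 0, 0); (-4, 0, 0, 0)].
Definition sample6 : seq quad := [:: (-2, 0, 0, 0); (4, 0, 0, 0); (-1, 0, 0, 0)].
Definition sample9 : seq quad := [:: (-1, -1, 0, 0); (1, 1, 0, 0); (-2, 0, 0, 0)].
Definition sample9' : seq quad := [:: (0, 2, 0, 0); (1, 0, 0, 1); (0, 1, 1, 0)].
Definition sample10 : seq quad := [:: (2, 0, 0, 0); (3, -1, 0, 0); (3, 1, 0, 0)].
Definition sample18 : seq quad := [:: (2, 0, 0, 0); (1, 1, 0, 0); (1, -1, 0, 0)].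
Local Close Scope Z_scope.

(** All sign choices of the square roots modulo the prime of the certificate, a prime modulo which
    these roots exist. Rational samples take A = B = 0, with the single place (0, 0). *)
Definition places1 : seq (Z * Z) := [:: (0, 0)]%Z.
Definition places1' : seq (Z * Z) := [:: (23, 0); (30, 0)]%Z.
Definition places1'' : seq (Z * Z) := [:: (27, 32); (27, 41); (46, 32); (46, 41)]%Z.
Definition places2 : seq (Z * Z) := [:: (0, 0)]%Z.
Definition places3 : seq (Z * Z) := [:: (0, 0)]%Z.
Definition places4 : seq (Z * Z) := [:: (0, 0)]%Z.
Definition places6 : seq (Z * Z) := [:: (0, 0)]%Z.
Definition places9 : seq (Z * Z) := [:: (27, 0); (34, 0)]%Z.
Definition places9' : seq (Z * Z) := [:: (11, 8); (11, 53); (50, 8); (50, 53)]%Z.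
Definition places10 : seq (Z * Z) := [:: (8, 0); (51, 0)]%Z.
Definition places18 : seq (Z * Z) := [:: (27, 0); (34, 0)]%Z.

Lemma smooth1 : smooth_check 53 places1 sample1.
Proof. by vm_cast_no_check (erefl true). Qed.

Lemma certificate1 : certificate 53 (0) (0) places1 (sample1 ++ al_be)
  [:: cycles_g1] [:: M_g1]
  first_steps next_steps base_lines.
Proof. by vm_cast_no_check (erefl true). Qed.

Lemma smooth1' : smooth_check 53 places1' sample1'.
Proof. by vm_cast_no_check (erefl true). Qed.

Lemma certificate1' : certificate 53 (-1) (0) places1' (sample1' ++ al_be)
  [:: cycles_g1'] [:: M_g1']
  first_steps next_steps base_lines.
Proof. by vm_cast_no_check (erefl true). Qed.

Lemma smooth1'' : smooth_check 73 places1'' sample1''.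
Proof. by vm_cast_no_check (erefl true). Qed.

Lemma certificate1'' : certificate 73 (-1) (2) places1'' (sample1'' ++ al_be)
  [:: cycles_g1''] [:: M_g1'']
  first_steps next_steps base_lines.
Proof. by vm_cast_no_check (erefl true). Qed.

Lemma smooth2 : smooth_check 53 places2 sample2.
Proof. by vm_cast_no_check (erefl true). Qed.

Lemma certificate2 : certificate 53 (0) (0) places2 (sample2 ++ al_be)
  [:: cycles_g2; cycles_g1] [:: M_g2; M_g1]
  first_steps next_steps base_lines.
Proof. by vm_cast_no_check (erefl true). Qed.

Lemma smooth3 : smooth_check 53 places3 sample3.
Proof. by vm_cast_no_check (erefl true). Qed.

Lemma certificate3 : certificate 53 (0) (0) places3 (sample3 ++ al_be)
  [:: cycles_g1; cycles_h3] [:: M_g1; M_h3]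
  first_steps next_steps base_lines.
Proof. by vm_cast_no_check (erefl true). Qed.

Lemma smooth4 : smooth_check 53 places4 sample4.
Proof. by vm_cast_no_check (erefl true). Qed.

Lemma certificate4 : certificate 53 (0) (0) places4 (sample4 ++ al_be)
  [:: cycles_g1; cycles_h4] [:: M_g1; M_h4]
  first_steps next_steps base_lines.
Proof. by vm_cast_no_check (erefl true). Qed.

Lemma smooth6 : smooth_check 53 places6 sample6.
Proof. by vm_cast_no_check (erefl true). Qed.

Lemma certificate6 : certificate 53 (0) (0) places6 (sample6 ++ al_be)
  [:: cycles_g6; cycles_h6] [:: M_g6; M_h6]
  first_steps next_steps base_lines.
Proof. by vm_cast_no_check (erefl true). Qed.

Lemma smooth9 : smooth_check 61 places9 sample9.
Proof. by vm_cast_no_check (erefl true). Qed.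

Lemma certificate9 : certificate 61 (-3) (0) places9 (sample9 ++ al_be)
  [:: cycles_g1; cycles_h3; cycles_k9] [:: M_g1; M_h3; M_k9]
  first_steps next_steps base_lines.
Proof. by vm_cast_no_check (erefl true). Qed.

Lemma smooth9' : smooth_check 61 places9' sample9'.
Proof. by vm_cast_no_check (erefl true). Qed.

Lemma certificate9' : certificate 61 (-1) (3) places9' (sample9' ++ al_be)
  [:: cycles_g9'; cycles_h9'] [:: M_g9'; M_h9']
  first_steps next_steps base_lines.
Proof. by vm_cast_no_check (erefl true). Qed.

Lemma smooth10 : smooth_check 59 places10 sample10.
Proof. by vm_cast_no_check (erefl true). Qed.

Lemma certificate10 : certificate 59 (5) (0) places10 (sample10 ++ al_be)
  [:: cycles_g10; cycles_h10] [:: M_g10; M_h10]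
  first_steps next_steps base_lines.
Proof. by vm_cast_no_check (erefl true). Qed.

Lemma smooth18 : smooth_check 61 places18 sample18.
Proof. by vm_cast_no_check (erefl true). Qed.

Lemma certificate18 : certificate 61 (-3) (0) places18 (sample18 ++ al_be)
  [:: cycles_g18; cycles_h18] [:: M_g18; M_h18]
  first_steps next_steps base_lines.
Proof. by vm_cast_no_check (erefl true). Qed.

(** * From points of the moduli to families *)

Section Scaling.
Variables (K : closedFieldType) (k : K).
Hypothesis k0 : k != 0.
Implicit Types (F : {mpoly K[4]}) (b c d e f : K).

Let k2 : k ^+ 2 != 0. Proof. by rewrite expf_neq0. Qed.

Lemma cubic_scale b c d e f :
  cubic (k * b) (k * c) (k * d) (k * e) (k * f) = k ^+ 2 *: cubic b c d e f.
Proof.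
have dist (p q r s t : {mpoly K[4]}) : k ^+ 2 *: (p + q - r + s - t) =
    k ^+ 2 *: p + k ^+ 2 *: q - k ^+ 2 *: r + k ^+ 2 *: s - k ^+ 2 *: t.
  by rewrite !(scalerBr, scalerDr).
rewrite /cubic dist !scalerA.
by congr (_ + _ - _ + _ - _); congr (_ *: _); ring.
Qed.

Lemma on_surface_scale F v : on_surface (k ^+ 2 *: F) v <-> on_surface F v.
Proof.
rewrite /on_surface /eval_at mevalZ; split=> -[v0 Hv]; split=> //.
  by apply: (mulfI k2); rewrite Hv mulr0.
by rewrite Hv mulr0.
Qed.

Lemma smooth_scale F : smooth F -> smooth (k ^+ 2 *: F).
Proof.
move=> HF v /on_surface_scale/HF[i Hi]; exists i.
by rewrite /eval_at mderivZ mevalZ mulf_neq0.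
Qed.

Lemma line_of_scale F l : line_of (k ^+ 2 *: F) l <-> line_of F l.
Proof.
split=> -[dl Hl]; split=> // v Hv v0; first by apply/on_surface_scale/Hl.
by apply/on_surface_scale; apply: Hl.
Qed.

Lemma in_stab_scale F M : in_stab (k ^+ 2 *: F) M <-> in_stab F M.
Proof.
split=> -[Mu HM]; split=> // v; split.
- by move=> /on_surface_scale/HM[w /on_surface_scale ? ->]; exists w.
- by move=> [w Hw ->]; apply/on_surface_scale/HM; exists w => //; apply/on_surface_scale.
- by move=> /on_surface_scale/HM[w ? ->]; exists w => //; apply/on_surface_scale.
by move=> [w /on_surface_scale Hw ->]; apply/on_surface_scale/HM; exists w.
Qed.

Lemma labelling_scale b c d e f N :
  labelling (k * b) (k * c) (k * d) (k * e) (k * f) N -> labelling b c d e f N.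
Proof.
case; rewrite cubic_scale => H1 H2 H3 H4 H5 H6 H7 H8 H9 H10; split=> //.
- by move=> i; apply/line_of_scale.
- by move=> l /line_of_scale/H3.
move=> A B; have [P [Q [u u0 [-> HE]]]] := H10.
(* The Plücker coordinates prescribed for E5 are homogeneous of degree 5 in the parameters. *)
exists P, Q, (u * k ^+ 5); first by rewrite mulf_neq0 ?expf_neq0.
split=> //; rewrite HE /A /B.
by congr [:: _; _; _; _; _; _]; ring.
Qed.

Lemma stab_is_scale (H : {set 'S_27}) b c d e f :
  stab_is H b c d e f -> stab_is H (k * b) (k * c) (k * d) (k * e) (k * f).
Proof.
move=> HS p N /labelling_scale/HS[S1 S2 S3]; rewrite /p cubic_scale; split.
- by move=> M /in_stab_scale/S1.
- by move=> M1 M2 s /in_stab_scale ? /in_stab_scale ?; apply: S2.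
by move=> s; rewrite -S3; split=> -[M HM ?]; exists M => //; apply/in_stab_scale.
Qed.

End Scaling.

Section Moduli.
Variables (K : closedFieldType) (al be : K).
Implicit Types (b c d e f : K).

Definition moduli b c d e f : nat -> K :=
  nth 0 [:: d / c - e * f / c ^+ 2 + 1; e / c + 1; f / c + 1; al; be].

Lemma moduli_params b c d e f (env := moduli b c d e f) : c != 0 -> Lambda1 b c d e f ->
  [/\ b = c * par_b env, d = c * par_d env, e = c * par_e env & f = c * par_f env].
Proof.
move=> c0 ->; rewrite /par_b /par_d /par_e /par_f /env /moduli /=.
by split; field.
Qed.

Lemma stab_is_moduli H b c d e f (env := moduli b c d e f) : c != 0 -> Lambda1 b c d e f ->
  stab_is H (par_b env) 1 (par_d env) (par_e env) (par_f env) -> stab_is H b c d e f.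
Proof.
move=> c0 L1 /(stab_is_scale c0); rewrite mulr1.
by have [<- <- <- <-] := moduli_params c0 L1.
Qed.

Lemma moduli_par (env : nat -> K) : env 3 = al -> env 4 = be -> (forall k, (4 < k)%N -> env k = 0) ->
  moduli (par_b env) 1 (par_d env) (par_e env) (par_f env) =1 env.
Proof.
move=> Hal Hbe H0 [|[|[|[|[|k]]]]]; rewrite /moduli /=.
- by rewrite expr1n !divr1 /par_d; ring.
- by rewrite divr1 /par_e; ring.
- by rewrite divr1 /par_f; ring.
- by rewrite Hal.
- by rewrite Hbe.
by rewrite nth_nil H0.
Qed.

(** A power of c clears denominators, so a condition on the moduli becomes, for c nonzero, the
    nonvanishing of a polynomial on K^5, as [zariski_open] requires. *)
Lemma ev_moduli_homogeneous x : exists q : {mpoly K[5]}, exists n, forall b c d e f, c != 0 ->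
  q.@[tnth [tuple b; c; d; e; f]] = c ^+ n * ev (moduli b c d e f) x.
Proof.
elim: x => [k|n|x [p [n Hp]] y [q [m Hq]]|x [p [n Hp]]|x [p [n Hp]] y [q [m Hq]]].
- pose C : {mpoly K[5]} := 'X_(inord 1); pose D : {mpoly K[5]} := 'X_(inord 2).
  pose E : {mpoly K[5]} := 'X_(inord 3); pose F : {mpoly K[5]} := 'X_(inord 4).
  exists (nth 0 [:: D * C - E * F + C ^+ 2; (E + C) * C; (F + C) * C; al *: C ^+ 2; be *: C ^+ 2] k), 2%N.
  move=> b c d e f c0.
  have ord5 i : (i < 5)%N -> forall t : 5.-tuple K, tnth t (inord i) = nth 0 t i.
    by move=> Hi t; rewrite (tnth_nth 0) inordK.
  case: k => [|[|[|[|[|k]]]]] /=; rewrite /C /D /E /F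
    ?(mevalB, mevalD, mevalM, mevalZ, mevalXU, rmorphXn) /= ?ord5 //= /moduli /=; [by field|by field|by field|ring|ring|].
  by rewrite !nth_nil meval0 mulr0.
- exists (n%:R)%:MP, 0%N => b c d e f c0; by rewrite mevalC mul1r.
- exists ('X_(inord 1) ^+ m * p + 'X_(inord 1) ^+ n * q), (n + m)%N => b c d e f c0.
  rewrite mevalD !mevalM !rmorphXn /= !mevalXU (tnth_nth 0) inordK //= Hp // Hq // exprD; ring.
- by exists (- p), n => b c d e f c0; rewrite mevalN Hp //= mulrN.
exists (p * q), (n + m)%N => b c d e f c0.
by rewrite mevalM Hp // Hq //= exprD; ring.
Qed.

Lemma generic_generically (P C : Defs.family K) (env0 : nat -> K) (D : (nat -> K) -> Prop) b0 c0 d0 e0 f0 :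
  (forall b c d e f, P b c d e f -> c != 0) -> generic env0 D ->
  P b0 c0 d0 e0 f0 -> moduli b0 c0 d0 e0 f0 =1 env0 ->
  (forall b c d e f, P b c d e f -> D (moduli b c d e f) -> C b c d e f) -> generically P C.
Proof.
move=> Pc [x x0 HD] P0 E0 HC; have [q [n Hq]] := ev_moduli_homogeneous x.
exists (fun p => q.@[tnth p] != 0); split.
- exists (fun q' => q' = q) => p; split=> [Hp|[_ ->] //]; by exists q.
- exists b0, c0, d0, e0, f0; split=> //; have c00 := Pc _ _ _ _ _ P0.
  by rewrite Hq // mulf_neq0 ?expf_neq0 // (eq_ev _ E0).
move=> b c d e f HP; have c0' := Pc _ _ _ _ _ HP.
by rewrite Hq // mulf_eq0 negb_or => /andP[_ /HD]; apply: HC.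
Qed.

End Moduli.

(** * The families *)

Section Families.
Variables (K : closedFieldType) (m : nat) (A B : Z) (places : seq (Z * Z)) (ts : seq quad).
Variables (css : seq (seq (seq nat))) (gm : seq (seq (seq ex) * ex)) (al be : K).
Hypotheses (char0 : [pchar K] =i pred0) (alE : al ^+ 2 = zR K A) (beE : be ^+ 2 = zR K B).

Definition sample_point : nat -> K := fun k => lin al be (nth (0, 0, 0, 0)%Z (ts ++ al_be) k).

Hypotheses (m_prime : prime m) (ts3 : size ts = 3%N) (smooth_ok : smooth_check m places ts).
Hypothesis certified : certificate m A B places (ts ++ al_be) css gm first_steps next_steps base_lines.

Local Notation H := <<[set x in perm_gens css]>>%G.

Lemma smooth_sample : smooth (surface sample_point).
Proof.
have /and5P[closed_places _ _ _ _] := certified.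
refine (smooth_surface char0 _) => i Hi.
apply: (nonvanishingP m_prime closed_places char0 alE beE).
by apply: (allP smooth_ok); rewrite mem_iota.
Qed.

Lemma sample_moduli (env := sample_point) :
  moduli al be (par_b env) 1 (par_d env) (par_e env) (par_f env) =1 env.
Proof.
have zR1 : zR K 1 = 1 by [].
have zR0 : zR K 0 = 0 by [].
apply: moduli_par => [||k Hk]; rewrite /env /sample_point.
- by rewrite nth_cat ts3 /= zR1 !zR0; ring.
- by rewrite nth_cat ts3 /= zR1 !zR0; ring.
by rewrite nth_default ?size_cat ?ts3 //= !zR0; ring.
Qed.

Theorem family_generically (P : Defs.family K) :
  (forall b c d e f, P b c d e f ->
    [/\ c != 0, Lambda1 b c d e f & symmetric_at css gm (moduli al be b c d e f)]) ->
  (let env := sample_point in smooth (surface env) ->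
   P (par_b env) 1 (par_d env) (par_e env) (par_f env)) ->
  generically P (stab_is H).
Proof.
move=> HP Hsample.
have G := generic_stabilizer m_prime stabilizer_base char0 alE beE certified.
apply: (generic_generically _ G (Hsample smooth_sample) sample_moduli).
  by move=> b c d e f /HP[].
move=> b c d e f /HP[c0 L1 sym] Hstab; apply: (stab_is_moduli c0 L1); exact: Hstab.
Qed.

(** The moduli of all members equal the sample point, where the generic witness is nonzero. The
    factor [c] in the existence part is for a family that prescribes c, while the sample is
    normalized to c = 1. *)
Theorem family_single_surface (P : Defs.family K) :
  (forall b c d e f, P b c d e f -> let env := moduli al be b c d e f in
    [/\ c != 0, Lambda1 b c d e f, symmetric_at css gm env & env =1 sample_point]) ->
  (let env := sample_point in smooth (surface env) -> exists c,
   P (c * par_b env) (c * 1) (c * par_d env) (c * par_e env) (c * par_f env)) ->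
  for_the_surface P (stab_is H).
Proof.
move=> HP Hsample; split.
  by have [c Hc] := Hsample smooth_sample; do 5!eexists; exact: Hc.
move=> b c d e f /HP[c0 L1 sym E].
have [x x0 Hx] := generic_stabilizer m_prime stabilizer_base char0 alE beE certified.
apply: (stab_is_moduli (al := al) (be := be) c0 L1); apply: Hx => //.
by rewrite (eq_ev _ E).
Qed.

End Families.

(** * The eleven families at their sample points *)

Section SquareRoots.
Variables (K : closedFieldType).
Hypothesis char0 : [pchar K] =i pred0.

Let nat_neq0 n : n.+1%:R != 0 :> K. Proof. by rewrite ((pcharf0P K).1 char0). Qed.

Lemma par_Lambda1 (env : nat -> K) : Lambda1 (par_b env) 1 (par_d env) (par_e env) (par_f env).
Proof. by rewrite /Lambda1 divr1 expr1n /par_b. Qed.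

Lemma zR_numerals :
  (zR K 0 = 0) * (zR K 1 = 1) * (zR K 2 = 2%:R) * (zR K 3 = 3%:R) * (zR K 4 = 4%:R) * (zR K 5 = 5%:R)
  * (zR K 6 = 6%:R) * (zR K 7 = 7%:R) * (zR K 15 = 15%:R)
  * (zR K (-1) = -1) * (zR K (-2) = - 2%:R) * (zR K (-4) = - 4%:R) * (zR K (-3) = - 3%:R).
Proof. by []. Qed.

Lemma moduli_sample (al be : K) q0 q1 q2 b c d e f (env := moduli al be b c d e f) :
  env 0%N = lin al be q0 -> env 1%N = lin al be q1 -> env 2%N = lin al be q2 ->
  env =1 sample_point [:: q0; q1; q2] al be.
Proof.
move=> H0 H1 H2 [|[|[|[|[|k]]]]]; rewrite ?H0 ?H1 ?H2 //= /sample_point /env /moduli /=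
  ?zR_numerals ?nth_nil /= ?zR_numerals; ring.
Qed.

Ltac sample :=
  match goal with e := sample_point _ _ _ |- _ => rewrite /e end;
  rewrite /par_b /par_d /par_e /par_f /sample_point /= !zR_numerals !mul0r !addr0
    ?expr1n ?mulr1 ?mul1r ?divr1.
Ltac nonzero :=
  repeat match goal with H : is_true (_ != 0) |- _ => rewrite ?H /=; clear H end;
  rewrite ?oppr_eq0 ?oner_eq0 ?nat_neq0 //.
Ltac member := rewrite /moduli /=; field; nonzero.

Let rational : 0 ^+ 2 = zR K 0. Proof. by rewrite expr0n. Qed.

Theorem stab_Se1 : generically (Se1 (K := K))
  (stab_is <<[set x in perm_gens [:: cycles_g1]]>>%G).
Proof.
have prime_m : prime 53 by [].
refine (family_generically char0 rational rational prime_m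
  (erefl _ : size sample1 = 3%N) smooth1 certificate1 _ _).
  move=> b c d e f [[c0 _] L1]; split=> // -[|k] // _; exact: semi_invariant_g1.
move=> env Hs; split; last exact: par_Lambda1.
by split; rewrite ?oner_eq0.
Qed.

Theorem stab_Se2 : generically (Se2 (K := K))
  (stab_is <<[set x in perm_gens [:: cycles_g2; cycles_g1]]>>%G).
Proof.
have prime_m : prime 53 by [].
refine (family_generically char0 rational rational prime_m
  (erefl _ : size sample2 = 3%N) smooth2 certificate2 _ _).
  move=> b c d e f [[c0 _] L1 Hd]; split=> // -[|[|k]] // _; last exact: semi_invariant_g1.
  by apply: semi_invariant_g2; rewrite Hd; member.
move=> env Hs; split; [by split; rewrite ?oner_eq0|exact: par_Lambda1|].
by sample; ring.
Qed.

Theorem stab_Se3 : generically (Se3 (K := K))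
  (stab_is <<[set x in perm_gens [:: cycles_g1; cycles_h3]]>>%G).
Proof.
have prime_m : prime 53 by [].
refine (family_generically char0 rational rational prime_m
  (erefl _ : size sample3 = 3%N) smooth3 certificate3 _ _).
  move=> b c d e f [[c0 _] [L1 Hd]]; split=> // -[|[|k]] // _; first exact: semi_invariant_g1.
  by apply: semi_invariant_h3; rewrite Hd; member.
move=> env Hs; split; [by split; rewrite ?oner_eq0|split; [exact: par_Lambda1|]].
by sample; field; nonzero.
Qed.

Theorem stab_Se4 : generically (Se4 (K := K))
  (stab_is <<[set x in perm_gens [:: cycles_g1; cycles_h4]]>>%G).
Proof.
have prime_m : prime 53 by [].
refine (family_generically char0 rational rational prime_m
  (erefl _ : size sample4 = 3%N) smooth4 certificate4 _ _).
  move=> b c d e f [[c0 _] [[L1 Hd] ce Hf]]; split=> // -[|[|k]] // _; first exact: semi_invariant_g1.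
  by apply: semi_invariant_h4; rewrite ?Hd Hf; member.
move=> env Hs; split;
  [by split; rewrite ?oner_eq0|split; [split; [exact: par_Lambda1|]| |]]; sample.
- by field; nonzero.
- have -> : 1 + (-1 - 1) = -1 :> K by ring.
  by rewrite oppr_eq0 oner_eq0.
by field; nonzero.
Qed.

Theorem stab_Se6 : generically (Se6 (K := K))
  (stab_is <<[set x in perm_gens [:: cycles_g6; cycles_h6]]>>%G).
Proof.
have prime_m : prime 53 by [].
refine (family_generically char0 rational rational prime_m
  (erefl _ : size sample6 = 3%N) smooth6 certificate6 _ _).
  move=> b c d e f [[c0 _] [L1 Hd] ce Hf]; split=> // -[|[|k]] // _;
    [apply: semi_invariant_g6|apply: semi_invariant_h6]; rewrite ?Hd Hf; member.
move=> env Hs; split; [by split; rewrite ?oner_eq0|split; [exact: par_Lambda1|]| |]; sample.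
- by field; nonzero.
- have -> : 1 + (4%:R - 1) = 4%:R :> K by ring.
  exact: nat_neq0.
by field; nonzero.
Qed.

(** Applied with [y] a product of conjugates of [x], so that [z] is a nonzero integer. *)
Lemma neq0_of_mul (x y z : K) : x * y = z -> z != 0 -> x != 0.
Proof. by move=> <-; rewrite mulf_eq0 negb_or => /andP[]. Qed.

Section Gauss.
Variables (i1 r2 r3 r5 : K).
Hypotheses (i1E : i1 ^+ 2 = -1) (r2E : r2 ^+ 2 = 2%:R) (r3E : r3 ^+ 2 = 3%:R) (r5E : r5 ^+ 2 = 5%:R).

Let m3E : (i1 * r3) ^+ 2 = zR K (-3). Proof. by rewrite exprMn i1E r3E mulN1r. Qed.

Theorem stab_Se1' : generically (Se1' i1)
  (stab_is <<[set x in perm_gens [:: cycles_g1']]>>%G).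
Proof.
have prime_m : prime 53 by [].
refine (family_generically char0 (i1E : _ = zR K (-1)) rational prime_m
  (erefl _ : size sample1' = 3%N) smooth1' certificate1' _ _).
  move=> b c d e f [[c0 _] L1 cf He Hd]; split=> // -[|k] // _.
  have cf0 : c - f != 0 by rewrite subr_eq0.
  have fc0 : f - c != 0 by rewrite subr_eq0 eq_sym.
  apply: semi_invariant_g1' => //; rewrite ?Hd He /moduli /=.
    by field: i1E; nonzero.
  by field: i1E; nonzero.
move=> env Hs; split; [by split; rewrite ?oner_eq0|exact: par_Lambda1| | |]; sample.
- by rewrite subrr oner_eq0.
- by field: i1E; nonzero.
- by field: i1E; nonzero.
Qed.

Theorem stab_Se9 : generically (Se9 i1 r3)
  (stab_is <<[set x in perm_gens [:: cycles_g1; cycles_h3; cycles_k9]]>>%G).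
Proof.
have prime_m : prime 61 by [].
refine (family_generically char0 m3E rational prime_m
  (erefl _ : size sample9 = 3%N) smooth9 certificate9 _ _).
  move=> b c d e f [[c0 _] [[L1 Hd] He]]; split=> // -[|[|[|k]]] // _; first exact: semi_invariant_g1.
    by apply: semi_invariant_h3; rewrite Hd; member.
  apply: (semi_invariant_k9 (k := (f / c + 1) / 2%:R)) => //; rewrite ?Hd ?He; member.
move=> env Hs; split;
  [by split; rewrite ?oner_eq0|split; [split; [exact: par_Lambda1|]|]]; sample.
  field: (m3E : _ = - 3%:R); nonzero.
field; nonzero.
Qed.

Theorem stab_Se10 : for_the_surface (Se10 r5)
  (stab_is <<[set x in perm_gens [:: cycles_g10; cycles_h10]]>>%G).
Proof.
have prime_m : prime 59 by [].
refine (family_single_surface char0 (r5E : _ = zR K 5) rational prime_m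
  smooth10 certificate10 _ _).
  move=> b c d e f [[c0 _] [[L1 Hd] ce Hf] He] env.
  (* The equation of f gives f / c = (1 + r5) / (3 - r5), which is 2 + r5; hence E and F are
     conjugate. *)
  have fE : f = (2%:R + r5) * c by apply: (mulIf ce); rewrite Hf mulfVK // He; ring: r5E.
  have v2 : env 0%N = 2%:R by rewrite /env Hd fE He /moduli /=; field: r5E; nonzero.
  have E2 : env 1%N = 3%:R - r5 by rewrite /env He; member.
  have F2 : env 2%N = 3%:R + r5 by rewrite /env fE; member.
  split=> //; first by move=> [|[|k]] // _; [exact: semi_invariant_g10|exact: semi_invariant_h10].
  by apply: moduli_sample; rewrite -/env ?v2 ?E2 ?F2 /= !zR_numerals; ring.
move=> env Hs; exists 1; rewrite !mul1r; split;
  [by split; rewrite ?oner_eq0|split; [split; [exact: par_Lambda1|]| |]|]; sample.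
- by field: r5E; nonzero.
- by apply: (neq0_of_mul (y := 3%:R + r5) (z := 4%:R)); [ring: r5E|nonzero].
- have H : 3%:R - r5 != 0 by apply: (neq0_of_mul (y := 3%:R + r5) (z := 4%:R)); [ring: r5E|nonzero].
  by field: r5E; rewrite -?[X in X != 0](_ : 3%:R - r5 = _) //; ring.
by ring.
Qed.

Theorem stab_Se18 : for_the_surface (Se18 i1 r3)
  (stab_is <<[set x in perm_gens [:: cycles_g18; cycles_h18]]>>%G).
Proof.
have prime_m : prime 61 by [].
have s2 : (i1 * r3) ^+ 2 = - 3%:R := m3E.
refine (family_single_surface char0 m3E rational prime_m
  smooth18 certificate18 _ _).
  move=> b c d e f [[c0 _] [[L1 Hd] ce Hf] He] env.
  have fE : f = - (i1 * r3) * c by apply: (mulIf ce); rewrite Hf mulfVK // He; ring: s2.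
  have v2 : env 0%N = 2%:R by rewrite /env Hd fE He /moduli /=; field: s2; nonzero.
  have E2 : env 1%N = 1 + i1 * r3 by rewrite /env He; member.
  have F2 : env 2%N = 1 - i1 * r3 by rewrite /env fE; member.
  split=> //; first by move=> [|[|k]] // _; [exact: semi_invariant_g18|exact: semi_invariant_h18].
  by apply: moduli_sample; rewrite -/env ?v2 ?E2 ?F2 /= !zR_numerals; ring.
have H : 1 + i1 * r3 != 0 by apply: (neq0_of_mul (y := 1 - i1 * r3) (z := 4%:R)); [ring: s2|nonzero].
move=> env Hs; exists 1; rewrite !mul1r; split;
  [by split; rewrite ?oner_eq0|split; [split; [exact: par_Lambda1|]| |]|]; sample.
- by field: s2; nonzero.
- by rewrite [X in X != 0](_ : _ = 1 + i1 * r3) //; ring.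
- by field: s2; rewrite -?[X in X != 0](_ : 1 + i1 * r3 = _) //; ring.
by ring.
Qed.

Theorem stab_Se9' : for_the_surface (Se9' i1 r3)
  (stab_is <<[set x in perm_gens [:: cycles_g9'; cycles_h9']]>>%G).
Proof.
have prime_m : prime 61 by [].
refine (family_single_surface char0 (i1E : _ = zR K (-1)) (r3E : _ = zR K 3) prime_m
  smooth9' certificate9' _ _).
  move=> b c d e f [[c0 _] [[L1 Hd] He] Hf c1] env.
  (* The cube of i1 - r3 is 8 i1. *)
  have fE : f = i1 + r3 - 1 by rewrite Hf; field: i1E r3E; nonzero.
  have v2 : env 0%N = 2%:R * i1 by rewrite /env Hd fE He c1 /moduli /=; field: i1E r3E; nonzero.
  have E2 : env 1%N = 1 + i1 * r3 by rewrite /env He; member.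
  have F2 : env 2%N = i1 + r3 by rewrite /env fE c1 /moduli /= divr1; ring.
  split=> //; first by move=> [|[|k]] // _; [exact: semi_invariant_g9'|exact: semi_invariant_h9'].
  by apply: moduli_sample; rewrite -/env ?v2 ?E2 ?F2 /= !zR_numerals; ring.
move=> env Hs; exists 1; rewrite !mul1r; split=> //;
  [by split; rewrite ?oner_eq0|split; [split; [exact: par_Lambda1|]|]|]; sample.
- by field: i1E r3E; nonzero.
- by ring.
by field: i1E r3E; nonzero.
Qed.

Theorem stab_Se1'' : for_the_surface (Se1'' i1 r2)
  (stab_is <<[set x in perm_gens [:: cycles_g1'']]>>%G).
Proof.
have prime_m : prime 73 by [].
(* This explains f = 3: since c = i1 - r2, the ratio f / c is - i1 - r2. *)
have cq : (i1 - r2) * (- i1 - r2) = 3%:R by ring: i1E r2E.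
have c0 : i1 - r2 != 0 by apply: (neq0_of_mul cq); nonzero.
(* This is (c - f) / c; the product of its four conjugates is 8. *)
have q1 : 1 + i1 + r2 != 0.
  by apply: (neq0_of_mul (y := (1 + i1 - r2) * (- 2%:R * i1 - 2%:R)) (z := 8%:R)); [ring: i1E r2E|nonzero].
refine (family_single_surface char0 (i1E : _ = zR K (-1)) (r2E : _ = zR K 2) prime_m
  smooth1'' certificate1'' _ _).
  move=> b c d e f [[[_ _] L1 cf He Hd] cE Hf] env; rewrite -{}cE in c0 cq.
  have fE : f = (- i1 - r2) * c by rewrite Hf -cq mulrC.
  have q2 : c - f != 0 by rewrite subr_eq0.
  have eE : e = (2%:R * i1 - 1) * c
      * (5%:R - (4%:R * i1 - 3%:R) * (- i1 - r2)) / (5%:R * (1 + i1 + r2)).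
    by rewrite He fE; field; rewrite ?c0 ?nat_neq0 ?q1 /= -fE.
  have dE : d = - (2%:R * i1 + 1) * c
      * (5%:R - (4%:R * i1 + 8%:R) * (- i1 - r2) - 5%:R * (- i1 - r2) ^+ 2) / (5%:R * (1 + i1 + r2)).
    by rewrite Hd fE; field; rewrite ?c0 ?nat_neq0 ?q1 /= -fE subr_eq0 eq_sym.
  have v2 : env 0%N = - 2%:R * i1 by rewrite /env dE fE eE /moduli /=; field: i1E r2E; nonzero.
  have E2 : env 1%N = 2%:R - 2%:R * i1 - r2 + i1 * r2 by rewrite /env eE /moduli /=; field: i1E r2E; nonzero.
  have F2 : env 2%N = 1 - i1 - r2 by rewrite /env fE; member.
  split=> //; first by move=> [|k] // _; exact: semi_invariant_g1''.
  by apply: moduli_sample; rewrite -/env ?v2 ?E2 ?F2 /= !zR_numerals; ring.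
move=> env Hs; exists (i1 - r2); split; rewrite ?mulr1 //.
- split.
  + by split=> //; rewrite -{2}[i1 - r2]mulr1 cubic_scale; apply: smooth_scale.
  + by rewrite /Lambda1 /par_b; field.
  + rewrite -subr_eq0; sample.
    by rewrite [X in X != 0](_ : _ = (i1 - r2) * (1 + i1 + r2)) ?mulf_neq0 //; ring.
  + sample; rewrite [X in _ / X](_ : _ = 5%:R * ((i1 - r2) * (1 + i1 + r2))); last by ring.
    by field: i1E r2E; nonzero.
  sample; rewrite [X in _ / X](_ : _ = - (5%:R * ((i1 - r2) * (1 + i1 + r2)))); last by ring.
  by field: i1E r2E; rewrite oppr_eq0 !mulf_neq0 ?nat_neq0.
by sample; ring: i1E r2E.
Qed.

End Gauss.
End SquareRoots.

Local Open Scope nat_scope.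

(** * Groups given by tables *)

Record faithful_action (gT : finGroupType) n (to : gT -> nat -> nat) : Prop := FaithfulAction {
  fact1 : forall i, i < n -> to 1%g i = i;
  factM : forall x y i, to (x * y)%g i = to y (to x i);
  fact_lt : forall x i, to x i < n;
  fact_inj : forall x, (forall i, i < n -> to x i = i) -> x = 1%g
}.

Section Tables.
Variables (gT : finGroupType) (n : nat) (to : gT -> nat -> nat).
Hypothesis toP : faithful_action n to.

Definition tabulates (x : gT) (t : seq nat) : Prop := [seq to x i | i <- iota 0 n] = t.

Lemma tabulates_nth x t i : tabulates x t -> i < n -> nth 0 t i = to x i.
Proof. by move=> <- Hi; rewrite (nth_map 0) ?size_iota // nth_iota. Qed.

Lemma tabulates_inj x y t : tabulates x t -> tabulates y t -> x = y.
Proof.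
move=> Hx Hy; apply/eqP; rewrite eq_mulgV1; apply/eqP/(fact_inj toP) => i Hi.
by rewrite (factM toP) -(tabulates_nth Hx Hi) (tabulates_nth Hy Hi) -(factM toP) mulgV (fact1 toP).
Qed.

Lemma tabulates1 : tabulates 1 (iota 0 n).
Proof.
rewrite /tabulates -[RHS]map_id; apply/eq_in_map => i.
by rewrite mem_iota => /andP[_ Hi]; rewrite (fact1 toP).
Qed.

Lemma tabulatesM x y s t : tabulates x s -> tabulates y t -> tabulates (x * y) (act t s).
Proof.
move=> <- Hy; rewrite /tabulates /act -map_comp; apply: eq_map => i /=.
by rewrite (tabulates_nth Hy) ?(fact_lt toP) // (factM toP).
Qed.

Definition tables (gs : seq gT) (gl : seq (seq nat)) : Prop :=
  size gs = size gl /\ forall k, k < size gs -> tabulates (nth 1%g gs k) (nth [::] gl k).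

Definition word (gs : seq gT) (w : seq nat) : gT := (\prod_(k <- w) nth 1%g gs k)%g.
Definition word_table (gl : seq (seq nat)) (w : seq nat) : seq nat :=
  foldl (fun s k => act (nth [::] gl k) s) (iota 0 n) w.

Definition letters (A : Type) (s : seq A) (ws : seq (seq nat)) : bool :=
  all (all (fun k => k < size s)) ws.

Lemma word_tabulates gs gl w : tables gs gl -> all (fun k => k < size gl) w ->
  tabulates (word gs w) (word_table gl w).
Proof.
move=> [Es Ht]; rewrite /word /word_table; elim/last_ind: w => [|w k IH].
  by rewrite big_nil => _; exact: tabulates1.
rewrite all_rcons => /andP[Hk Hw]; rewrite big_rcons /= foldl_rcons.
by apply: tabulatesM; [exact: IH|apply: Ht; rewrite Es].
Qed.

Lemma word_in (G : {group gT}) gs w : {subset gs <= G} -> word gs w \in G.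
Proof.
move=> Hgs; apply: group_prod => k _.
by have [Hk|Hk] := ltnP k (size gs); [apply/Hgs/mem_nth|rewrite nth_default].
Qed.

Definition words (gs : seq gT) (ws : seq (seq nat)) : seq gT := [seq word gs w | w <- ws].
Definition word_tables (gl : seq (seq nat)) (ws : seq (seq nat)) := [seq word_table gl w | w <- ws].

Lemma words_tables gs gl ws : tables gs gl -> letters gl ws -> tables (words gs ws) (word_tables gl ws).
Proof.
move=> Ht /allP Hws; split=> [|k]; rewrite !size_map // => Hk.
rewrite (nth_map [::]) // (nth_map [::]) //; apply: word_tabulates => //.
by apply: Hws; apply: mem_nth.
Qed.

(** By faithfulness the orbit of the tuple of all points is regular, so its length is the order of
    the group. *)
Definition order_check (gl : seq (seq nat)) (N : nat) : bool :=
  let orb := orbit_list gl (iota 0 n) in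
  [&& orbit_closed gl orb, iota 0 n \in orb, uniq orb & size orb == N].

Lemma tables_action gs gl : tables gs gl -> size gs = size gl /\
  forall k i, k < size gs -> i < n -> to (nth 1%g gs k) i = nth 0 (nth [::] gl k) i.
Proof. by move=> [Es Ht]; split=> // k i Hk Hi; rewrite (tabulates_nth (Ht k Hk)). Qed.

Let small : all (fun i => i < n) (iota 0 n). Proof. by apply/allP=> i; rewrite mem_iota. Qed.

Theorem card_tables gs gl N : tables gs gl -> order_check gl N -> #|<<[set x in gs]>>| = N.
Proof.
move=> /tables_action gsP /and4P[Hc Hin Hu /eqP <-].
apply: (card_orbit_list (fact1 toP) (factM toP) (fact_lt toP) gsP small (erefl _)).
  by move=> x _ Hx; apply: (fact_inj toP) => i Hi; apply: Hx; rewrite mem_iota.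
by apply/and3P.
Qed.

(** The orbit of the tuple of all points lists the tables of the elements, so a common element of
    the two subgroups shows up in both orbits. *)
Definition meet_check (gl1 gl2 : seq (seq nat)) : bool :=
  let o1 := orbit_list gl1 (iota 0 n) in let o2 := orbit_list gl2 (iota 0 n) in
  [&& orbit_closed gl1 o1, iota 0 n \in o1, orbit_closed gl2 o2, iota 0 n \in o2
    & all (fun t => (t \in o2) ==> (t == iota 0 n)) o1].

Lemma meet_tables gs1 gs2 gl1 gl2 : tables gs1 gl1 -> tables gs2 gl2 -> meet_check gl1 gl2 ->
  <<[set x in gs1]>> :&: <<[set x in gs2]>> = 1%g.
Proof.
move=> /tables_action P1 /tables_action P2 /and5P[c1 i1 c2 i2 /allP disj].
apply/trivgP/subsetP=> x /setIP[x1 x2]; rewrite inE; apply/eqP.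
have m1 := mem_closed_orbit (fact1 toP) (factM toP) (fact_lt toP) P1 small c1 i1 x1.
have m2 := mem_closed_orbit (fact1 toP) (factM toP) (fact_lt toP) P2 small c2 i2 x2.
by apply: (tabulates_inj (t := iota 0 n)) tabulates1; apply/eqP/(implyP (disj _ m1)).
Qed.

(* [conj] writes the conjugates of the generators of K by those of H, and [gen] the
   elements of gs, as words in the generators of K, resp. of K and H. *)
Definition split_check (gl : seq (seq nat)) (wsK wsH : seq (seq nat))
    (conj : seq (seq (seq nat))) (gen : seq (seq nat)) : bool :=
  let wordK v := flatten [seq nth [::] wsK k | k <- v] in
  let wordKH v := flatten [seq nth [::] (wsK ++ wsH) k | k <- v] in
  [&& letters gl wsK, letters gl wsH, meet_check (word_tables gl wsK) (word_tables gl wsH),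
    all (fun i => all (fun j =>
      word_table gl (nth [::] wsK j ++ nth [::] wsH i)
      == word_table gl (nth [::] wsH i ++ wordK (nth [::] (nth [::] conj i) j)))
      (iota 0 (size wsK))) (iota 0 (size wsH))
  & all (fun k => nth [::] gl k == word_table gl (wordKH (nth [::] gen k))) (iota 0 (size gl))].

Lemma word_cat gs u v : word gs (u ++ v) = (word gs u * word gs v)%g.
Proof. exact: big_cat. Qed.

Lemma word_flatten gs ws v : word gs (flatten [seq nth [::] ws k | k <- v]) = word (words gs ws) v.
Proof.
elim: v => [|k v IH] /=; first by rewrite /word !big_nil.
rewrite word_cat IH {3}/word big_cons; congr (_ * _)%g.
have [Hk|Hk] := ltnP k (size ws); first by rewrite (nth_map [::]).
by rewrite !nth_default ?size_map // /word big_nil.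
Qed.

Lemma letters_flatten (A : Type) (s : seq A) ws v : letters s ws ->
  all (fun k => k < size s) (flatten [seq nth [::] ws k | k <- v]).
Proof.
move=> /allP Hws; elim: v => [|k v IH] //=; rewrite all_cat IH andbT.
have [Hk|Hk] := ltnP k (size ws); first by apply: Hws; apply: mem_nth.
by rewrite nth_default.
Qed.

Theorem sdprod_tables gs gl wsK wsH conj gen
  (G : {group gT} := <<[set x in gs]>>%G)
  (A : {group gT} := <<[set x in words gs wsK]>>%G) (B : {group gT} := <<[set x in words gs wsH]>>%G) :
  tables gs gl -> split_check gl wsK wsH conj gen -> (A ><| B)%g = G.
Proof.
move=> Ht /and5P[LK LH HAB /allP Hconj /allP Hgen].
have [Es Ht'] := Ht.
have inA x : x \in words gs wsK -> x \in A by move=> Hx; apply: mem_gen; rewrite inE.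
have inB x : x \in words gs wsH -> x \in B by move=> Hx; apply: mem_gen; rewrite inE.
have inG x : x \in gs -> x \in G by move=> Hx; apply: mem_gen; rewrite inE.
have nAB : B \subset 'N(A).
  rewrite gen_subG; apply/subsetP=> h; rewrite inE => /(nthP 1%g)[i]; rewrite size_map => Hi <-.
  rewrite inE -genJ gen_subG; apply/subsetP=> z /imsetP[x].
  rewrite inE => /(nthP 1%g)[j]; rewrite size_map => Hj <- {z}->.
  rewrite !(nth_map [::]) //.
  have := Hconj i; rewrite mem_iota => /(_ Hi)/allP/(_ j); rewrite mem_iota => /(_ Hj)/eqP.
  set v := nth [::] (nth [::] conj i) j => E.
  have LKj : all (fun k => k < size gl) (nth [::] wsK j) by apply: (allP LK); apply: mem_nth.
  have LHi : all (fun k => k < size gl) (nth [::] wsH i) by apply: (allP LH); apply: mem_nth.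
  (* Normality is checked as x h = h x', an equality of words without inverses. *)
  have Ec : word gs (nth [::] wsK j ++ nth [::] wsH i)
      = word gs (nth [::] wsH i ++ flatten [seq nth [::] wsK k | k <- v]).
    apply: (tabulates_inj (word_tabulates Ht _)); first by rewrite all_cat LKj.
    by rewrite E; apply: word_tabulates => //; rewrite all_cat LHi; apply: letters_flatten.
  by rewrite conjgE -word_cat Ec word_cat mulKg word_flatten; apply: word_in => y /inA.
have AG : A \subset G.
  by rewrite gen_subG; apply/subsetP=> x; rewrite inE => /mapP[w _ ->]; apply: word_in => y /inG.
have BG : B \subset G.
  by rewrite gen_subG; apply/subsetP=> x; rewrite inE => /mapP[w _ ->]; apply: word_in => y /inG.
have GE : (A * B)%g = G.
  rewrite -norm_joinEr //; apply/eqP; rewrite eqEsubset join_subG AG BG /= gen_subG.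
  apply/subsetP=> x; rewrite inE => /(nthP 1%g)[k Hk <-].
  have := Hgen k; rewrite mem_iota -Es => /(_ Hk)/eqP E.
  rewrite (_ : nth 1%g gs k = word (words gs (wsK ++ wsH)) (nth [::] gen k)).
    apply: word_in => y; rewrite /words map_cat mem_cat => /orP[/inA|/inB].
      exact: (subsetP (joing_subl A B)).
    exact: (subsetP (joing_subr A B)).
  rewrite -word_flatten; apply: (tabulates_inj (Ht' k Hk)); rewrite E.
  by apply: word_tabulates => //; apply: letters_flatten; rewrite /letters all_cat; apply/andP.
by rewrite sdprodE //; apply: meet_tables HAB; apply: words_tables.
Qed.

End Tables.

Local Open Scope ring_scope.

Local Open Scope nat_scope.

(** * Symmetric, cyclic and product groups as table groups *)

Definition perm_act n (s : 'S_n.+1) (i : nat) : nat := s (inord i).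

Lemma perm_act_faithful n : faithful_action n.+1 (@perm_act n).
Proof.
split=> [i Hi|x y i|x i|x Hx]; rewrite /perm_act.
- by rewrite perm1 inordK.
- by rewrite permM inord_val.
- exact: ltn_ord.
by apply/permP=> i; apply/val_inj; have := Hx i (ltn_ord i); rewrite /perm_act inord_val perm1.
Qed.

(** The regular action of 'Z_m; [(Zp_trunc m).+2] is the bound of its ordinal type, equal to m for m
    at least 2. *)
Definition translate m (x : 'Z_m) (i : nat) : nat := (x + i) %% (Zp_trunc m).+2.

Lemma translate_faithful m : faithful_action (Zp_trunc m).+2 (@translate m).
Proof.
split=> [i Hi|x y i|x i|x /(_ 0)]; rewrite /translate.
- by rewrite modn_small.
- by rewrite /= modnDmr modnDml addnA [y + x]addnC.
- exact: ltn_pmod.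
by rewrite addn0 modn_small // => /(_ isT) x0; apply/val_inj.
Qed.

(** The product group acts on the disjoint union, the second set being shifted by [n]. *)
Definition sum_act (gT rT : finGroupType) n (to : gT -> nat -> nat) (to' : rT -> nat -> nat)
  (x : gT * rT) (i : nat) : nat := if i < n then to x.1 i else n + to' x.2 (i - n).

Lemma sum_act_faithful (gT rT : finGroupType) n m (to : gT -> nat -> nat) (to' : rT -> nat -> nat) :
  faithful_action n to -> faithful_action m to' -> faithful_action (n + m) (sum_act n to to').
Proof.
move=> A B; split=> [i Hi|x y i|x i|[x y] Hxy]; rewrite /sum_act.
- case: (ltnP i n) => Hn; first by rewrite (fact1 A).
  by rewrite (fact1 B) ?subnKC // ltn_subLR.
- case: (ltnP i n) => Hn; first by rewrite (fact_lt A) (factM A).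
  by rewrite ltnNge leq_addr /= addKn (factM B).
- by case: (ltnP i n) => Hn; rewrite ?ltn_add2l ?(fact_lt B) // ltn_addr ?(fact_lt A).
congr pair.
  apply: (fact_inj A) => i Hi; have := Hxy i; rewrite /sum_act Hi => -> //; exact: ltn_addr.
apply: (fact_inj B) => i Hi; have := Hxy (n + i).
by rewrite /sum_act ltn_add2l [n + i < n]ltnNge leq_addr /= addKn => /(_ Hi)/addnI.
Qed.

Definition sum_table n (s t : seq nat) : seq nat := s ++ [seq n + i | i <- t].

Section SumTables.
Variables (gT rT : finGroupType) (n m : nat) (to : gT -> nat -> nat) (to' : rT -> nat -> nat).
Hypotheses (toP : faithful_action n to) (toP' : faithful_action m to').

Lemma sum_tabulates x y s t : tabulates n to x s -> tabulates m to' y t ->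
  tabulates (n + m) (sum_act n to to') (x, y) (sum_table n s t).
Proof.
move=> <- <-; rewrite /tabulates iotaD map_cat; congr cat.
  by apply/eq_in_map => i; rewrite mem_iota /sum_act => /andP[_ ->].
rewrite -map_comp add0n -{2}[n]addn0 iotaDl -map_comp; apply: eq_map => i /=.
by rewrite /sum_act ltnNge leq_addr /= addKn.
Qed.

Definition sum_tables (gl tl : seq (seq nat)) := [seq sum_table n p.1 p.2 | p <- zip gl tl].

Lemma prod_tables gs ts gl tl : tables n to gs gl -> tables m to' ts tl -> size gs = size ts ->
  tables (n + m) (sum_act n to to') (zip gs ts) (sum_tables gl tl).
Proof.
move=> [Eg Hg] [Et Ht] Egt.
have Ez : size (zip gs ts) = size gs by rewrite size_zip Egt minnn.
have Ez' : size (zip gl tl) = size gl by rewrite size_zip -Et -Egt Eg minnn.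
split=> [|k]; first by rewrite size_map Ez Ez'.
rewrite Ez => Hk; rewrite -[nth _ (zip gs ts) k]/(nth (1%g, 1%g) (zip gs ts) k) nth_zip //.
rewrite (nth_map ([::], [::])) ?Ez' -?Eg // nth_zip /= -?Eg ?Egt ?Et //.
by apply: sum_tabulates; [apply: Hg|apply: Ht; rewrite -Egt].
Qed.

Variables (gs : seq gT) (ts : seq rT) (gl tl : seq (seq nat)) (N : nat).
Hypotheses (gsP : tables n to gs gl) (tsP : tables m to' ts tl).

Definition isog_check : bool :=
  [&& size gl == size tl, order_check n gl N, order_check m tl N
    & order_check (n + m) (sum_tables gl tl) N].

(* The subgroup of gT * rT generated by corresponding pairs of generators projects
   onto both groups; as it has the order of either of them, it is the graph of an isomorphism. *)
Theorem isog_tables : isog_check -> <<[set x in gs]>> \isog <<[set x in ts]>>.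
Proof.
move=> /and4P[/eqP Est og ot ogt].
have Egt : size gs = size ts by rewrite gsP.1 tsP.1.
have zipP := prod_tables gsP tsP Egt.
pose G := <<[set x in zip gs ts]>>%G.
have oG : #|G| = N := card_tables (sum_act_faithful toP toP') zipP ogt.
have proj (aT : finGroupType) (f : {morphism [set: gT * rT] >-> aT}) (xs : seq aT) :
    [seq f p | p <- zip gs ts] = xs -> #|<<[set x in xs]>>| = N -> G \isog <<[set x in xs]>>.
  move=> Ef oxs; pose fG := restrm_morphism (subsetT G) f.
  have im : fG @* G = <<[set x in xs]>>.
    rewrite morphim_restrm setIid morphim_gen ?subsetT // morphimEsub ?subsetT //.
    congr <<_>>; apply/setP=> x; rewrite !inE -Ef.
    apply/imsetP/mapP => -[p]; first by rewrite inE => Hp ->; exists p.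
    by move=> Hp ->; exists p; rewrite ?inE.
  rewrite -im; apply: sub_isog => //; apply/injmP/imset_injP.
  by rewrite -morphimEdom im oxs oG.
apply: (isog_trans (G := <<[set x in gs]>>%G) (H := G)).
  rewrite isog_sym; apply: (proj _ (fst_morphism gT rT)); last exact: (card_tables toP gsP og).
  exact: (unzip1_zip (eq_leq Egt)).
apply: (proj _ (snd_morphism gT rT)); last exact: (card_tables toP' tsP ot).
exact: (unzip2_zip (eq_leq (esym Egt))).
Qed.

Corollary isog_setT : isog_check -> #|rT| = N ->
  <<[set x in gs]>> \isog [set: rT] /\ #|<<[set x in gs]>>| = N.
Proof.
move=> chk oT; have /and4P[_ og ot _] := chk; have iso := isog_tables chk.
have oG := card_tables toP gsP og; split=> //.
rewrite (_ : [set: rT] = <<[set x in ts]>>) //; apply/esym/eqP.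
by rewrite eqEcard subsetT cardsT oT; apply: eq_leq; apply: esym; exact: (card_tables toP' tsP ot).
Qed.

End SumTables.

Definition transpositions n (l : seq (nat * nat)) : 'S_n.+1 :=
  (\prod_(p <- l) tperm (inord p.1) (inord p.2))%g.
Definition transpositions_table n (l : seq (nat * nat)) : seq nat :=
  [seq foldl (fun x p => if x == p.1 then p.2 else if x == p.2 then p.1 else x) i l | i <- iota 0 n.+1].

Lemma transpositions_tabulate n l : all (fun p => (p.1 <= n) && (p.2 <= n)) l ->
  tabulates n.+1 (@perm_act n) (transpositions n l) (transpositions_table n l).
Proof.
have A := perm_act_faithful n.
move=> Hl; apply/eq_in_map => i; rewrite mem_iota => /andP[_ Hi].
elim: l Hl i Hi => [|[a b] l IH] /=; first by move=> _ i Hi; rewrite /transpositions big_nil (fact1 A).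
move=> /andP[/andP[Ha Hb] Hl] i Hi; rewrite /transpositions big_cons (factM A).
have -> : perm_act (tperm (inord a : 'I_n.+1) (inord b)) i = if i == a then b else if i == b then a else i.
  rewrite /perm_act; have Ei c : c <= n -> (i == c) = (inord i == inord c :> 'I_n.+1).
    by move=> Hc; rewrite -val_eqE /= !inordK.
  rewrite !Ei //; case: tpermP => [->|->|/eqP n1 /eqP n2].
  - by rewrite eqxx inordK.
  - by rewrite eqxx; case: eqP => [<-|_]; rewrite inordK.
  by rewrite (negPf n1) (negPf n2) inordK.
by apply: IH => //; case: ifP => // _; case: ifP.
Qed.

Definition translation_table m (k : nat) : seq nat :=
  [seq (k + i) %% (Zp_trunc m).+2 | i <- iota 0 (Zp_trunc m).+2].

Lemma translation_tabulates m k :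
  tabulates (Zp_trunc m).+2 (@translate m) (inZp k) (translation_table m k).
Proof. by apply: eq_map => i; rewrite /translate /= modnDml. Qed.

Lemma perm_gens_tables css : cycle_data css -> tables 27 (@perm_act 26) (perm_gens css) (list_gens css).
Proof.
move=> ok; have [Es E] := perm_gensP ok; split=> // k Hk.
have Hk' : k < size css by rewrite size_map in Hk.
have lines27 : size lines = 27 by vm_compute.
apply: (@eq_from_nth _ 0) => [|i]; rewrite size_map size_iota.
  by rewrite /list_gens (nth_map [::]) // size_map lines27.
move=> Hi; rewrite (nth_map 0) ?size_iota // nth_iota // add0n.
exact: E.
Qed.

Theorem sdprod_of_tables (gT : finGroupType) n (to : gT -> nat -> nat) gs gl wsK wsH conj gen oK oH
  (P Q : {group gT} -> Prop) : faithful_action n to -> tables n to gs gl ->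
  split_check n gl wsK wsH conj gen ->
  P <<[set x in words gs wsK]>>%G -> #|<<[set x in words gs wsK]>>| = oK ->
  Q <<[set x in words gs wsH]>>%G -> #|<<[set x in words gs wsH]>>| = oH ->
  sdprod_of P Q <<[set x in gs]>>%G /\ #|<<[set x in gs]>>| = oK * oH.
Proof.
move=> toP gsP chk PK cK QH cH; have E := sdprod_tables toP gsP chk; split.
  by exists <<[set x in words gs wsK]>>%G, <<[set x in words gs wsH]>>%G.
by rewrite -cK -cH (sdprod_card E).
Qed.

Local Open Scope ring_scope.

Local Open Scope nat_scope.

Lemma Z_tables m (ks : seq nat) :
  tables (Zp_trunc m).+2 (@translate m) [seq inZp k | k <- ks] [seq translation_table m k | k <- ks].
Proof.
split=> [|k]; rewrite !size_map // => Hk.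
by rewrite !(nth_map 0) //; apply: translation_tabulates.
Qed.

Lemma S_tables n (ls : seq (seq (nat * nat))) : all (all (fun p => (p.1 <= n) && (p.2 <= n))) ls ->
  tables n.+1 (@perm_act n) [seq transpositions n l | l <- ls] [seq transpositions_table n l | l <- ls].
Proof.
move=> /allP Hls; split=> [|k]; rewrite !size_map // => Hk.
by rewrite !(nth_map [::]) //; apply: transpositions_tabulate; apply: Hls; apply: mem_nth.
Qed.

Section Isomorphisms.
Variables (gT : finGroupType) (n : nat) (to : gT -> nat -> nat) (gs : seq gT) (gl : seq (seq nat)).
Hypotheses (toP : faithful_action n to) (gsP : tables n to gs gl).

Lemma cyclic_tables m ks :
  isog_check n (Zp_trunc m).+2 gl [seq translation_table m k | k <- ks] (Zp_trunc m).+2 ->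
  <<[set x in gs]>> \isog [set: 'Z_m] /\ #|<<[set x in gs]>>| = (Zp_trunc m).+2.
Proof.
by move=> chk; apply: (isog_setT toP (translate_faithful m) gsP (Z_tables m ks) chk); apply: card_ord.
Qed.

Lemma sym_tables m ls : all (all (fun p => (p.1 <= m) && (p.2 <= m))) ls ->
  isog_check n m.+1 gl [seq transpositions_table m l | l <- ls] m.+1`! ->
  <<[set x in gs]>> \isog [set: 'S_m.+1] /\ #|<<[set x in gs]>>| = m.+1`!.
Proof.
move=> okl chk; apply: (isog_setT toP (perm_act_faithful m) gsP (S_tables okl) chk).
by rewrite card_Sn.
Qed.

Lemma product_tables (aT rT : finGroupType) k m (toA : aT -> nat -> nat) (toR : rT -> nat -> nat)
    xs ts xl tl N : faithful_action k toA -> faithful_action m toR ->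
  tables k toA xs xl -> tables m toR ts tl -> size xs = size ts ->
  isog_check n (k + m) gl (sum_tables k xl tl) N -> #|{: aT * rT}| = N ->
  <<[set x in gs]>> \isog [set: aT * rT] /\ #|<<[set x in gs]>>| = N.
Proof.
move=> A R xsP tsP Ext chk.
exact: (isog_setT toP (sum_act_faithful A R) gsP (prod_tables xsP tsP Ext) chk).
Qed.

Lemma Z2_tables m k xs ts : size xs = size ts ->
  isog_check n ((Zp_trunc m).+2 + (Zp_trunc k).+2) gl
    (sum_tables (Zp_trunc m).+2 [seq translation_table m x | x <- xs] [seq translation_table k t | t <- ts])
    ((Zp_trunc m).+2 * (Zp_trunc k).+2) ->
  <<[set x in gs]>> \isog [set: 'Z_m * 'Z_k] /\ #|<<[set x in gs]>>| = (Zp_trunc m).+2 * (Zp_trunc k).+2.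
Proof.
move=> Ext chk.
apply: (product_tables (translate_faithful m) (translate_faithful k) (Z_tables m xs) (Z_tables k ts) _ chk).
  by rewrite !size_map.
by rewrite card_prod !card_ord.
Qed.

End Isomorphisms.

(** * Isomorphism types of the eleven groups *)

Local Notation S27 := (perm_act_faithful 26).

Lemma structure1 (G := <<[set x in perm_gens [:: cycles_g1]]>>) :
  G \isog [set: 'Z_2] /\ #|G| = 2.
Proof.
have ok : cycle_data [:: cycles_g1] by vm_compute.
by apply: (cyclic_tables (m := 2) (ks := [:: 1]) S27 (perm_gens_tables ok)); vm_compute.
Qed.

Lemma structure1' (G := <<[set x in perm_gens [:: cycles_g1']]>>) :
  G \isog [set: 'Z_4] /\ #|G| = 4.
Proof.
have ok : cycle_data [:: cycles_g1'] by vm_compute.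
by apply: (cyclic_tables (m := 4) (ks := [:: 1]) S27 (perm_gens_tables ok)); vm_compute.
Qed.

Lemma structure1'' (G := <<[set x in perm_gens [:: cycles_g1'']]>>) :
  G \isog [set: 'Z_8] /\ #|G| = 8.
Proof.
have ok : cycle_data [:: cycles_g1''] by vm_compute.
by apply: (cyclic_tables (m := 8) (ks := [:: 1]) S27 (perm_gens_tables ok)); vm_compute.
Qed.

Lemma structure2 (G := <<[set x in perm_gens [:: cycles_g2; cycles_g1]]>>) :
  G \isog [set: 'Z_2 * 'Z_2] /\ #|G| = 4.
Proof.
have ok : cycle_data [:: cycles_g2; cycles_g1] by vm_compute.
by apply: (Z2_tables (m := 2) (k := 2) (xs := [:: 1; 0]) (ts := [:: 0; 1]) S27 (perm_gens_tables ok)); vm_compute.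
Qed.

(** [ls] lists the images of the generators: a transposition for g3 and a 3-cycle for h3. *)
Lemma structure3 (G := <<[set x in perm_gens [:: cycles_g1; cycles_h3]]>>) :
  G \isog [set: 'S_3] /\ #|G| = 6.
Proof.
have ok : cycle_data [:: cycles_g1; cycles_h3] by vm_compute.
by apply: (sym_tables (m := 2) (ls := [:: [:: (1, 2)]; [:: (0, 1); (0, 2)]])
  S27 (perm_gens_tables ok)); vm_compute.
Qed.

(** g4 corresponds to a transposition of 'S_3, and h4, of order 6, to the pair of the generator of
    'Z_2 and a 3-cycle. *)
Lemma structure4 (G := <<[set x in perm_gens [:: cycles_g1; cycles_h4]]>>) :
  G \isog [set: 'Z_2 * 'S_3] /\ #|G| = 12.
Proof.
have ok : cycle_data [:: cycles_g1; cycles_h4] by vm_compute.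
have okl : all (all (fun p => (p.1 <= 2) && (p.2 <= 2))) [:: [:: (1, 2)]; [:: (0, 1); (0, 2)]] by [].
refine (product_tables S27 (perm_gens_tables ok) (translate_faithful 2) (perm_act_faithful 2)
  (Z_tables 2 [:: 0; 1]) (S_tables okl) _ _ _);
  [by []|by vm_compute|by rewrite card_prod card_ord card_Sn].
Qed.

Lemma structure6 (G := <<[set x in perm_gens [:: cycles_g6; cycles_h6]]>>) :
  G \isog [set: 'S_4] /\ #|G| = 24.
Proof.
have ok : cycle_data [:: cycles_g6; cycles_h6] by vm_compute.
by apply: (sym_tables (m := 3) (ls := [:: [:: (2, 3)]; [:: (0, 1); (0, 2); (0, 3)]])
  S27 (perm_gens_tables ok)); vm_compute.
Qed.

Lemma structure10 (G := <<[set x in perm_gens [:: cycles_g10; cycles_h10]]>>) :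
  G \isog [set: 'S_5] /\ #|G| = 120.
Proof.
have ok : cycle_data [:: cycles_g10; cycles_h10] by vm_compute.
by apply: (sym_tables (m := 4) (ls := [:: [:: (3, 4)]; [:: (0, 1); (0, 2); (0, 3); (0, 4)]])
  S27 (perm_gens_tables ok)); vm_compute.
Qed.

Section Extensions.
Variables (gs : seq 'S_27) (gl : seq (seq nat)).
Hypothesis gsP : tables 27 (@perm_act 26) gs gl.

(** The Heisenberg group of order 27: conjugation by the third generator fixes the first, which is
    central, and multiplies the second by it. *)
Lemma heisenberg_tables :
  split_check 27 gl [:: [:: 0]; [:: 1]] [:: [:: 2]] [:: [:: [:: 0]; [:: 0; 1]]] [:: [:: 0]; [:: 1]; [:: 2]] ->
  isog_check 27 6 (word_tables 27 gl [:: [:: 0]; [:: 1]])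
    (sum_tables 3 [seq translation_table 3 x | x <- [:: 1; 0]] [seq translation_table 3 t | t <- [:: 0; 1]]) 9 ->
  isog_check 27 3 (word_tables 27 gl [:: [:: 2]]) [seq translation_table 3 k | k <- [:: 1]] 3 ->
  sdprod_of (fun A => A \isog [set: 'Z_3 * 'Z_3]) (fun A => A \isog [set: 'Z_3]) <<[set x in gs]>>%G /\ #|<<[set x in gs]>>| = 27.
Proof.
move=> chk c9 c3; have /and3P[LK LH _] := chk.
have [iK oK] := Z2_tables (m := 3) (k := 3) (xs := [:: 1; 0]) (ts := [:: 0; 1])
  S27 (words_tables S27 gsP LK) (erefl _) c9.
have [iH oH] := cyclic_tables (m := 3) (ks := [:: 1]) S27 (words_tables S27 gsP LH) c3.
by apply: (sdprod_of_tables S27 gsP chk _ oK _ oH); [exact: iK|exact: iH].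
Qed.

End Extensions.

Lemma structure9 (G := <<[set x in perm_gens [:: cycles_g1; cycles_h3; cycles_k9]]>>%G) :
  sdprod_of (sdprod_of (fun A => A \isog [set: 'Z_3 * 'Z_3]) (fun A => A \isog [set: 'Z_3]))
    (fun A => A \isog [set: 'Z_2]) G /\ #|G| = 54.
Proof.
have ok : cycle_data [:: cycles_g1; cycles_h3; cycles_k9] by vm_compute.
have gsP := perm_gens_tables ok; set gl := list_gens _ in gsP.
(* The letters 0, 1, 2 are g9, h9, k9. The word g9 k9 g9 k9 is the central element a of the
   Heisenberg group; conjugation by g9 fixes a, inverts h9 and sends k9 to a k9^2. *)
have chk : split_check 27 gl [:: [:: 0; 2; 0; 2]; [:: 1]; [:: 2]] [:: [:: 0]]
  [:: [:: [:: 0]; [:: 1; 1]; [:: 0; 2; 2]]] [:: [:: 3]; [:: 1]; [:: 2]] by vm_compute.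
have /and3P[LK LH _] := chk.
have [|||sK oK] := heisenberg_tables (words_tables S27 gsP LK); [by vm_compute..|].
have [|iH oH] := cyclic_tables (m := 2) (ks := [:: 1]) S27 (words_tables S27 gsP LH); first by vm_compute.
by apply: (sdprod_of_tables S27 gsP chk _ oK _ oH); [exact: sK|exact: iH].
Qed.

Lemma structure9' (G := <<[set x in perm_gens [:: cycles_g9'; cycles_h9']]>>%G) :
  sdprod_of (sdprod_of (fun A => A \isog [set: 'Z_3 * 'Z_3]) (fun A => A \isog [set: 'Z_3]))
    (fun A => A \isog [set: 'Z_4]) G /\ #|G| = 108.
Proof.
have ok : cycle_data [:: cycles_g9'; cycles_h9'] by vm_compute.
have gsP := perm_gens_tables ok; set gl := list_gens _ in gsP.
(* The third word is the conjugate of h9' by g9', and the first is the central element; g9'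
   generates the complement of order 4. *)
have chk : split_check 27 gl [:: [:: 0; 0; 1; 0; 0; 1]; [:: 1]; [:: 0; 0; 0; 1; 0]] [:: [:: 0]]
  [:: [:: [:: 0]; [:: 2]; [:: 0; 1; 1]]] [:: [:: 3]; [:: 1]] by vm_compute.
have /and3P[LK LH _] := chk.
have [|||sK oK] := heisenberg_tables (words_tables S27 gsP LK); [by vm_compute..|].
have [|iH oH] := cyclic_tables (m := 4) (ks := [:: 1]) S27 (words_tables S27 gsP LH); first by vm_compute.
by apply: (sdprod_of_tables S27 gsP chk _ oK _ oH); [exact: sK|exact: iH].
Qed.

Lemma structure18 (G := <<[set x in perm_gens [:: cycles_g18; cycles_h18]]>>%G) :
  sdprod_of (fun A => A \isog [set: 'Z_3 * 'Z_3 * 'Z_3]) (fun A => A \isog [set: 'S_4]) G /\ #|G| = 648.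
Proof.
have ok : cycle_data [:: cycles_g18; cycles_h18] by vm_compute.
have gsP := perm_gens_tables ok; set gl := list_gens _ in gsP.
(* The two generators of the complement, which become a 4-cycle and a transposition of 'S_4, permute
   the three generators of the normal subgroup up to inversion. *)
have chk : split_check 27 gl [:: [:: 0; 1; 0; 1]; [:: 1; 0; 1; 0]; [:: 1; 1; 0; 1; 0; 1; 1]]
  [:: [:: 0; 0; 1; 0]; [:: 0; 1; 0; 1; 0; 1]]
  [:: [:: [:: 2]; [:: 1; 1]; [:: 0; 0]]; [:: [:: 0]; [:: 2; 2]; [:: 1; 1]]]
  [:: [:: 1; 3; 0; 4; 1; 3]; [:: 0; 4; 1; 3]] by vm_compute.
have /and3P[LK LH _] := chk.
have Z33 := prod_tables (Z_tables 3 [:: 1; 0; 0]) (Z_tables 3 [:: 0; 1; 0]) (erefl _).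
have [|||iK oK] := product_tables (N := 27) S27 (words_tables S27 gsP LK)
  (sum_act_faithful (translate_faithful 3) (translate_faithful 3)) (translate_faithful 3)
  Z33 (Z_tables 3 [:: 0; 0; 1]).
- by [].
- by vm_compute.
- by rewrite !card_prod !card_ord.
have okl : all (all (fun p => (p.1 <= 3) && (p.2 <= 3))) [:: [:: (0, 1); (0, 2); (0, 3)]; [:: (2, 3)]] by [].
have [|iH oH] := sym_tables S27 (words_tables S27 gsP LH) okl; first by vm_compute.
by apply: (sdprod_of_tables S27 gsP chk _ oK _ oH); [exact: iK|exact: iH].
Qed.

Local Open Scope ring_scope.

Lemma gens1 c : [set x in perm_gens [:: c]] = [set perm_of_cycles c].
Proof. by apply/setP=> x; rewrite !inE. Qed.
Lemma gens2 c1 c2 : [set x in perm_gens [:: c1; c2]] = [set perm_of_cycles c1; perm_of_cycles c2].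
Proof. by apply/setP=> x; rewrite !inE. Qed.
Lemma gens3 c1 c2 c3 : [set x in perm_gens [:: c1; c2; c3]] =
  [set perm_of_cycles c1; perm_of_cycles c2; perm_of_cycles c3].
Proof. by apply/setP=> x; rewrite !inE orbA. Qed.

Theorem mainTheorem3 (K : closedFieldType) (char0 : [pchar K] =i pred0)
  (i1 r2 r3 r5 : K) (i1E : i1 ^+ 2 = -1) (r2E : r2 ^+ 2 = 2%:R)
  (r3E : r3 ^+ 2 = 3%:R) (r5E : r5 ^+ 2 = 5%:R) :
  let H1 := <<[set g1]>>%G in
  let H1' := <<[set g1']>>%G in
  let H1'' := <<[set g1'']>>%G in
  let H2 := <<[set g2; h2]>>%G in
  let H3 := <<[set g3; h3]>>%G in
  let H4 := <<[set g4; h4]>>%G in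
  let H6 := <<[set g6; h6]>>%G in
  let H9 := <<[set g9; h9; k9]>>%G in
  let H9' := <<[set g9'; h9']>>%G in
  let H10 := <<[set g10; h10]>>%G in
  let H18 := <<[set g18; h18]>>%G in
  (* Se_1 *)
  [/\ generically (Se1 (K := K)) (stab_is H1),
      H1 \isog [set: 'Z_2] & #|H1| = 2%N] /\
  (* Se_1' *)
  [/\ generically (Se1' i1) (stab_is H1'),
      H1' \isog [set: 'Z_4] & #|H1'| = 4%N] /\
  (* Se_1'' *)
  [/\ for_the_surface (Se1'' i1 r2) (stab_is H1''),
      H1'' \isog [set: 'Z_8] & #|H1''| = 8%N] /\
  (* Se_2 *)
  [/\ generically (Se2 (K := K)) (stab_is H2),
      H2 \isog [set: 'Z_2 * 'Z_2] & #|H2| = 4%N] /\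
  (* Se_3 *)
  [/\ generically (Se3 (K := K)) (stab_is H3),
      H3 \isog [set: 'S_3] & #|H3| = 6%N] /\
  (* Se_4 *)
  [/\ generically (Se4 (K := K)) (stab_is H4),
      H4 \isog [set: 'Z_2 * 'S_3] & #|H4| = 12%N] /\
  (* Se_6 *)
  [/\ generically (Se6 (K := K)) (stab_is H6),
      H6 \isog [set: 'S_4] & #|H6| = 24%N] /\
  (* Se_9 *)
  [/\ generically (Se9 i1 r3) (stab_is H9),
      sdprod_of (sdprod_of (fun A => A \isog [set: 'Z_3 * 'Z_3])
                           (fun A => A \isog [set: 'Z_3]))
                (fun A => A \isog [set: 'Z_2]) H9
    & #|H9| = 54%N] /\
  (* Se_9' *)
  [/\ for_the_surface (Se9' i1 r3) (stab_is H9'),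
      sdprod_of (sdprod_of (fun A => A \isog [set: 'Z_3 * 'Z_3])
                           (fun A => A \isog [set: 'Z_3]))
                (fun A => A \isog [set: 'Z_4]) H9'
    & #|H9'| = 108%N] /\
  (* Se_10 *)
  [/\ for_the_surface (Se10 r5) (stab_is H10),
      H10 \isog [set: 'S_5] & #|H10| = 120%N] /\
  (* Se_18 *)
  [/\ for_the_surface (Se18 i1 r3) (stab_is H18),
      sdprod_of (fun A => A \isog [set: 'Z_3 * 'Z_3 * 'Z_3])
                (fun A => A \isog [set: 'S_4]) H18
    & #|H18| = 648%N].
Proof.
move=> H1 H1' H1'' H2 H3 H4 H6 H9 H9' H10 H18.
have E1 : <<[set x in perm_gens [:: cycles_g1]]>>%G = H1 by apply/val_inj; rewrite /= gens1.
have E1' : <<[set x in perm_gens [:: cycles_g1']]>>%G = H1' by apply/val_inj; rewrite /= gens1.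
have E1'' : <<[set x in perm_gens [:: cycles_g1'']]>>%G = H1'' by apply/val_inj; rewrite /= gens1.
have E2 : <<[set x in perm_gens [:: cycles_g2; cycles_g1]]>>%G = H2 by apply/val_inj; rewrite /= gens2.
have E3 : <<[set x in perm_gens [:: cycles_g1; cycles_h3]]>>%G = H3 by apply/val_inj; rewrite /= gens2.
have E4 : <<[set x in perm_gens [:: cycles_g1; cycles_h4]]>>%G = H4 by apply/val_inj; rewrite /= gens2.
have E6 : <<[set x in perm_gens [:: cycles_g6; cycles_h6]]>>%G = H6 by apply/val_inj; rewrite /= gens2.
have E9 : <<[set x in perm_gens [:: cycles_g1; cycles_h3; cycles_k9]]>>%G = H9 by apply/val_inj; rewrite /= gens3.
have E9' : <<[set x in perm_gens [:: cycles_g9'; cycles_h9']]>>%G = H9' by apply/val_inj; rewrite /= gens2.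
have E10 : <<[set x in perm_gens [:: cycles_g10; cycles_h10]]>>%G = H10 by apply/val_inj; rewrite /= gens2.
have E18 : <<[set x in perm_gens [:: cycles_g18; cycles_h18]]>>%G = H18 by apply/val_inj; rewrite /= gens2.
rewrite -E1 -E1' -E1'' -E2 -E3 -E4 -E6 -E9 -E9' -E10 -E18.
split; first by have [? ?] := structure1; split=> //; exact: (stab_Se1 char0).
split; first by have [? ?] := structure1'; split=> //; exact: (stab_Se1' char0 i1E).
split; first by have [? ?] := structure1''; split=> //; exact: (stab_Se1'' char0 i1E r2E).
split; first by have [? ?] := structure2; split=> //; exact: (stab_Se2 char0).
split; first by have [? ?] := structure3; split=> //; exact: (stab_Se3 char0).
split; first by have [? ?] := structure4; split=> //; exact: (stab_Se4 char0).
split; first by have [? ?] := structure6; split=> //; exact: (stab_Se6 char0).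
split; first by have [? ?] := structure9; split=> //; exact: (stab_Se9 char0 i1E r3E).
split; first by have [? ?] := structure9'; split=> //; exact: (stab_Se9' char0 i1E r3E).
split; first by have [? ?] := structure10; split=> //; exact: (stab_Se10 char0 r5E).
by have [? ?] := structure18; split=> //; exact: (stab_Se18 char0 i1E r3E).
Qed.
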